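(* Let $\alpha\ge1$ and let $m_\alpha\in[-3,-2]$ be the unique non-zero solution of \[ (m+1)^{2\alpha}(m+1)-\bigl((2\alpha+1)m+1\bigr)=0. \] Let $q_0=(x_0,y_0)\in\mathbb{G}_\alpha$ with $x_0\neq0$ and let $q\in\mathbb{G}_\alpha$ lie on the same horizontal line. We have that \[ \beta_t(q_0,q)\ge t^N\quad\text{for all }t\in[0,1] \] if and only if \[ N\ge 2\left[\frac{(\alpha+1)m_\alpha+1}{m_\alpha+1}\right]. \]
   Context: Convention: for real $a$, $a^{2\alpha}$ means $(a^2)^\alpha=|a|^{2\alpha}$. The $\alpha$-Grushin plane $\mathbb{G}_\alpha$ ($\alpha\ge1$) is $\mathbb{R}^2$ with the sub-Riemannian structure generated by the vector fields $X=\partial_x$ and $Y_\alpha=|x|^\alpha\partial_y$. A curve $\gamma=(x,y):[0,T]\to\mathbb{R}^2$ is horizontal if it is Lipschitz and there are $L^2$ functions $a,b$ with $\dot\gamma=aX(\gamma)+bY_\alpha(\gamma)$ almost everywhere; its length is $\int_0^T\|\dot\gamma\|\,dt$, where $\|w\|$ is the minimum of $\sqrt{a^2+b^2}$ over all $(a,b)$ with $w=aX+bY_\alpha$ at the point. The distance $\mathrm{d}_\alpha$ between two points is the infimum of lengths of horizontal curves joining them. $\mathbb{G}_\alpha$ is equipped with $\mathrm{d}_\alpha$ and the Lebesgue measure $\mathcal{L}^2$. A constant speed minimising geodesic is a constant speed horizontal curve whose length equals the distance between its endpoints. Two points lie on the same horizontal line if they have the same $y$-coordinate. Distortion coefficient: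 for $p,p'\in\mathbb{G}_\alpha$ and $t\in[0,1]$, \[\beta_t(p,p')=\limsup_{r\to0^+}\frac{\mathcal{L}^2(Z_t(p,B_r(p')))}{\mathcal{L}^2(B_r(p'))},\] where $B_r(p')$ is the $\mathrm{d}_\alpha$-ball of radius $r$ centred at $p'$ and $Z_t(p,B)$ is the set of points $\gamma(t)$ for $\gamma:[0,1]\to\mathbb{G}_\alpha$ a constant speed minimising geodesic with $\gamma(0)=p$, $\gamma(1)\in B$ (outer measure is used if the set is not measurable).
   Formalization: For one fixed q the equivalence fails (q = q_0, α = 1: β_t = t^2, yet the threshold is 5), so the inequality β_t(q_0,q) ≥ t^N is required for all q on the horizontal line of q_0 as well as all t; this condition is equivalent to the stated bound on N, for each q_0. *)

(* Defs.v *)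
From HB Require Import structures.
From mathcomp Require Import all_boot all_order all_algebra.
From mathcomp Require Import all_classical all_reals all_analysis.
Import Order.TTheory GRing.Theory Num.Theory.
Import numFieldNormedType.Exports.

Set Implicit Arguments.
Unset Strict Implicit.
Unset Printing Implicit Defensive.

Local Open Scope classical_set_scope.
Local Open Scope ring_scope.

(* The carrier of the Grushin plane is [R * R], with first coordinate [x] and
   second coordinate [y].  Curves are total functions [R -> R * R]; only their
   values on [`[0, T]] matter. *)

Definition fieldX (R : realType) (p : R * R) : R * R := (1, 0).

Definition fieldY (R : realType) (alpha : R) (p : R * R) : R * R :=
  (0, `|p.1| `^ alpha).

Definition square_integrable (R : realType) (T : R) (f : R -> R) : Prop :=
  measurable_fun `[0, T] f /\
  (@lebesgue_measure R).-integrable `[0, T] (fun t => (f t ^+ 2)%:E).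

Definition horizontal (R : realType) (alpha T : R) (g : R -> R * R) : Prop :=
  [lipschitz g t | t in `[0, T]] /\
  exists a b : R -> R,
    [/\ square_integrable T a, square_integrable T b &
      {ae @lebesgue_measure R, forall t, t \in `[0, T] ->
        is_derive t 1 g (a t *: fieldX (g t) + b t *: fieldY alpha (g t))}].

(* [+oo] when [w] is not in the span of the two fields at [p]; otherwise the
   infimum is attained. *)
Definition grushin_norm (R : realType) (alpha : R) (p w : R * R) : \bar R :=
  ereal_inf [set (Num.sqrt (ab.1 ^+ 2 + ab.2 ^+ 2))%:E | ab in
    [set ab : R * R | w = ab.1 *: fieldX p + ab.2 *: fieldY alpha p]].

(* For horizontal [g] the integrand is almost everywhere equal to a measurable
   function; on the remaining null set its value is irrelevant. *)
Definition curve_length (R : realType) (alpha T : R) (g : R -> R * R) : \bar R :=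
  \int[@lebesgue_measure R]_(t in `[0, T]) grushin_norm alpha (g t) (derive1 g t).

Definition grushin_dist (R : realType) (alpha : R) (p q : R * R) : \bar R :=
  ereal_inf [set l | exists T g,
    [/\ 0 < T, horizontal alpha T g, g 0 = p, g T = q &
        l = curve_length alpha T g]].

Definition grushin_ball (R : realType) (alpha : R) (p : R * R) (r : R) :
    set (R * R) :=
  [set q | (grushin_dist alpha p q < r%:E)%E].

Definition constant_speed (R : realType) (alpha T : R) (g : R -> R * R) : Prop :=
  exists c : R, {ae @lebesgue_measure R, forall t, t \in `[0, T] ->
    grushin_norm alpha (g t) (derive1 g t) = c%:E}.

Definition minimising_geodesic (R : realType) (alpha T : R) (g : R -> R * R) :
    Prop :=
  [/\ horizontal alpha T g, constant_speed alpha T g &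
      curve_length alpha T g = grushin_dist alpha (g 0) (g T)].

Definition intermediate_points (R : realType) (alpha t : R) (p : R * R)
    (B : set (R * R)) : set (R * R) :=
  [set z | exists g, [/\ minimising_geodesic alpha 1 g, g 0 = p, B (g 1) &
                         z = g t]].

(* The outer measure induced by the two-dimensional Lebesgue measure on Borel
   sets; it agrees with the latter on measurable sets. *)
Definition area (R : realType) (A : set (R * R)) : \bar R :=
  mu_ext (@lebesgue_measure R \x @lebesgue_measure R)%E A.

Definition distortion (R : realType) (alpha t : R) (p q : R * R) : \bar R :=
  limf_esup (fun r : R =>
    (area (intermediate_points alpha t p (grushin_ball alpha q r)) /
     area (grushin_ball alpha q r))%E) (0 : R)^'+.

(* Main.v *)
Require Import Defs.
From HB Require Import structures.
From mathcomp Require Import all_boot all_order all_algebra.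
From mathcomp Require Import all_classical all_reals all_analysis.
From mathcomp Require Import measurable_realfun.
From mathcomp Require Import ring lra.
Import Order.TTheory GRing.Theory Num.Theory.
Import numFieldNormedType.Exports.

Set Implicit Arguments.
Unset Strict Implicit.
Unset Printing Implicit Defensive.

Local Open Scope classical_set_scope.
Local Open Scope ring_scope.

(** Fix the horizontal line through [(x0, y0)] with direction [s = 1] or [-1],
    and put [h r = |x0 + s r|^alpha] and [I r = \int_0^r h^2].  A geodesic from
    [(x0, y0)] with small conserved vertical momentum [v] does not turn back: it
    is the graph over the line of the height [Y_v r = \int_0^r v h^2 / q], reached
    at time [P_v r = \int_0^r 1 / q], where [q = sqrt (1 - v^2 h^2)].  The 1-form
    [v dy + s q dx] calibrates it, so it is minimising, and unique between its end
    points.  In the coordinates [(P_v r, v)] passing to intermediate points is a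
    homothety of the first coordinate; letting [v] tend to [0], the distortion at
    the point of the line at distance [rho] is [t I (t rho) / I rho].  It is
    therefore at least [t^N] for all [rho] and [t] if and only if [N] bounds the
    logarithmic derivative [1 + rho h^2(rho) / I rho].  As [I] is explicit, the
    supremum of the latter is [1 + u^(2 alpha)], attained at the point of abscissa
    [- u x0], where [u = - (m_alpha + 1)].

    For [q = q0], the geodesics above cover all directions but a thin cone around
    the vertical, so [B_(t r)] is contained in [Z_t (q0, B_r)] up to a small
    proportion.  A distortion smaller than [t^2] would then make the area of
    [B_(t^k r)] decrease faster than [t^(2 k)], whereas the area of [B_r] is at
    least [c r^2]. *)

(** * Lebesgue area of fibrewise expanding images *)

(** Two obstacles shape the argument. The sets [Z_t] are arbitrary and [area] is an outer measure,
    so areas are not compared through a Jacobian. Every map used moves a single coordinate, is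
    increasing in it, and has difference quotients between two positive constants; such maps distort
    outer area by factors between these constants. The two constants need not agree: they only have
    to merge when the momentum tends to zero, and this is what [grushin_kappa] measures. The weight
    need not be smooth at [x = 0], while the extremal target lies beyond that line. The target
    itself, at distance [rho > 0], is reached with momentum [0], so targets near it need only small
    momenta, and the cut locus never appears. For [q = q0] no positive lower bound for the distance
    to the base point is available and the chart degenerates; only the weaker bound [t ^ 2] is
    proved there, which suffices because the critical exponent is at least [2]. *)

Lemma lebesgue_measure_le_diam (R : realType) (E : set R) (d : R) : 0 <= d ->
  (forall x y, E x -> E y -> `|x - y| <= d) ->
  (@lebesgue_measure R E <= d%:E)%E.
Proof.
move=> d0 Ed; have [->|/set0P[x0 Ex0]] := eqVneq E set0.
  by rewrite measure0 lee_fin.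
have hub : has_ubound E.
  by exists (x0 + d) => y Ey; have := Ed _ _ Ey Ex0; rewrite ler_norml; lra.
have hlb : has_lbound E.
  by exists (x0 - d) => y Ey; have := Ed _ _ Ey Ex0; rewrite ler_norml; lra.
have sE : E `<=` `[inf E, sup E].
  by move=> y Ey; rewrite /= in_itv /=; apply/andP; split;
   [exact: ge_inf|exact: ub_le_sup].
apply: (@le_trans _ _ (@lebesgue_measure R `[inf E, sup E])).
  exact: (@le_mu_ext _ (ocitv_type R) _ (wlength idfun)).
rewrite lebesgue_measure_itv /=; case: ifPn => // _.
rewrite -EFinD lee_fin lerBlDr.
apply: ge_sup; first by exists x0.
move=> y Ey; rewrite -lerBlDl; apply: lb_le_inf; first by exists x0.
by move=> z Ez; have := Ed _ _ Ey Ez; rewrite ler_norml; lra.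
Qed.

(** The measure of any set is the infimum over covers by half-open intervals, and the preimage of an
    interval of length [l] has diameter at most [l / c]. The argument thus applies to arbitrary
    [V]. *)
Lemma lebesgue_measure_preimage_expansion (R : realType) (G : R -> R) (c : R) :
  0 < c -> (forall a b, c * `|a - b| <= `|G a - G b|) ->
  forall V : set R,
  (c%:E * @lebesgue_measure R (G @^-1` V) <= @lebesgue_measure R V)%E.
Proof.
move=> c0 Gc V.
apply: le_ereal_inf_tmp => _ [A [mA VA] <-].
apply: (@le_trans _ _ (c%:E * \sum_(k <oo) @lebesgue_measure R (G @^-1` (A k))))%E.
  rewrite lee_pmul2l// ?lte_fin//.
  apply: (@le_trans _ _ (@lebesgue_measure R (\bigcup_k (G @^-1` (A k))))).
    apply: (@le_mu_ext _ (ocitv_type R) _ (wlength idfun)).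
    by move=> x /VA [k _ Ak]; exists k.
  exact: (outer_measure_sigma_subadditive ((wlength idfun)^*)%mu).
rewrite -nneseriesZl//; apply: lee_nneseries.
  by move=> k _ _; rewrite mule_ge0// lee_fin ltW.
move=> k _; have := mA k => /ocitvP[->|[[a b] /= ab ->]].
  by rewrite preimage_set0 measure0 mule0; exact: wlength_ge0.
rewrite (wlength_itv_bnd idfun _ _ (ltW ab)).
rewrite -(@lee_pmul2l _ c^-1%:E)// ?lte_fin ?invr_gt0//.
rewrite muleA -EFinM mulVf ?gt_eqF// mul1e -EFinM.
apply: lebesgue_measure_le_diam.
  by rewrite mulr_ge0 ?invr_ge0 ?ltW ?subr_gt0.
move=> x y /=; rewrite !in_itv /= => /andP[? ?] /andP[? ?].
rewrite mulrC ler_pdivlMr// mulrC (le_trans (Gc _ _))//.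
by rewrite ler_norml; lra.
Qed.

Local Notation leb2 := (lebesgue_measure \x lebesgue_measure)%E.

Lemma le_area (R : realType) (A B : set (R * R)) : A `<=` B -> (area A <= area B)%E.
Proof. exact: le_mu_ext. Qed.

Lemma area_ge0 (R : realType) (A : set (R * R)) : (0 <= area A)%E.
Proof. by apply: mu_ext_ge0 => ?; exact: measure_ge0. Qed.

Lemma area_measurable (R : realType) (A : set (R * R)) : measurable A -> area A = leb2 A.
Proof. by move=> mA; rewrite /area measurable_mu_extE. Qed.

Lemma areaU (R : realType) (A B : set (R * R)) : (area (A `|` B) <= area A + area B)%E.
Proof. exact: (outer_measureU2 ((lebesgue_measure \x lebesgue_measure)%E^*)%mu). Qed.

Lemma area_setX (R : realType) (I J : set R) : measurable I -> measurable J ->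
  area (I `*` J) = (lebesgue_measure I * lebesgue_measure J)%E.
Proof.
move=> mI mJ; have mIJ : measurable (I `*` J) by exact: measurableX.
by rewrite area_measurable// product_measure1E.
Qed.

(** Preimages of a measurable cover of [A] cover the preimage of [A], so an estimate on measurable
    sets passes to the outer measure. *)
Lemma area_preimage_le (R : realType) (Psi : R * R -> R * R) (c : R) : 0 < c ->
  measurable_fun setT Psi ->
  (forall U, measurable U -> c%:E * leb2 (Psi @^-1` U) <= leb2 U)%E ->
  forall A, (c%:E * area (Psi @^-1` A) <= area A)%E.
Proof.
move=> c0 mPsi PsiU A; apply: le_ereal_inf_tmp => _ [F [mF AF] <-].
apply: (@le_trans _ _ (c%:E * \sum_(k <oo) leb2 (Psi @^-1` (F k))))%E.
  rewrite lee_pmul2l// ?lte_fin//; apply: ereal_inf_lbound.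
  exists (fun k => Psi @^-1` F k) => //; split=> [k|x /AF[k _ Fk]].
    have := mPsi measurableT (F k) (mF k).
    by rewrite setTI.
  by exists k.
rewrite -nneseriesZl//.
apply: lee_nneseries => k _; last exact: (PsiU (F k) (mF k)).
by move=> _; rewrite mule_ge0//; exact: ltW.
Qed.

(** Cavalieri's principle: the one-dimensional estimate is applied to every vertical section and
    integrated. *)
Lemma area_preimage_fiber2 (R : realType) (G : R -> R -> R) (c : R) : 0 < c ->
  measurable_fun setT (fun p : R * R => G p.1 p.2) ->
  (forall a b b', c * `|b - b'| <= `|G a b - G a b'|) ->
  forall A, (c%:E * area [set p | A (p.1, G p.1 p.2)] <= area A)%E.
Proof.
move=> c0 mG Gc; have mPsi : measurable_fun setT (fun p : R * R => (p.1, G p.1 p.2)).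
  exact: measurable_fun_pair.
move=> A; refine (area_preimage_le c0 mPsi _ A) => U mU.
have mPU : measurable ((fun p : R * R => (p.1, G p.1 p.2)) @^-1` U).
  by rewrite -[X in measurable X]setTI; exact: mPsi.
rewrite -ge0_integralZl//; last 2 first.
  exact: measurable_fun_xsection.
  by rewrite lee_fin ltW.
apply: ge0_le_integral => //=.
- by move=> x _; rewrite mule_ge0// lee_fin ltW.
- by apply: measurable_funeM; exact: measurable_fun_xsection.
- exact: measurable_fun_xsection.
move=> a _.
apply: le_trans (lebesgue_measure_preimage_expansion c0 (Gc a) _).
rewrite lee_pmul2l ?lte_fin// le_eqVlt; apply/orP; left; apply/eqP.
Qed.

Lemma area_preimage_fiber1 (R : realType) (G : R -> R -> R) (c : R) : 0 < c ->
  measurable_fun setT (fun p : R * R => G p.2 p.1) ->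
  (forall a b b', c * `|b - b'| <= `|G a b - G a b'|) ->
  forall A, (c%:E * area [set p | A (G p.2 p.1, p.2)] <= area A)%E.
Proof.
move=> c0 mG Gc; have mPsi : measurable_fun setT (fun p : R * R => (G p.2 p.1, p.2)).
  exact: measurable_fun_pair.
move=> A; refine (area_preimage_le c0 mPsi _ A) => U mU.
have mPU : measurable ((fun p : R * R => (G p.2 p.1, p.2)) @^-1` U).
  by rewrite -[X in measurable X]setTI; exact: mPsi.
(* The product measure is defined by vertical sections; uniqueness of the product measure lets it be
   computed by horizontal ones. *)
have leb2E V : measurable V -> leb2 V =
    (\int[@lebesgue_measure R]_y (@lebesgue_measure R (ysection V y)))%E.
  move=> mV; rewrite (product_measure_unique (m' := (lebesgue_measure \x^ lebesgue_measure)%E))//.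
  by move=> ? ? ? ?; rewrite /= product_measure2E.
rewrite !leb2E// -ge0_integralZl//; last 2 first.
  exact: measurable_fun_ysection.
  by rewrite lee_fin ltW.
apply: ge0_le_integral => //=.
- by move=> x _; rewrite mule_ge0// lee_fin ltW.
- by apply: measurable_funeM; exact: measurable_fun_ysection.
- exact: measurable_fun_ysection.
move=> a _.
apply: le_trans (lebesgue_measure_preimage_expansion c0 (Gc a) _).
rewrite lee_pmul2l ?lte_fin// le_eqVlt; apply/orP; left; apply/eqP.
Qed.

(* [G a b > z] if and only if [G a q > z] for some rational [q < b]. *)
Lemma measurable_fiberwise_increasing (R : realType) (G : R -> R -> R) (C : R) : 0 < C ->
  (forall a b b', b <= b' -> 0 <= G a b' - G a b <= C * (b' - b)) ->
  (forall b, measurable_fun setT (G^~ b)) ->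
  measurable_fun setT (fun p : R * R => G p.1 p.2).
Proof.
move=> C0 GC mG _; apply: (measurability _ (RGenOInfty.measurableE R)) => // _ [_ [z ->] <-].
rewrite setTI.
rewrite (_ : _ @^-1` _ =
    \bigcup_(q : rat) ((G^~ (ratr q) @^-1` `]z, +oo[) `*` `]ratr q, +oo[)); last first.
  apply/seteqP; split=> [[a b]|[a b] [q _] []] /=; rewrite !in_itv/= !andbT.
    move=> zG; have := @rat_in_itvoo R (b - (G a b - z) / C) b.
    rewrite ltrBlDr ltrDl divr_gt0 ?subr_gt0// => /(_ isT)[q /=].
    rewrite in_itv/= => /andP[bq qb]; exists q => //; split => /=; last by rewrite in_itv/= qb.
    rewrite in_itv/= andbT; have /andP[_] := GC a _ _ (ltW qb).
    move: bq; rewrite ltrBlDr -ltrBlDl ltr_pdivlMr// mulrC; lra.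
  move=> zG qb; have := GC a _ _ (ltW qb); lra.
apply: bigcupT_measurable_rat => q; apply: measurableX => //.
by rewrite -[X in measurable X]setTI; exact: mG.
Qed.

Lemma expanding_surjective (R : realType) (g : R -> R) (c C : R) : 0 < c ->
  (forall b b', b <= b' -> c * (b' - b) <= g b' - g b <= C * (b' - b)) ->
  forall y, exists x, g x = y.
Proof.
move=> c0 gC y.
have gcont : continuous g.
  have C0 : 0 < C.
    by have := gC 0 1 ler01; rewrite !subr0 !mulr1 => /andP[+ +]; lra.
  move=> x; apply/cvgrPdist_lt => e e0.
  near=> z; have xz : `|x - z| < e / C.
    by near: z; apply: cvgr_dist_lt => //; exact: divr_gt0.
  rewrite ltr_pdivlMr// in xz.
  have [zx|/ltW zx] := leP z x.
    have /andP[g1 g2] := gC _ _ zx; rewrite ger0_norm; last first.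
      by rewrite (le_trans _ g1)// mulr_ge0 ?subr_ge0// ltW.
    by rewrite (le_lt_trans g2)// mulrC -[x - z]ger0_norm ?subr_ge0.
  have /andP[g1 g2] := gC _ _ zx; rewrite distrC ger0_norm; last first.
    by rewrite (le_trans _ g1)// mulr_ge0 ?subr_ge0// ltW.
  by rewrite (le_lt_trans g2)// mulrC -[z - x]ger0_norm ?subr_ge0// distrC.
(* At distance [d] from [0] the value of [g] has moved by at least [c * d = |y - g 0|], so
   [[- d, d]] brackets [y]. *)
pose d := `|y - g 0| / c.
have d0 : 0 <= d by rewrite divr_ge0// ltW.
have cd : c * d = `|y - g 0| by rewrite /d mulrC divfK ?gt_eqF.
have [x _ gx] : exists2 x, x \in `[- d, d] & g x = y.
  apply: IVT; first by lra.
    by apply: continuous_subspaceT.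
  have /andP[A1 _] := gC (- d) 0 ltac:(lra).
  have /andP[B1 _] := gC 0 d d0.
  rewrite ge_min le_max; apply/andP; split; apply/orP; [left|right].
    have := ler_norm (- (y - g 0)); rewrite normrN; lra.
  have := ler_norm (y - g 0); lra.
by exists x.
Unshelve. all: by end_near. Qed.

Lemma fiber_inverse (R : realType) (G : R -> R -> R) (c C : R) : 0 < c ->
  (forall a b b', b <= b' -> c * (b' - b) <= G a b' - G a b <= C * (b' - b)) ->
  exists X : R -> R -> R, [/\ forall a, cancel (G a) (X a),
    forall a, cancel (X a) (G a), 0 < C,
    (forall a b b', c * `|b - b'| <= `|G a b - G a b'|) &
    (forall a b b', C^-1 * `|b - b'| <= `|X a b - X a b'|)].
Proof.
move=> c0 GC.
have C0 : 0 < C.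
  by have := GC 0 0 1 ler01; rewrite !subr0 !mulr1 => /andP[+ +]; lra.
have Gexp a b b' : c * `|b - b'| <= `|G a b - G a b'| <= C * `|b - b'|.
  wlog bb : b b' / b <= b'.
    move=> H; have [|/ltW] := leP b b'; first exact: H.
    by move=> /H; rewrite distrC (distrC (G a b')).
  rewrite distrC (distrC (G a b)) (ger0_norm (x := b' - b)) ?subr_ge0//.
  have /andP[g1 g2] := GC a _ _ bb.
  rewrite ger0_norm ?g1 ?g2// (le_trans _ g1)// mulr_ge0 ?subr_ge0//.
  exact: ltW.
have /choice[X XP] : forall a, exists Xa : R -> R, forall y, G a (Xa y) = y.
  move=> a; have /choice[Xa ?] := expanding_surjective c0 (GC a).
  by exists Xa.
have inj a : injective (G a).
  move=> b b' bb; have /andP[+ _] := Gexp a b b'.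
  rewrite bb subrr normr0 pmulr_rle0// => ?.
  by apply/eqP; rewrite -subr_eq0 -normr_eq0 eq_le normr_ge0 andbT.
exists X; split => //.
- by move=> a b; apply: (inj a); rewrite XP.
- by move=> a b b'; have /andP[] := Gexp a b b'.
move=> a b b'; have /andP[_] := Gexp a (X a b) (X a b').
by rewrite !XP ler_pdivrMl.
Qed.

(** By monotonicity [X a y > z] if and only if [y > G a z], and for fixed [z] the latter condition
    is measurable in [(a, y)]. *)
Lemma measurable_fiber_inverse (R : realType) (G X : R -> R -> R) (c : R) :
  0 < c ->
  (forall a b b', b <= b' -> c * (b' - b) <= G a b' - G a b) ->
  (forall a, cancel (X a) (G a)) ->
  (forall b, measurable_fun setT (G^~ b)) ->
  measurable_fun setT (fun p : R * R => X p.1 p.2).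
Proof.
move=> c0 GC XK mG _.
apply: (measurability _ (RGenOInfty.measurableE R)) => // _ [_ [z ->] <-].
rewrite setTI (_ : _ @^-1` _ = (fun p : R * R => p.2 - G p.1 z) @^-1` `]0, +oo[).
  have mG1 : measurable_fun setT (fun p : R * R => p.2 - G p.1 z).
    apply: measurable_funB; first exact: measurable_snd.
    exact: measurableT_comp (mG z) _.
  by rewrite -[X in measurable X]setTI; apply: mG1.
apply/seteqP; split=> [[a y]|[a y]] /=; rewrite !in_itv/= !andbT subr_gt0.
  move=> zX; rewrite -{1}[y](XK a) -subr_gt0.
  by apply: lt_le_trans (GC a _ _ (ltW zX)); rewrite mulr_gt0 ?subr_gt0.
move=> Gy; rewrite ltNge; apply/negP => Xz.
have : 0 <= G a z - G a (X a y).
  by apply: le_trans (GC a _ _ Xz); rewrite mulr_ge0 ?subr_ge0// ltW.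
by rewrite XK subr_ge0 leNgt Gy.
Qed.

(** This replaces the change of variables formula. The lower bound holds because [A] lies in the
    preimage of its image; the upper one because the image lies in the preimage of [A] under the
    fibre inverse, which expands by at least [C^-1]. *)
Lemma area_fiber2 (R : realType) (G : R -> R -> R) (c C : R) : 0 < c ->
  (forall a b b', b <= b' -> c * (b' - b) <= G a b' - G a b <= C * (b' - b)) ->
  (forall b, measurable_fun setT (G^~ b)) ->
  forall A, (c%:E * area A <= area [set (p.1, G p.1 p.2) | p in A] <=
             C%:E * area A)%E.
Proof.
move=> c0 GC mG A; have [X [GK XK C0 Gc XC]] := fiber_inverse c0 GC.
have mG2 : measurable_fun setT (fun p : R * R => G p.1 p.2).
  apply: (measurable_fiberwise_increasing C0 _ mG) => a b b' bb.
  have /andP[g1 ->] := GC a _ _ bb.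
  by rewrite andbT (le_trans _ g1)// mulr_ge0 ?subr_ge0// ltW.
have mX2 : measurable_fun setT (fun p : R * R => X p.1 p.2).
  by apply: (measurable_fiber_inverse c0 _ XK mG) => a b b' /(GC a)/andP[].
apply/andP; split.
  apply: (le_trans _ (area_preimage_fiber2 c0 mG2 Gc _)).
  by rewrite lee_pmul2l ?lte_fin//; apply: le_area => p Ap; exists p.
rewrite -(@lee_pmul2l _ C^-1%:E) ?lte_fin ?invr_gt0//.
rewrite muleA -EFinM mulVf ?gt_eqF// mul1e.
apply: (le_trans _ (area_preimage_fiber2 _ mX2 XC A)); last by rewrite invr_gt0.
rewrite lee_pmul2l ?lte_fin ?invr_gt0//; apply: le_area => _ [[a b] Ap <-] /=.
by rewrite GK.
Qed.

Lemma area_fiber1 (R : realType) (G : R -> R -> R) (c C : R) : 0 < c ->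
  (forall a b b', b <= b' -> c * (b' - b) <= G a b' - G a b <= C * (b' - b)) ->
  (forall b, measurable_fun setT (G^~ b)) ->
  forall A, (c%:E * area A <= area [set (G p.2 p.1, p.2) | p in A] <=
             C%:E * area A)%E.
Proof.
move=> c0 GC mG A; have [X [GK XK C0 Gc XC]] := fiber_inverse c0 GC.
have mG2 : measurable_fun setT (fun p : R * R => G p.2 p.1).
  suff mG2 : measurable_fun setT (fun p : R * R => G p.1 p.2).
    exact: (measurableT_comp mG2 (@measurable_swap _ _ _ _)).
  apply: (measurable_fiberwise_increasing C0 _ mG) => a b b' bb.
  have /andP[g1 ->] := GC a _ _ bb.
  by rewrite andbT (le_trans _ g1)// mulr_ge0 ?subr_ge0// ltW.
have mX2 : measurable_fun setT (fun p : R * R => X p.2 p.1).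
  suff mX2 : measurable_fun setT (fun p : R * R => X p.1 p.2).
    exact: (measurableT_comp mX2 (@measurable_swap _ _ _ _)).
  by apply: (measurable_fiber_inverse c0 _ XK mG) => a b b' /(GC a)/andP[].
apply/andP; split.
  apply: (le_trans _ (area_preimage_fiber1 c0 mG2 Gc _)).
  by rewrite lee_pmul2l ?lte_fin//; apply: le_area => p Ap; exists p.
rewrite -(@lee_pmul2l _ C^-1%:E) ?lte_fin ?invr_gt0//.
rewrite muleA -EFinM mulVf ?gt_eqF// mul1e.
apply: (le_trans _ (area_preimage_fiber1 _ mX2 XC A)); last by rewrite invr_gt0.
rewrite lee_pmul2l ?lte_fin ?invr_gt0//; apply: le_area => _ [[a b] Ap <-] /=.
by rewrite GK.
Qed.

Lemma area_reflect1 (R : realType) (x s : R) (A : set (R * R)) : `|s| = 1 ->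
  area [set (x + s * p.1, p.2) | p in A] = area A.
Proof.
move=> s1; have s2 : s * s = 1 by rewrite -expr2 -real_normK ?num_real// s1 expr1n.
have H (x' : R) (B : set (R * R)) :
    (area [set p | B ((x' + s * p.1)%R, p.2)] <= area B)%E.
  rewrite -[leLHS]mul1e; apply: (@area_preimage_fiber1 _ (fun _ b => x' + s * b) 1) => //.
    by apply: measurable_funD => //; apply: measurable_funM => //; exact: measurable_fst.
  by move=> _ b b'; rewrite mul1r opprD addrACA subrr add0r -mulrBr normrM s1 mul1r.
apply/eqP; rewrite eq_le; apply/andP; split.
  apply: le_trans (H (- (s * x)) A); apply: le_area => _ [[a b] Aab <-] /=.
  by rewrite mulrDr mulrA s2 mul1r addKr.
apply: le_trans (H x _); apply: le_area => -[a b] Aab /=.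
by exists (a, b).
Qed.

(** * Primitives and the critical exponent *)

Lemma exists_primitive (R : realType) (f : R -> R) : continuous f ->
  exists F : R -> R, F 0 = 0 /\ forall x : R, is_derive x 1 F (f x).
Proof.
move=> cf.
have intf (a b : R) : (@lebesgue_measure R).-integrable `[a, b] (EFin \o f).
  apply: continuous_compact_integrable; first exact: segment_compact.
  exact: continuous_subspaceT.
pose J (a x : R) := (\int[@lebesgue_measure R]_(t in `[a, x]) f t)%R.
have JB (a b x y : R) : b <= a -> a <= x -> a <= y -> J b y - J b x = J a y - J a x.
  wlog xy : x y / x <= y.
    move=> H ba ax ay; have [|/ltW] := leP x y; first by move=> /H; apply.
    by move=> /H /(_ ba ay ax) h; rewrite -opprB h opprB.
  move=> ba ax ay; rewrite /J !Rintegral_itvB ?bnd_simp//.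
  exact: le_trans ba ax.
(* The base point lies to the left of both [0] and [x]. By [JB] the difference does not depend on
   it, so near a given point it can be frozen. *)
pose F (x : R) := J (- `|x| - 1) x - J (- `|x| - 1) 0.
exists F; split; first by rewrite /F subrr.
move=> x.
have FE (y : R) : `|y| < `|x| + 1 -> F y = J (- `|x| - 2) y - J (- `|x| - 2) 0.
  move=> yx; rewrite /F; apply/esym/JB; first by lra.
    by have := normr_ge0 y; lra.
  by have := ler_norm (- y); rewrite normrN; lra.
have [dJ dJE] : derivable (J (- `|x| - 2)) x 1 /\ derive1 (J (- `|x| - 2)) x = f x.
  apply: (@continuous_FTC1_closed _ f (- `|x| - 2) x (x + 1)) => //; first by rewrite ltrDl.
    by have := ler_norm (- x); rewrite normrN; lra.
  exact: cf.
have dF : is_derive x 1 (fun y => J (- `|x| - 2) y - J (- `|x| - 2) 0) (f x).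
  rewrite -[f x]subr0; apply: is_deriveB.
  by rewrite -dJE derive1E; exact: DeriveDef.
apply: near_eq_is_derive dF.
near=> y; apply/esym/FE; near: y.
have : (fun y : R => `|y|) @ x --> `|x| by apply: cvg_norm.
move=> /cvgrPdist_lt/(_ 1 ltr01); apply: filterS => y.
by rewrite ltr_norml => /andP[? ?]; lra.
Unshelve. all: by end_near. Qed.

(* Unlike an integral over [`[0, x]], this is meaningful for negative [x]; it is
   the zero function when [f] has no primitive. *)
Definition primitive (R : realType) (f : R -> R) : R -> R :=
  xget (fun=> 0) [set F | F 0 = 0 /\ forall x : R, is_derive x 1 F (f x)].

Lemma primitive0 (R : realType) (f : R -> R) : primitive f 0 = 0.
Proof. by rewrite /primitive; case: xgetP => [F _ []|]. Qed.

Lemma is_derive_primitive (R : realType) (f : R -> R) : continuous f ->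
  forall x : R, is_derive x 1 (primitive f) (f x).
Proof.
move=> /exists_primitive[F FP]; rewrite /primitive.
by case: xgetP => [G _ []//|/(_ F)]; case.
Qed.

Lemma is_derive_continuous (R : realType) (F f : R -> R) :
  (forall x : R, is_derive x 1 F (f x)) -> continuous F.
Proof.
move=> dF x; apply: differentiable_continuous; apply/derivable1_diffP.
by have [] := dF x.
Qed.

Lemma derivable_homo (R : realType) (F G f g : R -> R) (a b : R) : a <= b ->
  (forall x : R, is_derive x 1 F (f x)) -> (forall x : R, is_derive x 1 G (g x)) ->
  (forall x, a <= x <= b -> f x <= g x) -> F b - F a <= G b - G a.
Proof.
move=> ab dF dG fg.
have dGF (x : R) : is_derive x 1 (G \- F) ((g \- f) x) by exact: is_deriveB.
have cGF : {within `[a, b], continuous (G \- F)}.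
  by apply: continuous_subspaceT; exact: is_derive_continuous dGF.
have [c cab E] := MVT_segment ab (fun x _ => dGF x) cGF.
have : 0 <= (G \- F) b - (G \- F) a.
  by rewrite E mulr_ge0 ?subr_ge0//; apply: fg; move: cab; rewrite in_itv.
rewrite /=; lra.
Qed.

Lemma primitive_homo (R : realType) (f g : R -> R) (a b : R) : a <= b ->
  continuous f -> continuous g -> (forall x, a <= x <= b -> f x <= g x) ->
  primitive f b - primitive f a <= primitive g b - primitive g a.
Proof.
by move=> ab cf cg; apply: derivable_homo => //; exact: is_derive_primitive.
Qed.

Lemma primitiveE (R : realType) (f F : R -> R) : continuous f ->
  (forall x : R, is_derive x 1 F (f x)) -> forall x, primitive f x = F x - F 0.
Proof.
move=> cf dF x; have dp := is_derive_primitive cf.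
have [x0|/ltW x0] := leP 0 x.
  have := derivable_homo x0 dp dF (fun _ _ => lexx _).
  have := derivable_homo x0 dF dp (fun _ _ => lexx _).
  rewrite primitive0; lra.
have := derivable_homo x0 dp dF (fun _ _ => lexx _).
have := derivable_homo x0 dF dp (fun _ _ => lexx _).
rewrite primitive0; lra.
Qed.

Lemma primitive_cst (R : realType) (k x : R) : primitive (fun=> k) x = k * x.
Proof.
have dl (y : R) : is_derive y 1 (fun z : R => k * z) k.
  by rewrite -[X in is_derive _ _ _ X]mulr1; exact: is_deriveZ.
by rewrite (primitiveE _ dl) ?mulr0 ?subr0//; exact: cst_continuous.
Qed.

Lemma primitive_bounds (R : realType) (f : R -> R) (c C a b : R) : a <= b ->
  continuous f -> (forall x, a <= x <= b -> c <= f x <= C) ->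
  c * (b - a) <= primitive f b - primitive f a <= C * (b - a).
Proof.
move=> ab cf fC; apply/andP; split.
  rewrite mulrBr -!primitive_cst; apply: primitive_homo => //; first exact: cst_continuous.
  by move=> x /fC /andP[].
rewrite mulrBr -!primitive_cst; apply: primitive_homo => //; first exact: cst_continuous.
by move=> x /fC /andP[].
Qed.

Lemma primitiveZ (R : realType) (f : R -> R) (k x : R) : continuous f ->
  primitive (fun s => k * f s) x = k * primitive f x.
Proof.
move=> cf.
have dk (y : R) : is_derive y 1 (fun z : R => k * primitive f z) (k * f y).
  by apply: is_deriveZ; exact: is_derive_primitive.
rewrite (primitiveE _ dk) ?primitive0 ?mulr0 ?subr0// => y.
by apply: cvgM; [exact: cvg_cst|exact: cf].
Qed.

(** * Convexity of powers and the critical exponent *)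

Lemma powR_bernoulli (R : realType) (s p : R) : 0 <= s -> 1 <= p ->
  1 + p * (s - 1) <= s `^ p.
Proof.
move=> s0; rewrite le_eqVlt => /predU1P[<-|p1].
  by rewrite powRr1// mul1r addrC subrK.
have p0 : 0 < p by lra.
have q0 : 0 < p / (p - 1) by rewrite divr_gt0// subr_gt0.
have pq : p^-1 + (p / (p - 1))^-1 = 1.
  by rewrite invf_div; field; rewrite gt_eqF.
(* Young's inequality for the product [s * 1], with exponents [p] and [p / (p - 1)]. *)
have := conjugate_powR s0 ler01 p0 q0 pq.
rewrite mulr1 powR1 mul1r invf_div -mulrDl ler_pdivlMr//; lra.
Qed.

Lemma mulr_powRD1 (R : realType) (x b : R) : 0 <= x -> 0 <= b ->
  x * x `^ b = x `^ (b + 1).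
Proof.
move=> x0 b0; rewrite powRD ?powRr1 1?mulrC//; apply/implyP => /eqP; lra.
Qed.

Lemma continuous_norm_powR (R : realType) (b : R) : 0 < b ->
  continuous (fun x : R => `|x| `^ b).
Proof.
move=> b0 x; have [->|x0] := eqVneq x 0.
  rewrite /continuous_at normr0 powR0 ?gt_eqF//.
  apply/cvgrPdist_lt => e e0; have := powR_cvg0 b0.
  move=> /cvgrPdist_lt/(_ _ e0); rewrite near_withinE => -[d /= d0 dH].
  exists d => //= y; rewrite /= !sub0r !normrN => yd.
  have [->|y0] := eqVneq y 0.
    by rewrite normr0 powR0 ?gt_eqF// normr0.
  have := dH `|y|; rewrite /= !sub0r !normrN normr_id; apply => //.
  by rewrite normr_gt0.
apply: (@continuous_comp _ _ _ (fun x : R => `|x|) (fun z => z `^ b)).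
  exact: norm_continuous.
apply: differentiable_continuous; apply/derivable1_diffP.
by apply: derivable_powR; rewrite in_itv/= andbT normr_gt0.
Qed.

(** This yields a primitive of the squared weight valid across the singular line. At [0] the
    difference quotient at [h] is the [b]-th power of [|h|]; negative arguments follow by
    oddness. *)
Lemma is_derive_signed_powR (R : realType) (b x : R) : 0 < b ->
  is_derive x 1 (fun z : R => z * `|z| `^ b) ((b + 1) * `|x| `^ b).
Proof.
move=> b0.
have pos (y : R) : 0 < y -> is_derive y 1 (fun z : R => z * `|z| `^ b) ((b + 1) * `|y| `^ b).
  move=> y0; have := is_derive1_powR (b + 1) y0; rewrite addrK gtr0_norm//.
  apply: near_eq_is_derive; near=> z.
  have z0 : 0 < z by near: z; exact: lt_nbhsr.
  by rewrite gtr0_norm// mulr_powRD1// ltW.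
have [x0|x0|->] := ltgtP x 0; last 2 first.
- exact: pos.
- rewrite normr0 powR0 ?gt_eqF// mulr0.
  have H : (fun h : R => h^-1 *: (((h *: (1 : R) + 0) : R) * `|h *: (1 : R) + 0| `^ b -
      (0 : R) * `|0 : R| `^ b)) @ (0:R)^' --> (0 : R).
    have : `|h| `^ b @[h --> (0 : R)^'] --> (0 : R).
      have := @continuous_norm_powR R b b0 0.
      by rewrite /continuous_at normr0 powR0 ?gt_eqF// => /cvg_within_filter; exact.
    move=> C; apply: cvg_trans C; apply: near_eq_cvg; near=> h.
    have h0 : h != 0 by near: h; exact: nbhs_dnbhs_neq.
    by rewrite /= mul0r subr0 addr0 /GRing.scale /= mulr1 mulrA mulVf// mul1r.
  apply: DeriveDef; first by apply/cvg_ex; exists 0.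
  exact/cvg_lim.
have nx0 : 0 < - x by rewrite oppr_gt0.
have := is_derive1_comp (pos _ nx0) (is_deriveN (is_derive_id x 1)).
move=> /is_deriveN; rewrite normrN mulrN1 opprK.
by congr is_derive; apply/funext => z /=; rewrite !fctE normrN mulNr opprK.
Unshelve. all: by end_near. Qed.

(* For [z = (a + s * x) / a] this says that [x * w x <= u `^ b * primitive w x]
   with [w x = `|a + s * x| `^ b]; equality holds at [z = - u]. *)
Lemma grushin_critical_ineq (R : realType) (b u z : R) : 1 <= b -> 0 < u ->
  u `^ (b + 1) + 1 = (b + 1) * (u + 1) ->
  0 <= (z - 1) * (u `^ b * (z * `|z| `^ b - 1) - (b + 1) * (z - 1) * `|z| `^ b).
Proof.
move=> b1 u0 uE; set n := u `^ b.
have nu : u * n = (b + 1) * (u + 1) - 1 by rewrite /n mulr_powRD1//; lra.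
have nb : b + 1 <= n.
  rewrite -(ler_pM2l u0) nu; lra.
have P0 : 0 <= `|z| `^ b by exact: powR_ge0.
(* For [z >= 0] both summands have the sign of [z - 1], because [n >= b + 1]. *)
have E : n * (z * `|z| `^ b - 1) - (b + 1) * (z - 1) * `|z| `^ b =
    n * (`|z| `^ b - 1) + (n - (b + 1)) * (z - 1) * `|z| `^ b by ring.
have [z0|z0] := leP 0 z.
  have [z1|/ltW z1] := leP 1 z.
    have P1 : 1 <= `|z| `^ b by rewrite -(powRr0 `|z|) ler_powR ?ger0_norm//; lra.
    rewrite E mulr_ge0 ?subr_ge0// addr_ge0 ?mulr_ge0 ?subr_ge0//; lra.
  have P1 : `|z| `^ b <= 1.
    have -> : (1 : R) = 1 `^ b by rewrite powR1.
    by rewrite ge0_ler_powR ?nnegrE ?ger0_norm//; lra.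
  have h1 : n * (`|z| `^ b - 1) <= 0 by rewrite mulr_ge0_le0 ?subr_le0//; lra.
  have h2 : (n - (b + 1)) * (z - 1) * `|z| `^ b <= 0.
    by rewrite mulr_le0_ge0// mulr_ge0_le0 ?subr_ge0 ?subr_le0.
  rewrite E; apply: mulr_le0; lra.
have v0 : 0 < - z by rewrite oppr_gt0.
rewrite (ltr0_norm z0) in P0 *; move: v0 P0; set v := - z => v0 P0.
have -> : z = - v by rewrite /v opprK.
have s0 : 0 <= u / v by rewrite divr_ge0// ltW.
(* For [z < 0], Bernoulli at [u / v] is the tangent line inequality at [v] for the convex power of
   exponent [b + 1], evaluated at [u]; it is sharp at [v = u], that is [z = - u]. *)
have := powR_bernoulli s0 (_ : 1 <= b + 1) => /(_ ltac:(lra)).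
move=> H; have Pgt0 : 0 < v `^ b by exact: powR_gt0.
have uv : u * n = (u / v) `^ (b + 1) * (v * v `^ b).
  rewrite /n !mulr_powRD1 -?powRM ?divfK ?gt_eqF//; lra.
move: P0 Pgt0 H uv; set P := v `^ b => P0 Pgt0 H uv.
have K : (1 + (b + 1) * (u / v - 1)) * (v * P) <= u * n.
  by rewrite uv ler_pM2r// mulr_gt0.
have K2 : (1 + (b + 1) * (u / v - 1)) * (v * P) = (b + 1) * u * P - b * (v * P).
  by field; rewrite gt_eqF.
rewrite K2 in K.
have : u * ((b + 1) * (v + 1) * P) <= u * (n * (v * P + 1)).
  rewrite (_ : u * (n * (v * P + 1)) = (u * n) * (v * P) + u * n); last by ring.
  rewrite nu; rewrite nu in K.
  lra.
rewrite ler_pM2l// => L.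
apply: mulr_le0; lra.
Qed.

(* With [b = 2 * alpha], [- 1 - u] is the number [m_alpha]. *)
Lemma exists_grushin_critical (R : realType) (b : R) : 2 <= b ->
  exists2 u : R, 1 <= u <= 2 & u `^ (b + 1) + 1 = (b + 1) * (u + 1).
Proof.
move=> b2; pose k (u : R) := `|u| `^ (b + 1) + 1 - (b + 1) * (u + 1).
have [|||u u12 ku] := @IVT R k 1 2 0; first by lra.
- apply: continuous_subspaceT => x; apply: cvgB.
    apply: cvgD; last exact: cvg_cst.
    by apply: continuous_norm_powR; lra.
  by apply: cvgM; [exact: cvg_cst|apply: cvgD; [exact: cvg_id|exact: cvg_cst]].
- have k1 : k 1 <= 0 by rewrite /k normr1 powR1; lra.
  have k2 : 0 <= k 2.
    rewrite /k ger0_norm// -mulr_powRD1//; last lra.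
    (* What is needed is that the [b]-th power of [2] is at least [1 + 3 * b / 2]: exactly Bernoulli
       for base [4] and exponent [b / 2 >= 1], with equality at [b = 2]. *)
    have : (2 : R) `^ b = 4 `^ (b / 2).
      rewrite (_ : (4 : R) = 2 `^ 2%:R); last by rewrite powR_mulrn//; ring.
      by rewrite -powRrM; congr (_ `^ _); field.
    have := @powR_bernoulli R 4 (b / 2) ltac:(lra) ltac:(lra); lra.
  by rewrite ge_min le_max k1 k2 orbT.
exists u; first by move: u12; rewrite in_itv.
move: ku; rewrite /k ger0_norm; first lra.
by move: u12; rewrite in_itv/= => /andP[? _]; lra.
Qed.

(** This is the critical inequality of [u] at the point [- v], simplified by the equation of [v].
    Exchanging the two roots gives equality, hence uniqueness. *)
Lemma grushin_critical_le (R : realType) (b u v : R) : 1 <= b -> 0 < u -> 0 < v ->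
  u `^ (b + 1) + 1 = (b + 1) * (u + 1) ->
  v `^ (b + 1) + 1 = (b + 1) * (v + 1) -> v `^ b <= u `^ b.
Proof.
move=> b1 u0 v0 uE vE; have := grushin_critical_ineq (- v) b1 u0 uE.
have vv : v * v `^ b = v `^ (b + 1) by rewrite mulr_powRD1//; lra.
rewrite normrN gtr0_norm// -mulrNN pmulr_rge0; last lra.
set n := u `^ b; move: vv; set P := v `^ b => vv.
have P0 : 0 < P by exact: powR_gt0.
rewrite -vv in vE => H.
have : P * (v * P + 1) <= n * (v * P + 1) by rewrite {1}vE; lra.
by rewrite ler_pM2r// ltr_wpDl// mulr_ge0 ?ltW.
Qed.

Lemma grushin_critical_unique (R : realType) (b u z : R) : 1 <= b -> 0 < u ->
  u `^ (b + 1) + 1 = (b + 1) * (u + 1) ->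
  `|z| `^ b * z = (b + 1) * (z - 1) + 1 -> z != 1 -> z = - u.
Proof.
move=> b1 u0 uE zE z1; have [z0|z0] := leP 0 z.
  (* Combined with the equation this gives [b * (z - 1) ^+ 2 <= 0]: among non-negative numbers only
     the excluded root [z = 1] remains. *)
  have : z * (1 + b * (z - 1)) <= z * z `^ b by rewrite ler_wpM2l// powR_bernoulli.
  rewrite ger0_norm// mulrC in zE; rewrite zE => H.
  have : b * (z - 1) ^+ 2 <= 0 by rewrite expr2; lra.
  rewrite pmulr_rle0; last lra.
  by rewrite real_exprn_even_le0 ?num_real//= subr_eq0 (negbTE z1).
have v0 : 0 < - z by lra.
have vE : (- z) `^ (b + 1) + 1 = (b + 1) * (- z + 1).
  move: zE; rewrite ltr0_norm// -mulr_powRD1 ?ltW//; lra.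
have : (- z) `^ b = u `^ b.
  by apply/eqP; rewrite eq_le !grushin_critical_le.
by move/(powR_injective _) => <-; rewrite ?opprK ?nnegrE ?ltW//; lra.
Qed.

Lemma is_derive_affine (R : realType) (a s x : R) :
  is_derive x 1 (fun z : R => a + s * z) s.
Proof.
rewrite -[X in is_derive _ _ _ X]add0r; apply: is_deriveD.
by rewrite -[X in is_derive _ _ _ X]mulr1; exact: is_deriveZ.
Qed.

Lemma continuous_affine (R : realType) (a s : R) :
  continuous (fun z : R => a + s * z).
Proof. exact: is_derive_continuous (is_derive_affine a s). Qed.

Lemma continuous_norm_powR_affine (R : realType) (a s b : R) : 0 < b ->
  continuous (fun z : R => `|a + s * z| `^ b).
Proof.
move=> b0 x; apply: (@continuous_comp _ _ _ (fun z => a + s * z) (fun z => `|z| `^ b)).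
  exact: continuous_affine.
exact: continuous_norm_powR.
Qed.

Lemma primitive_norm_powR (R : realType) (a s b x : R) : s * s = 1 -> 0 < b ->
  (b + 1) * primitive (fun z => `|a + s * z| `^ b) x =
  s * ((a + s * x) * `|a + s * x| `^ b - a * `|a| `^ b).
Proof.
move=> s2 b0; pose F z := s / (b + 1) * ((a + s * z) * `|a + s * z| `^ b).
have dF (z : R) : is_derive z 1 F (`|a + s * z| `^ b).
  rewrite (_ : `|_| `^ b = s / (b + 1) * ((b + 1) * `|a + s * z| `^ b * s)).
    apply: is_deriveZ.
    apply: (@is_derive1_comp _ (fun z => z * `|z| `^ b) (fun z => a + s * z)).
      exact: is_derive_signed_powR.
    exact: is_derive_affine.
  transitivity ((s * s) * `|a + s * z| `^ b); first by rewrite s2 mul1r.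
  by field; rewrite gt_eqF//; lra.
rewrite (primitiveE _ dF); last exact: continuous_norm_powR_affine.
by rewrite /F mulr0 addr0; field; rewrite gt_eqF//; lra.
Qed.

Lemma primitive_norm_powR_le (R : realType) (a s b u x : R) : s * s = 1 ->
  1 <= b -> a != 0 -> 0 < u -> u `^ (b + 1) + 1 = (b + 1) * (u + 1) -> 0 <= x ->
  x * `|a + s * x| `^ b <= u `^ b * primitive (fun z => `|a + s * z| `^ b) x.
Proof.
move=> s2 b1 a0 u0 uE; rewrite le_eqVlt => /predU1P[<-|x0].
  by rewrite mul0r primitive0 mulr0.
have b0 : 0 < b by lra.
have b10 : 0 < b + 1 by lra.
pose z := 1 + s * x / a.
have az : a + s * x = a * z by rewrite /z; field.
have zD := grushin_critical_ineq z b1 u0 uE.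
rewrite -(ler_pM2l b10) [leRHS]mulrCA (primitive_norm_powR a x s2 b0).
rewrite az normrM powRM//; move: zD.
set P := `|z| `^ b; set A := `|a| `^ b; set n := u `^ b.
have A0 : 0 < A by rewrite powR_gt0// normr_gt0.
set D := n * _ - _ => zD.
have xE : x = s * a * (z - 1).
  by rewrite /z addrC addKr mulrC !mulrA; transitivity ((s * s) * x); [rewrite s2 mul1r|field].
(* Multiplying by the positive number [x = s * a * (z - 1)] avoids distinguishing whether the line
   is followed towards or away from [x = 0]. *)
have D0 : 0 <= s * a * D.
  rewrite -(pmulr_rge0 _ x0) xE.
  rewrite [leRHS](_ : _ = (s * a) ^+ 2 * ((z - 1) * D)); last by ring.
  by rewrite mulr_ge0// sqr_ge0.
rewrite -subr_ge0 [leRHS](_ : _ = A * (s * a * D)); first by rewrite mulr_ge0// ltW.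
by rewrite /D {1}xE; ring.
Qed.

Lemma primitive_norm_powR_critical (R : realType) (a b u : R) :
  1 <= b -> a != 0 -> 0 < u -> u `^ (b + 1) + 1 = (b + 1) * (u + 1) ->
  let s := - Num.sg a in let x := (1 + u) * `|a| in
  x * `|a + s * x| `^ b = u `^ b * primitive (fun z => `|a + s * z| `^ b) x.
Proof.
move=> b1 a0 u0 uE s x.
have sg2 : Num.sg a * Num.sg a = 1 by rewrite -expr2 sqr_sg a0.
have s2 : s * s = 1 by rewrite mulrNN.
have b0 : 0 < b by lra.
have b10 : b + 1 != 0 by rewrite gt_eqF//; lra.
apply: (mulfI b10); rewrite [RHS]mulrCA (primitive_norm_powR a x s2 b0).
have ax : a + s * x = - (u * a).
  rewrite (_ : s * x = - ((1 + u) * (Num.sg a * `|a|))); last by rewrite /s /x; ring.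
  by rewrite -numEsg; ring.
have sa : s * a = - `|a| by rewrite /s mulNr {2}(numEsg a) mulrA sg2 mul1r.
have uu : u * u `^ b = (b + 1) * (u + 1) - 1 by rewrite mulr_powRD1//; lra.
rewrite ax normrN normrM powRM// (gtr0_norm u0) /x.
set P := u `^ b in uu *; set A := `|a| `^ b.
rewrite (_ : s * (_ - _) = - (s * a) * A * (u * P + 1)); last by ring.
by rewrite sa uu; ring.
Qed.

(** The quotient [g] of the primitive by the [n]-th power is non-increasing: its derivative is a
    positive multiple of [s * w s - n * primitive w s]. *)
Lemma primitive_powR_scale (R : realType) (w : R -> R) (n x t : R) :
  continuous w -> (forall y, 0 <= y -> y * w y <= n * primitive w y) ->
  0 < x -> 0 < t <= 1 -> t `^ n * primitive w x <= primitive w (t * x).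
Proof.
move=> cw wn x0 /andP[t0 t1].
pose g (s : R) := primitive w s * s `^ (- n).
pose dg (s : R) := s `^ (- n - 1) * (s * w s - n * primitive w s).
have tx0 : 0 < t * x by rewrite mulr_gt0.
have dgP (s : R) : 0 < s -> is_derive s 1 g (dg s).
  move=> s0; have dp := is_derive_primitive cw s.
  have dq := is_derive1_powR (- n) s0.
  have := is_deriveM dp dq; rewrite /dg.
  suff -> : primitive w s *: (- n * s `^ (- n - 1)) + s `^ (- n) *: w s =
      s `^ (- n - 1) * (s * w s - n * primitive w s) by [].
  have -> : s `^ (- n) = s * s `^ (- n - 1).
    rewrite -{2}(powRr1 (ltW s0)) -powRD; first by congr (_ `^ _); ring.
    by rewrite (gt_eqF s0) /= implybT.
  by rewrite /GRing.scale /=; ring.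
have txx : t * x <= x by rewrite ler_piMl// ltW.
have [c /[!in_itv]/= /andP[c1 c2] E] :
    exists2 c, c \in `[t * x, x]%R & g x - g (t * x) = dg c * (x - t * x).
  apply: MVT_segment => //.
    by move=> c /[!in_itv]/= /andP[c1 c2]; apply: dgP; lra.
  apply: derivable_within_continuous => c /[!in_itv]/= /andP[c1 _].
  by have [] := dgP c ltac:(lra).
have : g x - g (t * x) <= 0.
  rewrite E mulr_le0_ge0 ?subr_ge0// /dg mulr_ge0_le0 ?powR_ge0// subr_le0.
  by apply: wn; lra.
rewrite subr_le0 /g powRM ?(ltW x0) ?(ltW t0)// mulrA (ler_pM2r (powR_gt0 _ x0)).
by rewrite [t `^ (- n)]powRN ler_pdivlMr ?powR_gt0// mulrC.
Qed.

(** The difference [k] of the two sides vanishes at [t = 1] and is non-negative to the left of it,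
    so its derivative at [1] is at most [0]. *)
Lemma primitive_powR_scale_inv (R : realType) (w : R -> R) (N x : R) :
  continuous w ->
  (forall t, 0 < t <= 1 -> t `^ N * primitive w x <= t * primitive w (t * x)) ->
  primitive w x + x * w x <= N * primitive w x.
Proof.
move=> cw H.
pose k (t : R) := t * primitive w (t * x) - t `^ N * primitive w x.
have dk : is_derive (1 : R) 1 k (primitive w x + x * w x - N * primitive w x).
  have dp : is_derive (1 * x) 1 (primitive w) (w (1 * x)) by exact: is_derive_primitive.
  have d1 : is_derive (1 : R) 1 (fun t => t * x) x.
    have := is_derive_affine 0 x (1 : R); congr is_derive.
    by apply/funext => t; rewrite add0r mulrC.
  have d2 := @is_derive1_comp R (primitive w) (fun t => t * x) 1 _ _ dp d1.
  have d3 := is_deriveM (is_derive_id (1 : R) 1) d2.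
  have d4 := is_derive1_powR N (@ltr01 R).
  have d5 := is_deriveM d4 (is_derive_cst (primitive w x) (1 : R) 1).
  have := is_deriveB d3 d5.
  rewrite /GRing.scale /= !mul1r !mulr1 mulr0 add0r powR1 mulr1.
  rewrite (_ : w x * x + primitive w x - primitive w x * N =
     primitive w x + x * w x - N * primitive w x); last by ring.
  by congr is_derive.
suff : primitive w x + x * w x - N * primitive w x <= 0 by lra.
have [dk1 dk2] := dk.
rewrite -dk2.
have k1 : k 1 = 0 by rewrite /k mul1r powR1 !mul1r subrr.
have C : (fun h : R => h^-1 *: (k (h *: 1 + 1) - k 1)) @ 0^'- --> 'D_1 k (1 : R).
  exact: cvg_dnbhs_at_left dk1.
apply: (cvgr_to_le C).
near=> h.
have h0 : h < 0 by near: h; exact: nbhs_left_lt.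
have h1 : - 1 < h by near: h; apply: nbhs_left_gt; lra.
rewrite k1 subr0 /GRing.scale /= mulr1 mulr_le0_ge0 ?invr_le0 ?(ltW h0)//.
rewrite /k subr_ge0; apply: H; lra.
Unshelve. all: by end_near. Qed.

(** * Horizontal curves and their length *)

Lemma integral_is_derive (R : realType) (f F : R -> R) (a b : R) : a <= b ->
  continuous f -> (forall x : R, is_derive x 1 F (f x)) ->
  (\int[@lebesgue_measure R]_(x in `[a, b]) (f x)%:E = (F b - F a)%:E)%E.
Proof.
rewrite le_eqVlt => /predU1P[<- _ _|ab cf dF].
  by rewrite set_itv1 integral_set1 subrr.
have cF := is_derive_continuous dF.
rewrite (@continuous_FTC2 _ f F)//.
- exact: continuous_subspaceT.
- split => [x _| |].
  + by have [] := dF x.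
  + by apply: cvg_at_right_filter; exact: cF.
  + by apply: cvg_at_left_filter; exact: cF.
- by move=> x _; rewrite derive1E; have [_ ->] := dF x.
Qed.

Definition clamp (R : realType) (a b t : R) : R := Num.max a (Num.min b t).

Lemma clamp_itv (R : realType) (a b t : R) : a <= b -> a <= clamp a b t <= b.
Proof.
by move=> ab; rewrite /clamp le_max lexx/= ge_max ab /= ge_min lexx.
Qed.

Lemma clamp_id (R : realType) (a b t : R) : a <= t <= b -> clamp a b t = t.
Proof. by move=> /andP[ta tb]; rewrite /clamp min_r// max_r. Qed.

Lemma clamp_contraction (R : realType) (a b s t : R) :
  `|clamp a b s - clamp a b t| <= `|s - t|.
Proof.
have H (m x y : R) : `|Num.min m x - Num.min m y| <= `|x - y|.
  by rewrite ler_norml !minElt; case: (ltP m x); case: (ltP m y) => ? ? /=;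
    have := ler_norm (x - y); have := ler_norm (- (x - y)); rewrite normrN; lra.
have K (m x y : R) : `|Num.max m x - Num.max m y| <= `|x - y|.
  by rewrite ler_norml !maxElt; case: (ltP m x); case: (ltP m y) => ? ? /=;
    have := ler_norm (x - y); have := ler_norm (- (x - y)); rewrite normrN; lra.
exact: le_trans (K _ _ _) (H _ _ _).
Qed.

Lemma lipschitz_continuous (R : realType) (f : R -> R) (L : R) :
  (forall s t, `|f s - f t| <= L * `|s - t|) -> continuous f.
Proof.
move=> fL x; apply/cvgrPdist_le => e e0.
have L0 : 0 < `|L| + 1 by rewrite ltr_wpDl.
near=> y; apply: (le_trans (fL _ _)).
apply: (@le_trans _ _ ((`|L| + 1) * `|x - y|)).
  by rewrite ler_wpM2r// (le_trans (ler_norm L))// lerDl.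
rewrite mulrC -ler_pdivlMr//; near: y.
by apply: cvgr_dist_le => //; rewrite divr_gt0.
Unshelve. all: by end_near. Qed.

Lemma ae_neq (R : realType) (b : R) :
  {ae @lebesgue_measure R, forall t, t != b}.
Proof.
exists [set b]; split => //; first exact: lebesgue_measure_set1.
by move=> t /= /negP; rewrite negbK => /eqP.
Qed.

Lemma ae_mono (R : realType) (P Q : R -> Prop) : (forall t, P t -> Q t) ->
  {ae @lebesgue_measure R, forall t, P t} -> {ae @lebesgue_measure R, forall t, Q t}.
Proof. exact: (@filterS _ _ (ae_filter_ringOfSetsType (@lebesgue_measure R))). Qed.

Lemma ae_mono2 (R : realType) (P Q S : R -> Prop) : (forall t, P t -> Q t -> S t) ->
  {ae @lebesgue_measure R, forall t, P t} -> {ae @lebesgue_measure R, forall t, Q t} ->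
  {ae @lebesgue_measure R, forall t, S t}.
Proof. exact: (@filterS2 _ _ (ae_filter_ringOfSetsType (@lebesgue_measure R))). Qed.

(* Dominated convergence of the difference quotients of [H], extended by constants
   outside [`[a, b]]. *)
Lemma lipschitz_FTC (R : realType) (H d : R -> R) (a b L : R) : a < b ->
  (forall s t, a <= s <= b -> a <= t <= b -> `|H s - H t| <= L * `|s - t|) ->
  measurable_fun `[a, b] d ->
  {ae @lebesgue_measure R, forall t : R, t \in `[a, b] -> is_derive t 1 H (d t)} ->
  (@lebesgue_measure R).-integrable `[a, b] (EFin \o d) /\
  (\int[@lebesgue_measure R]_(t in `[a, b]) (d t)%:E = (H b - H a)%:E)%E.
Proof.
move=> ab HL md dH; pose G t := H (clamp a b t).
have ab' := ltW ab.
have L0 : 0 <= L.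
  have := HL a b; rewrite !lexx ab' => /(_ isT isT) h.
  have : 0 <= L * `|a - b| by apply: le_trans h.
  by rewrite pmulr_lge0// normr_gt0 subr_eq0 lt_eqF.
have GL s t : `|G s - G t| <= L * `|s - t|.
  apply: (le_trans (HL _ _ (clamp_itv _ ab') (clamp_itv _ ab'))).
  by rewrite ler_wpM2l// clamp_contraction.
have cG : continuous G := lipschitz_continuous GL.
(* The integral of [f n] is a difference of quotients of [K] at [b] and at [a], whose limits are
   [G b] and [G a]. *)
pose K := primitive G.
have dK := is_derive_primitive cG.
pose s (n : nat) : R := n.+1%:R^-1.
have s0 n : 0 < s n by rewrite invr_gt0.
pose f n t := (s n)^-1 * (G (t + s n) - G t).
have sshift (n : nat) (x : R) : is_derive x 1 (fun t => t + s n) (1 : R).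
  rewrite -[X in is_derive _ _ _ X]addr0.
  exact: (is_deriveD (is_derive_id x 1) (is_derive_cst (s n) x 1)).
have dF n (x : R) : is_derive x 1 (fun t => (s n)^-1 * (K (t + s n) - K t)) (f n x).
  apply: is_deriveZ; apply: is_deriveB.
  rewrite -[X in is_derive _ _ _ X]mulr1.
  exact: (@is_derive1_comp _ K (fun t => t + s n) x _ _ (dK _) (sshift n x)).
have cf n : continuous (f n).
  move=> x; apply: cvgM; first exact: cvg_cst.
  apply: cvgB; last exact: cG.
  apply: (@continuous_comp _ _ _ (fun t => t + s n) G); last exact: cG.
  by apply: cvgD; [exact: cvg_id|exact: cvg_cst].
have If n : (\int[@lebesgue_measure R]_(t in `[a, b]) (f n t)%:E =
   ((s n)^-1 * (K (b + s n) - K b) - (s n)^-1 * (K (a + s n) - K a))%:E)%E.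
  by rewrite (integral_is_derive ab' (cf n) (dF n)).
have s_cvg : s @ \oo --> (0 : R)^'.
  move=> A /= [e /= e0 eA].
  have [N _ hN] := @cvg_harmonic R (ball (0 : R) e) (nbhsx_ballx _ _ e0).
  by exists N => // n /hN /eA; apply; rewrite gt_eqF.
have dfun n : (@lebesgue_measure R).-integrable `[a, b] (EFin \o f n).
  apply: continuous_compact_integrable; first exact: segment_compact.
  exact: continuous_subspaceT.
have mf n : measurable_fun `[a, b] (EFin \o f n) by exact: measurable_int (dfun n).
have ff : {ae @lebesgue_measure R, forall t, [set` `[a, b]] t ->
    (EFin \o f n) t @[n --> \oo] --> (EFin \o d) t}.
  (* At [t = b] the quotients of the constant extension vanish whatever [d b] is; for [t < b] the
     point [t + s n] is eventually inside the interval. *)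
  refine (ae_mono2 _ dH (ae_neq b)) => t dHt tb tab.
  have [dt1 dt2] := dHt tab; apply: cvg_EFin; first exact: nearW.
  have C : (fun h : R => h^-1 *: (H (h *: 1 + t) - H t)) \o s @ \oo --> d t.
    by rewrite -dt2; apply: cvg_comp s_cvg _; exact: dt1.
  apply: cvg_trans C; apply: near_eq_cvg.
  move: tab; rewrite /= in_itv/= => /andP[ta tb'].
  have {}tb : 0 < b - t by rewrite subr_gt0 lt_neqAle tb.
  have : \forall n \near \oo, s n < b - t.
    have := @cvg_harmonic R => /cvgrPdist_lt/(_ _ tb).
    by apply: filterS => n; rewrite sub0r normrN ger0_norm// ltW.
  apply: filterS => n sn /=; rewrite /f /G /GRing.scale /= mulr1.
  rewrite (@clamp_id _ a b t) ?ta ?tb'// (@clamp_id _ a b (t + s n)).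
    by rewrite [s n + t]addrC.
  by have := s0 n; lra.
have ig : (@lebesgue_measure R).-integrable `[a, b] (fun=> L%:E).
  have := @continuous_compact_integrable R (fun=> L) `[a, b] (@segment_compact _ a b).
  by apply; apply: continuous_subspaceT => x; exact: cvg_cst.
have fL : {ae @lebesgue_measure R, forall t, forall n : nat, [set` `[a, b]] t ->
    (`|(EFin \o f n) t| <= L%:E)%E}.
  apply: aeW => t n _ /=; rewrite lee_fin /f normrM gtr0_norm ?invr_gt0//.
  rewrite ler_pdivrMl// mulrC (le_trans (GL _ _))//.
  by rewrite addrC addKr gtr0_norm// mulrC.
have md' : measurable_fun `[a, b] (EFin \o d) by exact/measurable_EFinP.
have [id _ C] := @dominated_convergence _ _ R (@lebesgue_measure R) _
  (measurable_itv _) _ _ _ mf md' ff ig fL.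
split=> //.
have quot (x : R) : (s n)^-1 * (K (x + s n) - K x) @[n --> \oo] --> G x.
  have [dt1 dt2] := dK x; rewrite -dt2.
  have C0 : (fun h : R => h^-1 *: (K (h *: 1 + x) - K x)) \o s @ \oo --> 'D_1 K x.
    by apply: cvg_comp s_cvg _; exact: dt1.
  apply: cvg_trans C0; apply: near_eq_cvg.
  by apply: nearW => n /=; rewrite /GRing.scale /= mulr1 [s n + x]addrC.
have C2 : (((s n)^-1 * (K (b + s n) - K b) - (s n)^-1 * (K (a + s n) - K a))%:E)
     @[n --> \oo] --> (H b - H a)%:E.
  apply: cvg_EFin; first exact: nearW.
  have -> : H b = G b by rewrite /G clamp_id// lexx ab'.
  have -> : H a = G a by rewrite /G clamp_id// lexx ab'.
  by apply: cvgB; exact: quot.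
apply: (@cvg_unique _ (@ereal_hausdorff R) _ _ _ _ C).
move=> /=; apply: cvg_trans C2; apply: near_eq_cvg; apply: nearW => n /=.
exact/esym/If.
Qed.

Import HBNNSimple.

(* The integrand of [curve_length] is only almost everywhere equal to a measurable
   function, so the two facts below cannot assume its measurability. *)
Lemma ge0_integral_subset_nonmeasurable d (T : measurableType d) (R : realType)
    (mu : {measure set T -> \bar R}) (A D : set T) (f : T -> \bar R) :
  A `<=` D -> (forall x, D x -> 0 <= f x)%E ->
  (\int[mu]_(x in A) f x <= \int[mu]_(x in D) f x)%E.
Proof.
move=> AD f0; rewrite !ge0_integralE//; last by move=> x /AD/f0.
apply: ge_ereal_sup => _ [h /= hf <-]; apply: ereal_sup_ubound; exists h => //= x.
apply: (le_trans (hf x)); rewrite /patch; case: ifPn => xA; case: ifPn => xD //.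
  by move: xD; rewrite notin_setE => /(_ (AD _ (set_mem xA))).
by apply: f0; exact: set_mem.
Qed.

Lemma ge0_ae_eq_integral_nonmeasurable d (T : measurableType d) (R : realType)
    (mu : {measure set T -> \bar R}) (D : set T) (f g : T -> \bar R) :
  measurable D -> (forall x, D x -> 0 <= f x)%E -> (forall x, D x -> 0 <= g x)%E ->
  measurable_fun D g -> {ae mu, forall x, D x -> f x = g x} ->
  (\int[mu]_(x in D) f x = \int[mu]_(x in D) g x)%E.
Proof.
move=> mD f0 g0 mg [N [mN N0 fgN]].
have fg x : ~ N x -> D x -> f x = g x.
  by move=> Nx; apply: contrapT => fgx; apply: Nx; apply: fgN.
apply/eqP; rewrite eq_le; apply/andP; split.
  (* The integral of [f] is a supremum over simple functions below [f], and each of them is almost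
     everywhere below [g]. For the converse the null set [N] is removed from the integral of [g]. *)
  rewrite (integral_mkcond _ g) [leLHS]ge0_integralE//.
  apply: ge_ereal_sup => _ [h /= hf <-]; rewrite -integralT_nnsfun.
  have mgD : measurable_fun setT (g \_ D) by exact/(measurable_restrictT _ _).1.
  apply: ae_ge0_le_integral => //=.
  - by move=> x _; rewrite lee_fin fun_ge0.
  - by apply/measurable_EFinP; exact: measurable_funPT.
  - by move=> x _; apply: erestrict_ge0.
  exists N; split => // x /= hgx; apply: contrapT => Nx; apply: hgx => _.
  apply: (le_trans (hf x)); rewrite /patch; case: ifPn => // xD.
  by rewrite fg//; exact: set_mem.
rewrite (ge0_negligible_integral mN)//.
rewrite (eq_integral f); last first.
  by move=> x /[!inE] -[Dx Nx]; rewrite fg.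
by apply: ge0_integral_subset_nonmeasurable => // x [].
Qed.

Lemma continuous_fst (R : realType) : continuous (fun p : R * R => p.1).
Proof. by move=> p; exact: cvg_fst. Qed.

Lemma continuous_snd (R : realType) : continuous (fun p : R * R => p.2).
Proof. by move=> p; exact: cvg_snd. Qed.

Lemma is_derive_fst (R : realType) (g : R -> R * R) (t : R) (w : R * R) :
  is_derive t 1 g w -> is_derive t 1 (fun s => (g s).1) w.1.
Proof.
move=> [dg <-].
have C : (fun h : R => h^-1 *: ((g (h *: 1 + t)).1 - (g t).1)) @ (0 : R)^' --> ('D_1 g t).1.
  have dg' : (fun h : R => h^-1 *: (g (h *: 1 + t) - g t)) @ (0 : R)^' --> 'D_1 g t by exact: dg.
  exact: (@cvg_comp _ _ _ _ (fun p : R * R => p.1) _ _ _ dg' (@continuous_fst R _)).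
by apply: DeriveDef; [apply/cvg_ex; exists ('D_1 g t).1|exact/cvg_lim].
Qed.

Lemma is_derive_snd (R : realType) (g : R -> R * R) (t : R) (w : R * R) :
  is_derive t 1 g w -> is_derive t 1 (fun s => (g s).2) w.2.
Proof.
move=> [dg <-].
have C : (fun h : R => h^-1 *: ((g (h *: 1 + t)).2 - (g t).2)) @ (0 : R)^' --> ('D_1 g t).2.
  have dg' : (fun h : R => h^-1 *: (g (h *: 1 + t) - g t)) @ (0 : R)^' --> 'D_1 g t by exact: dg.
  exact: (@cvg_comp _ _ _ _ (fun p : R * R => p.2) _ _ _ dg' (@continuous_snd R _)).
by apply: DeriveDef; [apply/cvg_ex; exists ('D_1 g t).2|exact/cvg_lim].
Qed.

Lemma is_derive_pair (R : realType) (f g : R -> R) (t a b : R) :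
  is_derive t 1 f a -> is_derive t 1 g b ->
  is_derive t 1 (fun s => (f s, g s)) (a, b).
Proof.
move=> [df <-] [dg <-].
have C : (fun h : R => h^-1 *: ((f (h *: 1 + t), g (h *: 1 + t)) - (f t, g t)))
    @ (0 : R)^' --> ('D_1 f t, 'D_1 g t).
  have df' : (fun h : R => h^-1 *: (f (h *: 1 + t) - f t)) @ (0 : R)^' --> 'D_1 f t by exact: df.
  have dg' : (fun h : R => h^-1 *: (g (h *: 1 + t) - g t)) @ (0 : R)^' --> 'D_1 g t by exact: dg.
  exact: (cvg_pair df' dg').
by apply: DeriveDef; [apply/cvg_ex; exists ('D_1 f t, 'D_1 g t)|exact/cvg_lim].
Qed.

Lemma grushin_fieldE (R : realType) (alpha a b : R) (p : R * R) :
  a *: fieldX p + b *: fieldY alpha p = (a, b * `|p.1| `^ alpha).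
Proof.
by rewrite /fieldX /fieldY; congr pair; rewrite /= /GRing.scale /=
  ?mulr1 ?mulr0 ?addr0 ?add0r.
Qed.

Lemma grushin_norm_ge0 (R : realType) (alpha : R) (p w : R * R) :
  (0 <= grushin_norm alpha p w)%E.
Proof.
by apply: le_ereal_inf_tmp => _ [ab _ <-]; rewrite lee_fin sqrtr_ge0.
Qed.

Lemma grushin_normE (R : realType) (alpha a b : R) (p : R * R) :
  (p.1 = 0 -> b = 0) ->
  grushin_norm alpha p (a, b * `|p.1| `^ alpha) = (Num.sqrt (a ^+ 2 + b ^+ 2))%:E.
Proof.
move=> b0; apply/eqP; rewrite eq_le; apply/andP; split.
  apply: ereal_inf_lbound; exists (a, b) => //=.
  by rewrite grushin_fieldE.
apply: le_ereal_inf_tmp => x [[a' b']] /=; rewrite grushin_fieldE => -[-> bE] <-.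
rewrite lee_fin ler_wsqrtr// lerD2l.
have [/b0->|x0] := eqVneq p.1 0; first by rewrite expr0n/= sqr_ge0.
have : b = b' by apply: mulIf bE; rewrite gt_eqF// powR_gt0// normr_gt0.
by move=> ->.
Qed.

Lemma measurable_lipschitz (R : realType) (f : R -> R) (T L : R) :
  0 < T ->
  (forall s t, 0 <= s <= T -> 0 <= t <= T -> `|f s - f t| <= L * `|s - t|) ->
  measurable_fun `[0, T] f.
Proof.
move=> T0 fL.
have : measurable_fun setT (fun t => f (clamp 0 T t)).
  apply: continuous_measurable_fun; apply: (@lipschitz_continuous _ _ `|L|) => s t.
  have c01 u : 0 <= clamp 0 T u <= T by apply: clamp_itv; exact: ltW.
  apply: (le_trans (fL _ _ (c01 s) (c01 t))).
  by rewrite (le_trans (ler_wpM2r _ (ler_norm L)))// ler_wpM2l// clamp_contraction.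
move=> /(measurable_funS measurableT (@subsetT _ `[0, T]%classic)).
apply: eq_measurable_fun => t /[!inE]/=; rewrite in_itv/= => tT.
by rewrite clamp_id.
Qed.

Definition control_speed (R : realType) (a b : R -> R) (t : R) : R :=
  Num.sqrt (a t ^+ 2 + b t ^+ 2).

(* The second control of a horizontal curve is arbitrary where [x = 0]; setting it
   to zero there makes [control_speed a b] the norm of the velocity. *)
Record controlled (R : realType) (alpha T : R) (g : R -> R * R) (a b : R -> R)
    (L : R) : Prop := Controlled {
  controlled_lip1 : forall s t, 0 <= s <= T -> 0 <= t <= T ->
    `|(g s).1 - (g t).1| <= L * `|s - t|;
  controlled_lip2 : forall s t, 0 <= s <= T -> 0 <= t <= T ->
    `|(g s).2 - (g t).2| <= L * `|s - t|;
  controlled_meas1 : measurable_fun `[0, T] a;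
  controlled_meas2 : measurable_fun `[0, T] b;
  controlled_derive : {ae @lebesgue_measure R, forall t : R, t \in `[0, T] ->
    [/\ is_derive t 1 (fun s => (g s).1) (a t),
        is_derive t 1 (fun s => (g s).2) (b t * `|(g t).1| `^ alpha) &
        grushin_norm alpha (g t) (derive1 g t) = (control_speed a b t)%:E]};
  controlled_zero : forall t, (g t).1 = 0 -> b t = 0 }.

Lemma measurable_control_speed (R : realType) (alpha T : R) g (a b : R -> R) L :
  controlled alpha T g a b L -> measurable_fun `[0, T] (control_speed a b).
Proof.
move=> [_ _ ma mb _ _]; apply: measurableT_comp.
  exact: (continuous_measurable_fun (@sqrt_continuous R)).
by apply: measurable_funD; exact: measurable_funX.
Qed.

Lemma controlled_length (R : realType) (alpha T : R) g (a b : R -> R) L :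
  controlled alpha T g a b L ->
  curve_length alpha T g = (\int[@lebesgue_measure R]_(t in `[0%R, T]) (control_speed a b t)%:E)%E.
Proof.
move=> C; apply: ge0_ae_eq_integral_nonmeasurable => //.
- by move=> t _; exact: grushin_norm_ge0.
- by move=> t _; rewrite lee_fin sqrtr_ge0.
- by apply/measurable_EFinP; exact: measurable_control_speed C.
by apply: ae_mono (controlled_derive C) => t /[apply] -[].
Qed.

Lemma horizontal_controlled (R : realType) (alpha T : R) (g : R -> R * R) :
  0 < alpha -> 0 < T -> horizontal alpha T g -> exists a b L, controlled alpha T g a b L.
Proof.
move=> al0 T0 [[M [_ gM]] [a [b [[ma _] [mb _] dg]]]].
(* The Lipschitz condition is stated for all constants close to [+oo]: it is known only for those
   strictly above [M]. *)
pose L := `|M| + 1.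
have {}gM s t : 0 <= s <= T -> 0 <= t <= T -> `|g s - g t| <= L * `|s - t|.
  move=> sT tT; have ML : M < L by rewrite /L; have := ler_norm M; lra.
  by apply: (gM L ML (s, t)) => /=; rewrite !in_itv.
have g1 s t : 0 <= s <= T -> 0 <= t <= T -> `|(g s).1 - (g t).1| <= L * `|s - t|.
  move=> sT tT; apply: le_trans (gM s t sT tT).
  by rewrite prod_normE le_max lexx.
have g2 s t : 0 <= s <= T -> 0 <= t <= T -> `|(g s).2 - (g t).2| <= L * `|s - t|.
  move=> sT tT; apply: le_trans (gM s t sT tT).
  by rewrite prod_normE le_max lexx orbT.
exists a, (fun t => if (g t).1 == 0 then 0 else b t), L; split => //.
- have mx := measurable_lipschitz T0 g1.
  apply: measurable_fun_if => //.
    by apply: measurable_fun_eqr.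
  exact: measurable_funS mb.
- apply: ae_mono dg => t /[apply]; rewrite grushin_fieldE.
  have -> : b t * `|(g t).1| `^ alpha =
     (if (g t).1 == 0 then 0 else b t) * `|(g t).1| `^ alpha.
    by case: eqP => [->|//]; rewrite normr0 powR0 ?mulr0 ?gt_eqF.
  move=> dgt; split.
  + exact: (is_derive_fst dgt).
  + exact: (is_derive_snd dgt).
  + have [_ dE] := dgt; rewrite derive1E dE grushin_normE// => ->.
    by rewrite eqxx.
by move=> t ->; rewrite eqxx.
Qed.

(** * Geodesics as graphs over a horizontal line *)

(* The horizontal speed of the unit speed geodesic with vertical momentum [v], where
   [h r] is the weight [|x|^alpha] at abscissa [r].  The truncation at [z0 < 1]
   keeps it positive everywhere; it is inactive under [grushin_strip] below. *)
Definition grushin_speed (R : realType) (h : R -> R) (z0 v r : R) : R :=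
  Num.sqrt (1 - Num.min ((v * h r) ^+ 2) z0).

Definition grushin_time (R : realType) (h : R -> R) (z0 v : R) : R -> R :=
  primitive (fun r => (grushin_speed h z0 v r)^-1).

Definition grushin_height (R : realType) (h : R -> R) (z0 v : R) : R -> R :=
  primitive (fun r => v * h r ^+ 2 / grushin_speed h z0 v r).

(* Upper bound for the inverse of [grushin_speed]. *)
Definition grushin_kappa (R : realType) (z0 : R) : R := (Num.sqrt (1 - z0))^-1.

Lemma kappa_ge1 (R : realType) (z0 : R) : 0 <= z0 < 1 -> 1 <= grushin_kappa z0.
Proof.
move=> /andP[z00 z01]; have s0 : 0 < Num.sqrt (1 - z0) by rewrite sqrtr_gt0 subr_gt0.
rewrite /grushin_kappa invf_ge1// -[leRHS]sqrtr1 ler_wsqrtr//; lra.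
Qed.

Lemma grushin_speed_itv (R : realType) (h : R -> R) (z0 v r : R) : 0 <= z0 < 1 ->
  (grushin_kappa z0)^-1 <= grushin_speed h z0 v r <= 1.
Proof.
move=> /andP[z00 z01]; rewrite /grushin_kappa invrK /grushin_speed; apply/andP; split.
  by apply: ler_wsqrtr; rewrite lerD2l lerN2 ge_min lexx orbT.
rewrite -[leRHS]sqrtr1 ler_wsqrtr// lerBlDr lerDl le_min z00 andbT.
exact: sqr_ge0.
Qed.

Lemma grushin_speed_gt0 (R : realType) (h : R -> R) (z0 v r : R) : 0 <= z0 < 1 ->
  0 < grushin_speed h z0 v r.
Proof.
move=> z01; have /andP[+ _] := grushin_speed_itv h v r z01.
by apply: lt_le_trans; rewrite invr_gt0; have := kappa_ge1 z01; lra.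
Qed.

Lemma grushin_speedV_itv (R : realType) (h : R -> R) (z0 v r : R) : 0 <= z0 < 1 ->
  1 <= (grushin_speed h z0 v r)^-1 <= grushin_kappa z0.
Proof.
move=> z01; have q0 := grushin_speed_gt0 h v r z01.
have /andP[q1 q2] := grushin_speed_itv h v r z01.
rewrite invf_ge1// q2 /=.
have k0 : 0 < grushin_kappa z0 by have := kappa_ge1 z01; lra.
by rewrite -[X in _ <= X]invrK lef_pV2 // posrE invr_gt0.
Qed.

Lemma continuous_grushin_speed (R : realType) (h : R -> R) (z0 v : R) :
  continuous h -> continuous (grushin_speed h z0 v).
Proof.
move=> ch r; rewrite /grushin_speed.
apply: (@continuous_comp _ _ _ (fun r => 1 - Num.min ((v * h r) ^+ 2) z0) Num.sqrt);
  last exact: sqrt_continuous.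
apply: cvgB; first exact: cvg_cst.
apply: (@continuous_min _ _ (fun r => (v * h r) ^+ 2) (fun=> z0)); last exact: cvg_cst.
apply: (@continuous_comp _ _ _ (fun r => v * h r) (fun z => z ^+ 2)).
  by apply: cvgM; [exact: cvg_cst|exact: ch].
exact: exprn_continuous.
Qed.

Lemma continuous_grushin_speedV (R : realType) (h : R -> R) (z0 v : R) :
  0 <= z0 < 1 -> continuous h -> continuous (fun r => (grushin_speed h z0 v r)^-1).
Proof.
move=> z01 ch r; apply: cvgV; first by rewrite gt_eqF// grushin_speed_gt0.
exact: continuous_grushin_speed.
Qed.

Lemma continuous_sqr_comp (R : realType) (h : R -> R) : continuous h ->
  continuous (fun r => h r ^+ 2).
Proof.
move=> ch r; apply: (@continuous_comp _ _ _ h (fun z => z ^+ 2)); first exact: ch.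
exact: exprn_continuous.
Qed.

Lemma continuous_grushin_height_deriv (R : realType) (h : R -> R) (z0 v : R) :
  0 <= z0 < 1 -> continuous h ->
  continuous (fun r => v * h r ^+ 2 / grushin_speed h z0 v r).
Proof.
move=> z01 ch r; apply: cvgM; last exact: continuous_grushin_speedV.
by apply: cvgM; [exact: cvg_cst|exact: continuous_sqr_comp].
Qed.

Lemma grushin_time_bounds (R : realType) (h : R -> R) (z0 v r r' : R) :
  0 <= z0 < 1 -> continuous h -> r <= r' ->
  1 * (r' - r) <= grushin_time h z0 v r' - grushin_time h z0 v r
               <= grushin_kappa z0 * (r' - r).
Proof.
move=> z01 ch rr; apply: primitive_bounds => //.
  exact: continuous_grushin_speedV.
by move=> x _; exact: grushin_speedV_itv.
Qed.

(** The derivative of [u / sqrt (1 - u ^ 2)] is the power [- 3 / 2] of [1 - u ^ 2], which lies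
    between [1] and [m ^ - 3]. The proof is algebraic: with [A] and [B] the two roots, the
    difference factors as in [E], and [A * B <= 1 + u * u'] and [A * B <= 1 - u * u'] bound the
    factor from below and above. *)
Lemma sqrt_quotient_bounds (R : realType) (u u' m : R) : u <= u' -> 0 < m ->
  u ^+ 2 <= 1 - m ^+ 2 -> u' ^+ 2 <= 1 - m ^+ 2 ->
  u' - u <= u' / Num.sqrt (1 - u' ^+ 2) - u / Num.sqrt (1 - u ^+ 2)
         <= m^-1 ^+ 3 * (u' - u).
Proof.
move=> uu m0 um um'.
have A0 : m <= Num.sqrt (1 - u ^+ 2).
  by rewrite -(ger0_norm (ltW m0)) -sqrtr_sqr ler_wsqrtr//; lra.
have B0 : m <= Num.sqrt (1 - u' ^+ 2).
  by rewrite -(ger0_norm (ltW m0)) -sqrtr_sqr ler_wsqrtr//; lra.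
have A2 : Num.sqrt (1 - u ^+ 2) ^+ 2 = 1 - u ^+ 2.
  by rewrite sqr_sqrtr//; have := sqr_ge0 m; lra.
have B2 : Num.sqrt (1 - u' ^+ 2) ^+ 2 = 1 - u' ^+ 2.
  by rewrite sqr_sqrtr//; have := sqr_ge0 m; lra.
move: A0 B0 A2 B2; set A := Num.sqrt (1 - u ^+ 2); set B := Num.sqrt (1 - u' ^+ 2).
move=> A0 B0 A2 B2.
have Ap : 0 < A by lra.
have Bp : 0 < B by lra.
have AB : 0 < A * B by exact: mulr_gt0.
have ABm : 0 < (A + B) * (A * B) by rewrite mulr_gt0// addr_gt0.
have E : u' / B - u / A = (u' - u) * ((A * B + 1 + u * u') / ((A + B) * (A * B))).
  apply/eqP; rewrite -subr_eq0; apply/eqP.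
  transitivity ((u' * (A ^+ 2 + u ^+ 2 - 1) - u * (B ^+ 2 + u' ^+ 2 - 1)) / ((A + B) * (A * B))).
    by field; rewrite !gt_eqF// addr_gt0.
  by rewrite A2 B2; field; rewrite !gt_eqF// addr_gt0.
have m21 : m ^+ 2 > 0 by rewrite exprn_gt0.
have sq (x y : R) : 0 <= y -> x ^+ 2 <= y ^+ 2 -> x <= y.
  move=> y0 xy; rewrite (le_trans (ler_norm x))// -(ger0_norm y0).
  by rewrite -ler_sqr ?nnegrE// !real_normK ?num_real.
have uv1 : - 1 <= u * u' <= 1.
  have h1 := sqr_ge0 (u + u'); have h2 := sqr_ge0 (u - u').
  by move: h1 h2; rewrite !expr2 in um um' m21 *; lra.
have c1 : A * B <= 1 + u * u'.
  apply: sq; first lra.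
  rewrite exprMn A2 B2 -subr_ge0; have := sqr_ge0 (u + u'); rewrite !expr2; lra.
have c2 : A * B <= 1 - u * u'.
  apply: sq; first lra.
  rewrite exprMn A2 B2 -subr_ge0; have := sqr_ge0 (u - u'); rewrite !expr2; lra.
have A1 : A <= 1 by apply: sq => //; rewrite A2 expr1n; have := sqr_ge0 u; lra.
have B1 : B <= 1 by apply: sq => //; rewrite B2 expr1n; have := sqr_ge0 u'; lra.
rewrite E; apply/andP; split.
  rewrite -[leLHS]mulr1 ler_wpM2l ?subr_ge0// ler_pdivlMr// mul1r.
  have : (A + B) * (A * B) <= 2 * (A * B) by rewrite ler_pM2r//; lra.
  lra.
rewrite mulrC ler_wpM2r ?subr_ge0// ler_pdivrMr//.
apply: (@le_trans _ _ 2); first lra.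
rewrite exprVn mulrC ler_pdivlMr ?exprn_gt0//.
have h1 : m * m <= A * B by apply: ler_pM => //; exact: ltW.
have : (m + m) * (m * m) <= (A + B) * (A * B).
  by apply: ler_pM => //; [lra|rewrite mulr_ge0// ltW|lra].
by rewrite !exprS expr0 mulr1; lra.
Qed.

Lemma clamp_mono (R : realType) (a b s t : R) : s <= t ->
  clamp a b s <= clamp a b t /\ s - clamp a b s <= t - clamp a b t.
Proof.
move=> st; rewrite /clamp !maxElt !minElt.
by split; case: (ltP b s); case: (ltP b t) => ? ?; rewrite ?ltxx;
  do ?[case: ltP => ? //=]; lra.
Qed.

Lemma truncated_quotient_bounds (R : realType) (z0 u u' : R) : 0 <= z0 < 1 ->
  u <= u' ->
  u' - u <= u' / Num.sqrt (1 - Num.min (u' ^+ 2) z0) -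
            u / Num.sqrt (1 - Num.min (u ^+ 2) z0)
         <= grushin_kappa z0 ^+ 3 * (u' - u).
Proof.
move=> z01 uu; have k1 := kappa_ge1 z01; have /andP[z00 z01'] := z01.
pose e := Num.sqrt z0; have e0 : 0 <= e by exact: sqrtr_ge0.
have e2 : e ^+ 2 = z0 by rewrite sqr_sqrtr.
pose c x := clamp (- e) e x.
have ce x : - e <= c x <= e by apply: clamp_itv; lra.
have c2 x : c x ^+ 2 <= z0.
  by rewrite -e2 -real_normK ?num_real// ler_sqr ?nnegrE// ler_norml; exact: ce.
(* Beyond [e = sqrt z0] the truncated quotient is linear of slope [grushin_kappa z0]. It is thus the
   untruncated quotient at the clamped argument plus a linear remainder, and both parts are
   increasing with slopes between [1] and [kappa ^ 3]. *)
have cE x : x / Num.sqrt (1 - Num.min (x ^+ 2) z0) =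
    c x / Num.sqrt (1 - c x ^+ 2) + grushin_kappa z0 * (x - c x).
  have [xe|/negP xe] := boolP (- e <= x <= e).
    rewrite /c clamp_id// subrr mulr0 addr0 min_l//.
    by rewrite -e2 -real_normK ?num_real// ler_sqr ?nnegrE// ler_norml.
  have xz : z0 <= x ^+ 2.
    rewrite leNgt; apply/negP => xz; apply: xe; rewrite -ler_norml.
    by rewrite -ler_sqr ?nnegrE// real_normK ?num_real// e2 ltW.
  have cz : c x ^+ 2 = z0.
    rewrite -e2; apply/eqP; rewrite eqf_sqr /c /clamp; apply/orP.
    have [xe2|xe2] := leP x e; last by left; rewrite max_r//; lra.
    right; rewrite max_l//.
    by rewrite leNgt; apply/negP => h; apply: xe; rewrite (ltW h) xe2.
  by rewrite min_r// cz /grushin_kappa; ring.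
rewrite !cE.
have [cc ucc] := clamp_mono (- e) e uu; rewrite -/(c _) in cc; rewrite -!/(c _) in ucc.
have s0 : 0 < Num.sqrt (1 - z0) by rewrite sqrtr_gt0 subr_gt0.
have s2 : Num.sqrt (1 - z0) ^+ 2 = 1 - z0 by rewrite sqr_sqrtr// subr_ge0 ltW.
have := @sqrt_quotient_bounds R (c u) (c u') (Num.sqrt (1 - z0)) cc s0.
rewrite s2 opprB addrC subrK => /(_ (c2 _) (c2 _)); rewrite -/(grushin_kappa z0).
set k := grushin_kappa z0 in k1 *.
have k3 : k <= k ^+ 3 by rewrite -{1}(expr1 k) ler_weXn2l.
move=> /andP[b1 b2].
have d0 : 0 <= (u' - c u') - (u - c u) by rewrite subr_ge0.
have h1 : (u' - c u') - (u - c u) <= k * ((u' - c u') - (u - c u)).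
  by rewrite ler_peMl.
have h2 : k * ((u' - c u') - (u - c u)) <= k ^+ 3 * ((u' - c u') - (u - c u)).
  by rewrite ler_wpM2r.
by lra.
Qed.

(** The integrand is [h x] times the truncated quotient at [u = v * h x], so its slope in [v] lies
    between [h x ^ 2] and [kappa ^ 3 * h x ^ 2]. This is the source of the factor [I] in the
    distortion. *)
Lemma grushin_height_bounds (R : realType) (h : R -> R) (z0 v v' r : R) :
  0 <= z0 < 1 -> continuous h -> (forall r, 0 <= h r) -> 0 <= r -> v <= v' ->
  primitive (fun r => h r ^+ 2) r * (v' - v) <=
    grushin_height h z0 v' r - grushin_height h z0 v r <=
  grushin_kappa z0 ^+ 3 * primitive (fun r => h r ^+ 2) r * (v' - v).
Proof.
move=> z01 ch h0 r0 vv; set k := grushin_kappa z0.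
have cI := continuous_sqr_comp ch.
have dI := is_derive_primitive cI.
have dY v1 := is_derive_primitive (@continuous_grushin_height_deriv R h z0 v1 z01 ch).
have dYY (x : R) : is_derive x 1 (grushin_height h z0 v' \- grushin_height h z0 v)
   (v' * h x ^+ 2 / grushin_speed h z0 v' x - v * h x ^+ 2 / grushin_speed h z0 v x).
  by apply: is_deriveB; exact: dY.
have dIk (c x : R) : is_derive x 1 (fun x => c * primitive (fun r => h r ^+ 2) x) (c * h x ^+ 2).
  by apply: is_deriveZ; exact: dI.
have pt x : (v' - v) * h x ^+ 2 <=
   v' * h x ^+ 2 / grushin_speed h z0 v' x - v * h x ^+ 2 / grushin_speed h z0 v x <=
   k ^+ 3 * (v' - v) * h x ^+ 2.
  have := truncated_quotient_bounds z01 (ler_wpM2r (h0 x) vv).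
  rewrite -/(grushin_speed h z0 v' x) -/(grushin_speed h z0 v x) => /andP[b1 b2].
  have E : v' * h x ^+ 2 / grushin_speed h z0 v' x - v * h x ^+ 2 / grushin_speed h z0 v x
     = h x * (v' * h x / grushin_speed h z0 v' x - v * h x / grushin_speed h z0 v x).
    by ring.
  rewrite E; apply/andP; split.
    rewrite (_ : _ * h x ^+ 2 = h x * (v' * h x - v * h x)); last by ring.
    exact: ler_wpM2l.
  rewrite (_ : _ * h x ^+ 2 = h x * (k ^+ 3 * (v' * h x - v * h x))); last by ring.
  exact: ler_wpM2l.
have := derivable_homo r0 (dIk (v' - v)) dYY (fun x _ => proj1 (andP (pt x))).
have := derivable_homo r0 dYY (dIk (k ^+ 3 * (v' - v))) (fun x _ => proj2 (andP (pt x))).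
by rewrite /= /grushin_height !primitive0 !mulr0 !subr0 => h1 h2; lra.
Qed.

(** This serves the continuity of the travel time in [v]. With [A] and [B] the two speeds, the
    difference of the inverses is [(A ^ 2 - B ^ 2) / (A * B * (A + B))], and each inverse factor is
    at most [kappa]. *)
Lemma grushin_speedV_lipschitz (R : realType) (h : R -> R) (z0 v v' r : R) :
  0 <= z0 < 1 ->
  (grushin_speed h z0 v' r)^-1 - (grushin_speed h z0 v r)^-1 <=
  grushin_kappa z0 ^+ 3 * `|v' ^+ 2 - v ^+ 2| * h r ^+ 2.
Proof.
move=> z01; set k := grushin_kappa z0.
have /andP[a1 a2] := grushin_speedV_itv h v r z01.
have /andP[b1 b2] := grushin_speedV_itv h v' r z01.
have A0 := grushin_speed_gt0 h v r z01; have B0 := grushin_speed_gt0 h v' r z01.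
have sq x : 0 <= 1 - Num.min ((x * h r) ^+ 2) z0.
  by rewrite subr_ge0 ge_min; case/andP: z01 => _ /ltW ->; rewrite orbT.
have A2 : grushin_speed h z0 v r ^+ 2 = 1 - Num.min ((v * h r) ^+ 2) z0.
  by rewrite sqr_sqrtr.
have B2 : grushin_speed h z0 v' r ^+ 2 = 1 - Num.min ((v' * h r) ^+ 2) z0.
  by rewrite sqr_sqrtr.
move: A0 B0 a1 a2 b1 b2 A2 B2.
set A := grushin_speed h z0 v r; set B := grushin_speed h z0 v' r.
move=> A0 B0 a1 a2 b1 b2 A2 B2.
have min_le : Num.min ((v' * h r) ^+ 2) z0 - Num.min ((v * h r) ^+ 2) z0 <=
    `|v' ^+ 2 - v ^+ 2| * h r ^+ 2.
  have L : (v' * h r) ^+ 2 - (v * h r) ^+ 2 <= `|v' ^+ 2 - v ^+ 2| * h r ^+ 2.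
    by rewrite !exprMn -mulrBl ler_wpM2r ?sqr_ge0// ler_norm.
  have L0 : 0 <= `|v' ^+ 2 - v ^+ 2| * h r ^+ 2 by rewrite mulr_ge0 ?sqr_ge0.
  rewrite !minElt; case: (ltP ((v' * h r) ^+ 2) z0) => ?;
  by case: (ltP ((v * h r) ^+ 2) z0) => ?; lra.
have k1 : 1 <= k by exact: kappa_ge1.
have AB2 : A ^+ 2 - B ^+ 2 <= `|v' ^+ 2 - v ^+ 2| * h r ^+ 2 by rewrite A2 B2; lra.
have E : B^-1 - A^-1 = (A ^+ 2 - B ^+ 2) * (A^-1 * B^-1 * (A + B)^-1).
  by field; rewrite !gt_eqF// addr_gt0.
have AB1 : (A + B)^-1 <= k.
  apply: le_trans a2; rewrite lef_pV2 ?posrE ?addr_gt0// lerDl; exact: ltW.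
have AB0 : 0 <= (A + B)^-1 by rewrite invr_ge0 addr_ge0// ltW.
have K0 : 0 <= A^-1 * B^-1 * (A + B)^-1 by rewrite mulr_ge0// mulr_ge0 ?invr_ge0; lra.
have K3 : A^-1 * B^-1 * (A + B)^-1 <= k ^+ 3.
  rewrite exprSr expr2; apply: ler_pM => //; first by rewrite mulr_ge0 ?invr_ge0; lra.
  by apply: ler_pM => //; lra.
rewrite E -[leRHS]mulrA [leLHS]mulrC.
apply: (@le_trans _ _ (A^-1 * B^-1 * (A + B)^-1 * (`|v' ^+ 2 - v ^+ 2| * h r ^+ 2))).
  by rewrite ler_wpM2l.
by rewrite ler_wpM2r// mulr_ge0 ?sqr_ge0.
Qed.

Lemma measurable_grushin_time (R : realType) (h : R -> R) (z0 r : R) :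
  0 <= z0 < 1 -> continuous h -> measurable_fun setT (fun v => grushin_time h z0 v r).
Proof.
move=> z01 ch; apply: continuous_measurable_fun => v.
have cI := continuous_sqr_comp ch.
have dP v1 := is_derive_primitive (@continuous_grushin_speedV R h z0 v1 z01 ch).
pose I := primitive (fun r => h r ^+ 2).
have dk (c v1 : R) (x : R) : is_derive x 1 (fun x => grushin_time h z0 v1 x + c * I x)
    ((grushin_speed h z0 v1 x)^-1 + c * h x ^+ 2).
  have dZ : is_derive x 1 (fun x => c * I x) (c * h x ^+ 2).
    by apply: is_deriveZ; exact: is_derive_primitive.
  exact: (is_deriveD (dP v1 x) dZ).
pose c (v1 v2 : R) : R := grushin_kappa z0 ^+ 3 * `|v2 ^+ 2 - v1 ^+ 2|.
have c0 v1 v2 : 0 <= c v1 v2.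
  by rewrite mulr_ge0// exprn_ge0//; have := kappa_ge1 z01; lra.
have csym v1 v2 : c v1 v2 = c v2 v1 by rewrite /c distrC.
have pt v1 v2 x : (grushin_speed h z0 v2 x)^-1 <= (grushin_speed h z0 v1 x)^-1 + c v1 v2 * h x ^+ 2.
  by have := grushin_speedV_lipschitz h v1 v2 x z01; rewrite /c; lra.
(* For [r < 0] integration reverses inequalities, so [v1] and [v2] exchange roles and [I r] is
   negated. *)
have bound v1 v2 : grushin_time h z0 v2 r - grushin_time h z0 v1 r <= c v1 v2 * `|I r|.
  have [r0|/ltW r0] := leP 0 r.
    have := derivable_homo r0 (dP v2) (dk (c v1 v2) v1) (fun x _ => pt v1 v2 x).
    rewrite /grushin_time /I !primitive0 -/(I r) mulr0.
    have : c v1 v2 * I r <= c v1 v2 * `|I r| by rewrite ler_wpM2l// ler_norm.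
    by lra.
  have := derivable_homo r0 (dP v1) (dk (c v2 v1) v2) (fun x _ => pt v2 v1 x).
  rewrite /grushin_time /I !primitive0 -/(I r) mulr0 [c v2 v1]csym.
  have : c v1 v2 * - I r <= c v1 v2 * `|I r|.
    by rewrite ler_wpM2l// -normrN ler_norm.
  by rewrite mulrN; lra.
have cvg0 : c v v' * `|I r| @[v' --> v] --> c v v * `|I r|.
  apply: cvgM; last exact: cvg_cst.
  apply: cvgM; first exact: cvg_cst.
  apply: cvg_norm; apply: cvgB; last exact: cvg_cst.
  exact: exprn_continuous.
have cvv : c v v * `|I r| = 0 by rewrite /c subrr normr0 mulr0 mul0r.
rewrite cvv in cvg0.
apply/cvgrPdist_le => e e0.
move/cvgrPdist_le : cvg0 => /(_ _ e0); apply: filterS => v'.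
rewrite sub0r normrN => H.
rewrite ler_norml; have := bound v v'; have := bound v' v.
rewrite [c v' v]csym.
have := ler_norm (c v v' * `|I r|); lra.
Qed.

(** * Lower bounds for length by calibration *)

Lemma lipschitz_le_integral (R : realType) (H d n : R -> R) (a b L : R) : a <= b ->
  (forall s t, a <= s <= b -> a <= t <= b -> `|H s - H t| <= L * `|s - t|) ->
  measurable_fun `[a, b] d -> measurable_fun `[a, b] n ->
  {ae @lebesgue_measure R, forall t : R, t \in `[a, b] -> is_derive t 1 H (d t)} ->
  (forall t, a <= t <= b -> d t <= n t) -> (forall t, 0 <= n t) ->
  ((H b - H a)%:E <= \int[@lebesgue_measure R]_(t in `[a, b]) (n t)%:E)%E.
Proof.
rewrite le_eqVlt => /predU1P[<- _ _ _ _ _ n0|ab HL md mn dH dn n0].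
  by rewrite subrr; apply: integral_ge0 => t _; rewrite lee_fin.
have [_ <-] := lipschitz_FTC ab HL md dH.
(* The integral of [n] may be infinite; comparing it with that of the positive part of [d] covers
   this case too. *)
rewrite integralE.
apply: (@le_trans _ _ (\int[@lebesgue_measure R]_(x in `[a, b]) ((EFin \o d)^\+ x))%E).
  rewrite -[leRHS]sube0; apply: leeB => //.
  by apply: integral_ge0 => t _; exact: funeneg_ge0.
apply: ge0_le_integral => //=.
- by apply: measurable_funepos; exact/measurable_EFinP.
- exact/measurable_EFinP.
move=> t; rewrite in_itv/= => tab; rewrite funeposE /= ge_max !lee_fin n0 andbT.
exact: dn.
Qed.

(** The calibration principle: a function growing along the curve no faster than arc length bounds
    the length from below. It is used with [x] and [y] up to sign and scaling, and with the
    calibrating function of a geodesic. *)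
Lemma controlled_length_ge (R : realType) (alpha T : R) g (a b : R -> R) (L L' : R)
    (H d : R -> R) (s t : R) :
  controlled alpha T g a b L -> 0 <= s <= t -> t <= T ->
  (forall s t, 0 <= s <= T -> 0 <= t <= T -> `|H s - H t| <= L' * `|s - t|) ->
  measurable_fun `[0, T] d ->
  {ae @lebesgue_measure R, forall t : R, t \in `[0, T] -> is_derive t 1 H (d t)} ->
  (forall t, 0 <= t <= T -> d t <= control_speed a b t) ->
  ((H t - H s)%:E <= curve_length alpha T g)%E.
Proof.
move=> C /andP[s0 st] tT HL md dH dn; rewrite (controlled_length C).
have sub : `[s, t]%classic `<=` `[0, T]%classic.
  by move=> u /=; rewrite !in_itv/= => /andP[? ?]; apply/andP; split; lra.
have mn := measurable_control_speed C.
apply: (@le_trans _ _ (\int[@lebesgue_measure R]_(u in `[s, t]) (control_speed a b u)%:E)%E).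
  apply: (@lipschitz_le_integral _ H d (control_speed a b) s t L' st).
  - by move=> u w /andP[? ?] /andP[? ?]; apply: HL; apply/andP; split; lra.
  - exact: measurable_funS md.
  - exact: measurable_funS mn.
  - by apply: ae_mono dH => u Hu us; apply: Hu; exact: sub.
  - by move=> u /andP[? ?]; apply: dn; apply/andP; split; lra.
  - by move=> u; exact: sqrtr_ge0.
by apply: ge0_integral_subset_nonmeasurable => // u _; rewrite lee_fin sqrtr_ge0.
Qed.

Lemma le_sqrtD (R : realType) (a b u w : R) : u ^+ 2 + w ^+ 2 <= 1 ->
  a * u + b * w <= Num.sqrt (a ^+ 2 + b ^+ 2).
Proof.
move=> uw; apply: (le_trans (ler_norm _)); rewrite -sqrtr_sqr ler_wsqrtr//.
rewrite -subr_ge0 (_ : _ - _ = (a ^+ 2 + b ^+ 2) * (1 - (u ^+ 2 + w ^+ 2)) +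
  (a * w - b * u) ^+ 2); last by ring.
by rewrite addr_ge0 ?sqr_ge0// mulr_ge0 ?subr_ge0// addr_ge0 ?sqr_ge0.
Qed.

Lemma controlled_length_ge_x (R : realType) (alpha T : R) g (a b : R -> R) (L s t : R) :
  controlled alpha T g a b L -> 0 <= s <= t -> t <= T ->
  (`|(g t).1 - (g s).1|%:E <= curve_length alpha T g)%E.
Proof.
move=> C st tT.
have key (e : R) : `|e| = 1 -> ((e * (g t).1 - e * (g s).1)%:E <= curve_length alpha T g)%E.
  move=> e1; apply: (@controlled_length_ge _ _ _ _ _ _ _ L
    (fun t => e * (g t).1) (fun t => e * a t) _ _ C) => //.
  - by move=> u w uT wT; rewrite -mulrBr normrM e1 mul1r; exact: (controlled_lip1 C).
  - by apply: measurable_funM => //; exact: (controlled_meas1 C).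
  - apply: ae_mono (controlled_derive C) => u Hu uT; have [dx _ _] := Hu uT.
    exact: is_deriveZ.
  - move=> u _; have := @le_sqrtD R (a u) (b u) e 0.
    rewrite mulr0 addr0 mulrC; apply.
    by rewrite expr0n addr0 -real_normK ?num_real// e1 expr1n.
have [xx|/ltW xx] := leP (g s).1 (g t).1.
  by rewrite ger0_norm ?subr_ge0//; have := key 1 (normr1 _); rewrite !mul1r.
rewrite ler0_norm ?subr_le0// opprB.
by have := key (-1); rewrite normrN1 !mulN1r opprK addrC => /(_ erefl).
Qed.

Lemma controlled_length_ge_y (R : realType) (alpha T M : R) g (a b : R -> R) (L s t : R) :
  controlled alpha T g a b L -> 0 <= s <= t -> t <= T -> 0 < M -> 0 < alpha ->
  (forall t, 0 <= t <= T -> `|(g t).1| <= M) ->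
  ((`|(g t).2 - (g s).2| / M `^ alpha)%:E <= curve_length alpha T g)%E.
Proof.
move=> C st tT M0 al0 xM; have Ma : 0 < M `^ alpha by exact: powR_gt0.
have key (e : R) : `|e| = 1 ->
    ((e / M `^ alpha * (g t).2 - e / M `^ alpha * (g s).2)%:E <= curve_length alpha T g)%E.
  move=> e1; apply: (@controlled_length_ge _ _ _ _ _ _ _ (L / M `^ alpha)
     (fun t => e / M `^ alpha * (g t).2)
     (fun t => e / M `^ alpha * (b t * `|(g t).1| `^ alpha)) _ _ C) => //.
  - move=> u w uT wT; rewrite -mulrBr 2!normrM e1 mul1r gtr0_norm ?invr_gt0//.
    by rewrite mulrC mulrAC ler_wpM2r ?invr_ge0 ?(ltW Ma)//; exact: (controlled_lip2 C).
  - apply: measurable_funM => //; apply: measurable_funM; first exact: (controlled_meas2 C).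
    have T0 : 0 <= T by move/andP: st => [? ?]; lra.
    have [T00|T00] := eqVneq T 0.
      rewrite T00 set_itv1; exact: measurable_fun_set1.
    apply: (measurableT_comp (f := fun x : R => `|x| `^ alpha)).
      exact: (continuous_measurable_fun (continuous_norm_powR al0)).
    by apply: measurable_lipschitz (controlled_lip1 C); rewrite lt_neqAle eq_sym T00.
  - apply: ae_mono (controlled_derive C) => u Hu uT; have [_ dy _] := Hu uT.
    exact: is_deriveZ.
  - move=> u uT; have := @le_sqrtD R (a u) (b u) 0 (e / M `^ alpha * `|(g u).1| `^ alpha).
    rewrite mulr0 add0r mulrCA; apply.
    rewrite expr0n add0r -real_normK ?num_real// 2!normrM e1 mul1r normrV ?unitfE ?gt_eqF//.
    rewrite (gtr0_norm Ma) ger0_norm ?powR_ge0// exprn_ile1 ?mulr_ge0 ?invr_ge0 ?powR_ge0//.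
    rewrite mulrC ler_pdivrMr// mul1r ge0_ler_powR ?nnegrE ?(ltW al0) ?(ltW M0)//.
    exact: xM.
have [xx|/ltW xx] := leP (g s).2 (g t).2.
  rewrite ger0_norm ?subr_ge0//; have := key 1 (normr1 _).
  by rewrite -mulrBr mul1r mulrC.
rewrite ler0_norm ?subr_le0// opprB.
by have := key (-1); rewrite normrN1 -mulrBr mulN1r mulNr -mulrN opprB mulrC => /(_ erefl).
Qed.

Lemma grushin_ballP (R : realType) (alpha r : R) (p q : R * R) : 0 < alpha ->
  grushin_ball alpha p r q -> exists T g a b L, [/\ 0 < T, g 0 = p, g T = q,
    controlled alpha T g a b L & (curve_length alpha T g < r%:E)%E].
Proof.
move=> al0 /ereal_inf_lt[_ /= [T [g [T0 hg g0 gT ->]]] lr].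
have [a [b [L C]]] := horizontal_controlled al0 T0 hg.
by exists T, g, a, b, L.
Qed.

(** The bound on [x] holds along the whole joining curve, so the weight along the curve is at most
    the [alpha]-th power of [|p.1| + r], which bounds the vertical displacement. *)
Lemma grushin_ball_box (R : realType) (alpha r : R) (p q : R * R) : 0 < alpha ->
  grushin_ball alpha p r q ->
  `|q.1 - p.1| < r /\ `|q.2 - p.2| <= (`|p.1| + r) `^ alpha * r.
Proof.
move=> al0 /(grushin_ballP al0)[T [g [a [b [L [T0 g0 gT C lr]]]]]].
have TT : (0 : R) <= 0 <= T by rewrite lexx ltW.
have x0 : (forall t, 0 <= t <= T -> `|(g t).1 - p.1| < r).
  move=> t /andP[t0 tT]; rewrite -lte_fin; apply: le_lt_trans lr.
  by rewrite -g0; apply: (controlled_length_ge_x C); rewrite ?lexx.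
split; first by rewrite -gT; apply: x0; rewrite lexx ltW.
have r0 : 0 < r by apply: le_lt_trans (x0 0 TT); exact: normr_ge0.
have M0 : 0 < `|p.1| + r by rewrite ltr_wpDl.
have xM t : 0 <= t <= T -> `|(g t).1| <= `|p.1| + r.
  move=> /x0 h; rewrite -[(g t).1](subrK p.1) addrC (le_trans (ler_normD _ _))//.
  by rewrite lerD2l ltW.
have := @controlled_length_ge_y _ _ _ _ _ _ _ _ 0 T C _ (lexx T) M0 al0 xM.
rewrite lexx ltW// => /(_ isT).
move=> /le_lt_trans/(_ lr); rewrite lte_fin gT g0 ltr_pdivrMr ?powR_gt0// => /ltW.
by rewrite mulrC.
Qed.

Definition grushin_weight (R : realType) (alpha x0 s r : R) : R :=
  `|x0 + s * r| `^ alpha.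

Lemma grushin_weight_ge0 (R : realType) (alpha x0 s r : R) :
  0 <= grushin_weight alpha x0 s r.
Proof. exact: powR_ge0. Qed.

Lemma continuous_grushin_weight (R : realType) (alpha x0 s : R) : 0 < alpha ->
  continuous (grushin_weight alpha x0 s).
Proof. exact: continuous_norm_powR_affine. Qed.

(* A curve from abscissa [x0] whose length is at most the arrival time at [rho]
   stays in [`|x| <= M], where the truncation of [grushin_speed] is inactive. *)
Record grushin_strip (R : realType) (alpha x0 s z0 M v rho : R) : Prop :=
  GrushinStrip {
  strip_alpha : 0 < alpha;
  strip_sign : s * s = 1;
  strip_z0 : 0 <= z0 < 1;
  strip_v : (v * M `^ alpha) ^+ 2 <= z0;
  strip_rho : 0 <= rho;
  strip_M : `|x0| + grushin_time (grushin_weight alpha x0 s) z0 v rho <= M }.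

Lemma grushin_time0 (R : realType) (h : R -> R) (z0 v : R) : grushin_time h z0 v 0 = 0.
Proof. exact: primitive0. Qed.

Lemma grushin_height0 (R : realType) (h : R -> R) (z0 v : R) : grushin_height h z0 v 0 = 0.
Proof. exact: primitive0. Qed.

Lemma grushin_speed_strip (R : realType) (alpha x0 s z0 M v r : R) :
  0 <= alpha -> 0 <= M -> 0 <= z0 < 1 -> (v * M `^ alpha) ^+ 2 <= z0 -> `|x0 + s * r| <= M ->
  grushin_speed (grushin_weight alpha x0 s) z0 v r ^+ 2 +
    (v * grushin_weight alpha x0 s r) ^+ 2 = 1.
Proof.
move=> al0 M0 z01 vM xM; rewrite /grushin_speed.
have vh : (v * grushin_weight alpha x0 s r) ^+ 2 <= z0.
  apply: le_trans vM; rewrite !exprMn ler_wpM2l ?sqr_ge0//.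
  by rewrite ler_sqr ?nnegrE ?powR_ge0// ge0_ler_powR// nnegrE.
rewrite min_l// sqr_sqrtr ?subrK// subr_ge0 (le_trans vh)//.
by case/andP: z01 => _ /ltW.
Qed.

Lemma grushin_time_ge (R : realType) (h : R -> R) (z0 v r : R) : 0 <= z0 < 1 ->
  continuous h -> 0 <= r -> r <= grushin_time h z0 v r <= grushin_kappa z0 * r.
Proof.
by move=> z01 ch r0; have := grushin_time_bounds v z01 ch r0;
  rewrite grushin_time0 mul1r !subr0.
Qed.

Lemma grushin_sign_norm (R : realType) (s : R) : s * s = 1 -> `|s| = 1.
Proof.
by move=> s2; apply/eqP; rewrite -sqrp_eq1// real_normK ?num_real// expr2 s2.
Qed.

Lemma strip_norm_le (R : realType) (alpha x0 s z0 M v rho r : R) :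
  grushin_strip alpha x0 s z0 M v rho -> 0 <= r <= rho -> `|x0 + s * r| <= M.
Proof.
move=> [al0 s2 z01 vM rho0 xM] /andP[r0 rr].
have := grushin_time_ge v z01 (@continuous_grushin_weight R alpha x0 s al0) rho0.
have s1 := grushin_sign_norm s2.
have := ler_normD x0 (s * r); rewrite normrM s1 mul1r (ger0_norm r0); lra.
Qed.

(** Since [q ^ 2 + (v * h) ^ 2 = 1] in the strip, [v * (v * h ^ 2 / q) + q = 1 / q]: along the graph
    the calibrating form measures elapsed time. *)
Lemma grushin_calibration (R : realType) (alpha x0 s z0 M v rho : R) :
  grushin_strip alpha x0 s z0 M v rho ->
  v * grushin_height (grushin_weight alpha x0 s) z0 v rho +
    primitive (grushin_speed (grushin_weight alpha x0 s) z0 v) rho =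
  grushin_time (grushin_weight alpha x0 s) z0 v rho.
Proof.
move=> S; have [al0 s2 z01 vM rho0 xM] := S.
set h := grushin_weight alpha x0 s.
have ch : continuous h := @continuous_grushin_weight R alpha x0 s al0.
have M0 : 0 <= M.
  apply: (le_trans (normr_ge0 (x0 + s * rho))).
  by apply: strip_norm_le S _; rewrite rho0 lexx.
have dY := is_derive_primitive (@continuous_grushin_height_deriv R h z0 v z01 ch).
have dS := is_derive_primitive (@continuous_grushin_speed R h z0 v ch).
have dP := is_derive_primitive (@continuous_grushin_speedV R h z0 v z01 ch).
have dvY (x : R) : is_derive x 1 (fun x => v * grushin_height h z0 v x)
    (v * (v * h x ^+ 2 / grushin_speed h z0 v x)).
  by apply: is_deriveZ; exact: dY.
pose F := (fun x => v * grushin_height h z0 v x) \+ primitive (grushin_speed h z0 v).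
pose f x := v * (v * h x ^+ 2 / grushin_speed h z0 v x) + grushin_speed h z0 v x.
have dF (x : R) : is_derive x 1 F (f x) := is_deriveD (dvY x) (dS x).
have fE x : 0 <= x <= rho -> f x = (grushin_speed h z0 v x)^-1.
  move=> xr; have q0 := grushin_speed_gt0 h v x z01.
  have E := grushin_speed_strip (ltW al0) M0 z01 vM (strip_norm_le S xr).
  rewrite /f -[RHS]mul1r -E -/h; field; exact: lt0r_neq0.
have := derivable_homo rho0 dF dP; have := derivable_homo rho0 dP dF.
rewrite /F /= grushin_height0 /grushin_time !primitive0 mulr0 addr0 !subr0 => h1 h2.
by apply/eqP; rewrite eq_le h1 ?h2// => x xr; rewrite fE.
Qed.

Lemma lipschitz_derive0 (R : realType) (H : R -> R) (T L t : R) : 0 <= t <= T ->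
  (forall s t, 0 <= s <= T -> 0 <= t <= T -> `|H s - H t| <= L * `|s - t|) ->
  {ae @lebesgue_measure R, forall t : R, t \in `[0, T] -> is_derive t 1 H 0} ->
  H t = H 0.
Proof.
move=> /andP[]; rewrite le_eqVlt => /predU1P[->//|t0 tT] HL dH.
have [|||_] := @lipschitz_FTC R H (fun=> 0) 0 t L t0.
- by move=> u w /andP[? ?] /andP[? ?]; apply: HL; apply/andP; split; lra.
- exact: measurable_cst.
- apply: ae_mono dH => u Hu; rewrite in_itv/= => /andP[? ?]; apply: Hu.
  by rewrite in_itv/=; apply/andP; split; lra.
by rewrite integral0 => -[] /eqP; rewrite eq_sym subr_eq0 => /eqP.
Qed.

Lemma lipschitz_is_derive (R : realType) (F f : R -> R) (K a b : R) :
  (forall x : R, is_derive x 1 F (f x)) -> 0 <= K ->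
  (forall x, Num.min a b <= x <= Num.max a b -> `|f x| <= K) ->
  `|F a - F b| <= K * `|a - b|.
Proof.
wlog ab : a b / a <= b.
  move=> H dF K0 fK; have [|/ltW] := leP a b => ab; first exact: H.
  by rewrite distrC (distrC a); apply: H => // x; rewrite minC maxC; exact: fK.
move=> dF K0; rewrite min_l// max_r// => fK.
have dl (k x : R) : is_derive x 1 (fun z : R => k * z) k.
  by rewrite -[X in is_derive _ _ _ X]mulr1; exact: is_deriveZ.
have h1 := derivable_homo ab dF (dl K) (fun x xab => le_trans (ler_norm _) (fK x xab)).
have fK' x : a <= x <= b -> - K <= f x.
  by move=> /fK; rewrite ler_norml => /andP[].
have h2 := derivable_homo ab (dl (- K)) dF fK'.
rewrite distrC (distrC a) (ger0_norm (x := b - a)) ?subr_ge0//.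
by rewrite ler_norml; apply/andP; split; lra.
Qed.

Definition curve_abscissa (R : realType) (x0 s : R) (g : R -> R * R) (t : R) : R :=
  s * ((g t).1 - x0).

Lemma curve_abscissaE (R : realType) (x0 s : R) (g : R -> R * R) (t : R) :
  s * s = 1 -> x0 + s * curve_abscissa x0 s g t = (g t).1.
Proof. by move=> s2; rewrite /curve_abscissa mulrA s2 mul1r addrC subrK. Qed.

Lemma curve_abscissa_lipschitz (R : realType) (alpha x0 s T L : R) g (a b : R -> R) (u w : R) :
  s * s = 1 -> controlled alpha T g a b L -> 0 <= u <= T -> 0 <= w <= T ->
  `|curve_abscissa x0 s g u - curve_abscissa x0 s g w| <= L * `|u - w|.
Proof.
move=> s2 C uT wT; rewrite /curve_abscissa -mulrBr normrM (grushin_sign_norm s2) mul1r.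
by rewrite opprB addrA subrK; exact: (controlled_lip1 C).
Qed.

Lemma measurable_comp_abscissa (R : realType) (alpha x0 s T L : R) g (a b f : R -> R) :
  0 < T -> s * s = 1 -> controlled alpha T g a b L -> continuous f ->
  measurable_fun `[0, T] (fun t => f (curve_abscissa x0 s g t)).
Proof.
move=> T0 s2 C cf; apply: measurableT_comp; first exact: continuous_measurable_fun.
apply: (measurable_lipschitz T0) => u w uT wT.
exact: (@curve_abscissa_lipschitz R alpha x0 s T L g a b).
Qed.

Lemma is_derive_comp_abscissa (R : realType) (x0 s t da : R) g (F f : R -> R) :
  (forall x : R, is_derive x 1 F (f x)) ->
  is_derive t 1 (fun u => (g u).1) da ->
  is_derive t 1 (fun u => F (curve_abscissa x0 s g u))
    (f (curve_abscissa x0 s g t) * (s * da)).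
Proof.
move=> dF dg.
have dB : is_derive t 1 (fun u => (g u).1 - x0) da.
  rewrite -[da]subr0; exact: (is_deriveB dg (is_derive_cst x0 t 1)).
have dc : is_derive t 1 (curve_abscissa x0 s g) (s * da) by apply: is_deriveZ.
exact: (@is_derive1_comp _ F (curve_abscissa x0 s g) t _ _ (dF _) dc).
Qed.

Section calibrated_curve.
Context (R : realType) (alpha x0 s z0 M v rho T L : R) (g : R -> R * R) (a b : R -> R).
Hypothesis S : grushin_strip alpha x0 s z0 M v rho.
Hypothesis T0 : 0 < T.
Hypothesis C : controlled alpha T g a b L.
Hypothesis gM : forall t, 0 <= t <= T -> `|(g t).1| <= M.

Let h := grushin_weight alpha x0 s.
Let q := grushin_speed h z0 v.
Let rr := curve_abscissa x0 s g.

(* By the Cauchy-Schwarz inequality the derivative is at most the speed of [g]. *)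
Definition calibration (t : R) : R := v * (g t).2 + primitive q (rr t).
Definition calibration_deriv (t : R) : R := v * (b t * `|(g t).1| `^ alpha) + q (rr t) * (s * a t).

Let s2 : s * s = 1. Proof. by case: S. Qed.
Let z01 : 0 <= z0 < 1. Proof. by case: S. Qed.
Let ch : continuous h.
Proof. by apply: continuous_grushin_weight; case: S. Qed.

Lemma weight_abscissa t : h (rr t) = `|(g t).1| `^ alpha.
Proof. by rewrite /h /grushin_weight curve_abscissaE. Qed.

Lemma speed_abscissa t : 0 <= t <= T ->
  q (rr t) ^+ 2 + (v * `|(g t).1| `^ alpha) ^+ 2 = 1.
Proof.
move=> tT; rewrite -weight_abscissa; have [al0 _ _ vM _ _] := S.
apply: (grushin_speed_strip (ltW al0) _ z01 vM); last by rewrite curve_abscissaE// gM.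
by apply: le_trans (gM tT); exact: normr_ge0.
Qed.

Lemma calibration_lipschitz u w : 0 <= u <= T -> 0 <= w <= T ->
  `|calibration u - calibration w| <= (`|v| * L + L) * `|u - w|.
Proof.
move=> uT wT; rewrite /calibration opprD addrACA -mulrBr mulrDl.
apply: (le_trans (ler_normD _ _)); apply: lerD.
  by rewrite normrM -mulrA ler_wpM2l//; exact: (controlled_lip2 C).
apply: le_trans (curve_abscissa_lipschitz x0 s2 C uT wT).
have dS := is_derive_primitive (@continuous_grushin_speed R h z0 v ch).
rewrite -[leRHS]mul1r; apply: (lipschitz_is_derive dS) => // x _.
have /andP[_ q1] := grushin_speed_itv h v x z01.
by rewrite ger0_norm// ltW// grushin_speed_gt0.
Qed.

Lemma measurable_calibration_deriv : measurable_fun `[0, T] calibration_deriv.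
Proof.
apply: measurable_funD.
  apply: measurable_funM => //; apply: measurable_funM; first exact: (controlled_meas2 C).
  rewrite (_ : (fun _ => _) = fun t => h (rr t)); last first.
    by apply/funext => t; rewrite weight_abscissa.
  exact: (@measurable_comp_abscissa R alpha x0 s T L g a b h T0 s2 C ch).
apply: measurable_funM; last by apply: measurable_funM => //; exact: (controlled_meas1 C).
exact: (@measurable_comp_abscissa R alpha x0 s T L g a b q T0 s2 C (continuous_grushin_speed ch)).
Qed.

Lemma calibration_is_derive : {ae @lebesgue_measure R, forall t : R, t \in `[0, T] ->
  is_derive t 1 calibration (calibration_deriv t)}.
Proof.
apply: ae_mono (controlled_derive C) => t Ht tT; have [dx dy _] := Ht tT.
have dS := is_derive_primitive (@continuous_grushin_speed R h z0 v ch).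
have dvy : is_derive t 1 (fun u => v * (g u).2) (v * (b t * `|(g t).1| `^ alpha)).
  exact: is_deriveZ.
exact: (is_deriveD dvy (is_derive_comp_abscissa x0 s dS dx)).
Qed.

Lemma calibration_deriv_le t : 0 <= t <= T -> calibration_deriv t <= control_speed a b t.
Proof.
move=> tT; have E := speed_abscissa tT.
have := @le_sqrtD R (a t) (b t) (q (rr t) * s) (v * `|(g t).1| `^ alpha).
rewrite exprMn [s ^+ 2]expr2 s2 mulr1 E => /(_ (lexx _)).
by apply: le_trans; rewrite le_eqVlt; apply/orP; left; apply/eqP; rewrite /calibration_deriv; ring.
Qed.

Lemma calibration_length_ge u w : 0 <= u <= w -> w <= T ->
  ((calibration w - calibration u)%:E <= curve_length alpha T g)%E.
Proof.
move=> uw wT; apply: (controlled_length_ge C uw wT calibration_lipschitz).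
- exact: measurable_calibration_deriv.
- exact: calibration_is_derive.
- exact: calibration_deriv_le.
Qed.

End calibrated_curve.

(** * Minimality and uniqueness of the graph geodesics *)

Lemma strip_dist_ge (R : realType) (alpha x0 s z0 M v rho y0 : R) :
  grushin_strip alpha x0 s z0 M v rho ->
  ((grushin_time (grushin_weight alpha x0 s) z0 v rho)%:E <=
   grushin_dist alpha (x0, y0)
     ((x0 + s * rho)%R, (y0 + grushin_height (grushin_weight alpha x0 s) z0 v rho)%R))%E.
Proof.
move=> S; apply: le_ereal_inf_tmp => _ [T [g [T0 hg g0 gT ->]]].
have [al0 s2 z01 vM rho0 xM] := S.
have [a [b [L C]]] := horizontal_controlled al0 T0 hg.
have [gM|] := pselect (forall t, 0 <= t <= T -> `|(g t).1| <= M).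
  have TT : (0 : R) <= 0 <= T by rewrite lexx ltW.
  apply: le_trans (calibration_length_ge S T0 C gM TT (lexx T)).
  rewrite /calibration /curve_abscissa g0 gT /= lee_fin subrr mulr0 primitive0 addr0.
  rewrite (addrC x0) addrK mulrA s2 mul1r.
  have := grushin_calibration S; rewrite mulrDr; lra.
(* A curve leaving [`|x| <= M] is already too long. *)
move=> /existsNP[t /not_implyP[tT /negP]]; rewrite -ltNge => Mx.
have /andP[t0 tT'] := tT.
apply: (@le_trans _ _ (`|(g t).1 - (g 0).1|)%:E).
  rewrite lee_fin g0 /=.
  have := lerB_dist (g t).1 x0; lra.
by apply: (controlled_length_ge_x C); rewrite ?lexx.
Qed.

Lemma grushin_time_le (R : realType) (h : R -> R) (z0 v r r' : R) :
  0 <= z0 < 1 -> continuous h ->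
  (grushin_time h z0 v r <= grushin_time h z0 v r') = (r <= r').
Proof.
move=> z01 ch; apply/idP/idP => [|rr].
  apply: contraLR; rewrite -!ltNge => rr.
  by have /andP[+ _] := grushin_time_bounds v z01 ch (ltW rr); lra.
by have /andP[+ _] := grushin_time_bounds v z01 ch rr; lra.
Qed.

Lemma grushin_time_inverse (R : realType) (h : R -> R) (z0 v : R) :
  0 <= z0 < 1 -> continuous h -> exists X : R -> R,
  [/\ cancel X (grushin_time h z0 v), cancel (grushin_time h z0 v) X,
      forall u w, `|X u - X w| <= `|u - w| &
      forall u : R, is_derive u 1 X (grushin_speed h z0 v (X u))].
Proof.
move=> z01 ch.
have [X [KX XK _ XC _]] := @fiber_inverse R (fun=> grushin_time h z0 v) 1 _ ltr01
  (fun _ b b' bb => grushin_time_bounds v z01 ch bb).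
have {}KX : cancel (grushin_time h z0 v) (X 0) by exact: KX.
have {}XK : cancel (X 0) (grushin_time h z0 v) by exact: XK.
exists (X 0); split => //.
  by move=> u w; have := XC 0 (X 0 u) (X 0 w); rewrite !XK mul1r.
have dP := is_derive_primitive (@continuous_grushin_speedV R h z0 v z01 ch).
move=> u; rewrite -{1}(XK u) -[grushin_speed _ _ _ _]invrK.
have near1 : {near X 0 u, cancel (grushin_time h z0 v) (X 0)}.
  by near=> r; exact: KX.
have near2 : {near X 0 u, continuous (grushin_time h z0 v)}.
  by near=> r; exact: (is_derive_continuous dP).
apply: (is_derive_inverse near1 near2 (dP _)).
by rewrite invr_neq0// gt_eqF// grushin_speed_gt0.
Unshelve. all: by end_near. Qed.

Lemma strip_height_lipschitz (R : realType) (alpha x0 s z0 M v rho : R) :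
  grushin_strip alpha x0 s z0 M v rho ->
  forall r r', `|x0 + s * r| <= M -> `|x0 + s * r'| <= M ->
  `|grushin_height (grushin_weight alpha x0 s) z0 v r -
    grushin_height (grushin_weight alpha x0 s) z0 v r'| <=
  `|v| * (M `^ alpha) ^+ 2 * grushin_kappa z0 * `|r - r'|.
Proof.
move=> S r r' rM r'M; have [al0 s2 z01 vM rho0 xM] := S.
have M0 : 0 <= M := le_trans (normr_ge0 _) rM.
have ch := @continuous_grushin_weight R alpha x0 s al0.
have dY := is_derive_primitive (@continuous_grushin_height_deriv R _ z0 v z01 ch).
have k1 := kappa_ge1 z01.
apply: (lipschitz_is_derive dY) => [|x /andP[x1 x2]].
  by apply: mulr_ge0; [apply: mulr_ge0 => //; exact: sqr_ge0|lra].
have xM' : `|x0 + s * x| <= M.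
  have := grushin_sign_norm s2 => s1.
  have [s_eq|s_eq] : s = 1 \/ s = -1.
    by move/eqP: s1; rewrite eqr_norml ler01 andbT => /orP[] /eqP; [left|right].
  - move: rM r'M x1 x2; rewrite s_eq !mul1r !ler_norml minElt maxElt.
    by case: ltP => _ /andP[? ?] /andP[? ?] ? ?; apply/andP; split; lra.
  - move: rM r'M x1 x2; rewrite s_eq !mulN1r !ler_norml minElt maxElt.
    by case: ltP => _ /andP[? ?] /andP[? ?] ? ?; apply/andP; split; lra.
have q0 := grushin_speed_gt0 (grushin_weight alpha x0 s) v x z01.
rewrite 2!normrM normfV (gtr0_norm q0) (ger0_norm (sqr_ge0 _)).
have /andP[q1 q2] := grushin_speedV_itv (grushin_weight alpha x0 s) v x z01.
apply: ler_pM => //; first by rewrite mulr_ge0 ?sqr_ge0.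
  by rewrite invr_ge0 ltW.
rewrite ler_wpM2l// ler_sqr ?nnegrE ?powR_ge0// ge0_ler_powR ?nnegrE//.
exact: ltW.
Qed.

Lemma square_integrable_continuous (R : realType) (T : R) (f : R -> R) :
  continuous f -> square_integrable T f.
Proof.
move=> cf; split.
  by apply: measurable_funTS; exact: continuous_measurable_fun.
apply: continuous_compact_integrable; first exact: segment_compact.
by apply: continuous_subspaceT; exact: continuous_sqr_comp.
Qed.

(** The inverse [X] of the travel time parametrises the graph by time. Its controls [L * s * q] and
    [L * v * h] have norm [L = P rho], so the length equals the lower bound of [strip_dist_ge]. *)
Lemma strip_geodesic (R : realType) (alpha x0 s z0 M v rho y0 : R) :
  grushin_strip alpha x0 s z0 M v rho ->
  let h := grushin_weight alpha x0 s in
  let P := grushin_time h z0 v in let Y := grushin_height h z0 v in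
  grushin_dist alpha (x0, y0) (x0 + s * rho, y0 + Y rho) = (P rho)%:E /\
  exists g, [/\ minimising_geodesic alpha 1 g, g 0 = (x0, y0),
    g 1 = (x0 + s * rho, y0 + Y rho) &
    forall t r, P r = t * P rho -> g t = (x0 + s * r, y0 + Y r)].
Proof.
move=> S h P Y; have [al0 s2 z01 vM rho0 xM] := S.
have ch : continuous h := @continuous_grushin_weight R alpha x0 s al0.
have [X [XK KX XC dX]] := grushin_time_inverse v z01 ch.
have dY := is_derive_primitive (@continuous_grushin_height_deriv R h z0 v z01 ch).
have cX := is_derive_continuous dX.
have cq := @continuous_grushin_speed R h z0 v ch.
set L := P rho.
have rL : rho <= L by have /andP[] := grushin_time_ge v z01 ch rho0.
have L0 : 0 <= L := le_trans rho0 rL.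
pose rr t := X (t * L).
pose q := grushin_speed h z0 v.
have rr_itv t : 0 <= t <= 1 -> 0 <= rr t <= rho.
  move=> /andP[t0 t1]; rewrite -(grushin_time_le v 0 _ z01 ch) -(grushin_time_le v _ rho z01 ch).
  rewrite XK grushin_time0.
  by apply/andP; split; [exact: mulr_ge0|exact: ler_piMl].
have rrM t : 0 <= t <= 1 -> `|x0 + s * rr t| <= M.
  by move=> /rr_itv; exact: strip_norm_le S.
pose g t := (x0 + s * rr t, y0 + Y (rr t)).
have drr (t : R) : is_derive t 1 rr (q (rr t) * L).
  have dtL : is_derive t 1 (fun t => t * L) L.
    have := is_derive_affine 0 L t; congr is_derive.
    by apply/funext => u; rewrite add0r mulrC.
  exact: (@is_derive1_comp _ X (fun t => t * L) t _ _ (dX _) dtL).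
have crr : continuous rr := is_derive_continuous drr.
pose a t := L * (s * q (rr t)).
pose b t := L * (v * h (rr t)).
have dg (t : R) : is_derive t 1 g (a t, b t * `|(g t).1| `^ alpha).
  have d1 : is_derive t 1 (fun t => x0 + s * rr t) (a t).
    rewrite (_ : a t = 0 + s * (q (rr t) * L)); last by rewrite /a; ring.
    have dz : is_derive t 1 (fun t => s * rr t) (s * (q (rr t) * L)).
      by apply: is_deriveZ.
    exact: (is_deriveD (is_derive_cst x0 t 1) dz).
  have d2 : is_derive t 1 (fun t => y0 + Y (rr t)) (b t * `|(g t).1| `^ alpha).
    have dYr := @is_derive1_comp _ Y rr t _ _ (dY _) (drr t).
    rewrite (_ : b t * _ = 0 + v * h (rr t) ^+ 2 / q (rr t) * (q (rr t) * L)).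
      exact: (is_deriveD (is_derive_cst y0 t 1) dYr).
    have -> : `|(g t).1| `^ alpha = h (rr t) by [].
    have q0 := grushin_speed_gt0 h v (rr t) z01.
    by rewrite /b add0r -/q; field; rewrite lt0r_neq0.
  exact: is_derive_pair.
have b0 t : (g t).1 = 0 -> b t = 0.
  move=> g0; rewrite /b (_ : h (rr t) = `|(g t).1| `^ alpha)//.
  by rewrite g0 normr0 powR0 ?mulr0// gt_eqF.
have norm_g t : 0 <= t <= 1 -> grushin_norm alpha (g t) (derive1 g t) = L%:E.
  move=> t01; have [_ dE] := dg t; rewrite derive1E dE grushin_normE; last exact: b0.
  congr EFin.
  rewrite (_ : _ + _ = L ^+ 2 * ((s * s) * q (rr t) ^+ 2 + (v * h (rr t)) ^+ 2)); last first.
    by rewrite /a /b; ring.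
  have M0 : 0 <= M := le_trans (normr_ge0 _) (rrM _ t01).
  rewrite s2 mul1r (grushin_speed_strip (ltW al0) M0 z01 vM (rrM _ t01)).
  by rewrite mulr1 sqrtr_sqr ger0_norm.
have g0 : g 0 = (x0, y0).
  have r00 : rr 0 = 0 by rewrite /rr mul0r -{1}(grushin_time0 h z0 v) KX.
  by rewrite /g r00 mulr0 addr0 /Y grushin_height0 addr0.
have g1 : g 1 = (x0 + s * rho, y0 + Y rho).
  by rewrite /g /rr mul1r /L KX.
have hg : horizontal alpha 1 g.
  split.
    (* The product carries the maximum norm, hence the larger of the Lipschitz constants of the two
       coordinates. *)
    pose K := Num.max L (`|v| * (M `^ alpha) ^+ 2 * grushin_kappa z0 * L).
    apply: (@klipschitzW _ _ _ K).
      apply: (@globally_properfilter _ _ (0 : R, 0 : R)).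
      by split; rewrite /= in_itv/= lexx ler01.
    move=> [u w] /= []; rewrite !in_itv/= => u01 w01.
    have Xuw : `|rr u - rr w| <= L * `|u - w|.
      by rewrite /rr (le_trans (XC _ _))// -mulrBl normrM mulrC (ger0_norm L0).
    rewrite prod_normE ge_max /=; apply/andP; split.
      rewrite opprD addrACA subrr add0r -mulrBr normrM (grushin_sign_norm s2) mul1r.
      by rewrite (le_trans Xuw)// ler_wpM2r// le_max lexx.
    rewrite opprD addrACA subrr add0r.
    have := strip_height_lipschitz S (rrM _ u01) (rrM _ w01).
    move=> /le_trans; apply.
    apply: (@le_trans _ _ (`|v| * (M `^ alpha) ^+ 2 * grushin_kappa z0 * (L * `|u - w|))).
      apply: ler_wpM2l => //; apply: mulr_ge0.
        by apply: mulr_ge0 => //; exact: sqr_ge0.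
      by have := kappa_ge1 z01; lra.
    by rewrite mulrA ler_wpM2r// le_max lexx orbT.
  exists a, b; split.
  - apply: square_integrable_continuous => t; apply: cvgM; first exact: cvg_cst.
    apply: cvgM; first exact: cvg_cst.
    by apply: (@continuous_comp _ _ _ rr q); [exact: crr|exact: cq].
  - apply: square_integrable_continuous => t; apply: cvgM; first exact: cvg_cst.
    apply: cvgM; first exact: cvg_cst.
    by apply: (@continuous_comp _ _ _ rr h); [exact: crr|exact: ch].
  - by apply: aeW => t _; rewrite grushin_fieldE; exact: dg.
have len : curve_length alpha 1 g = L%:E.
  rewrite /curve_length (eq_integral (fun=> L%:E)); last first.
    by move=> t; rewrite inE/= in_itv/= => /norm_g.
  by rewrite integral_cst//= lebesgue_measure_itv/= lte01 oppr0 adde0 mule1.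
have dE : grushin_dist alpha (x0, y0) (x0 + s * rho, y0 + Y rho) = L%:E.
  apply/eqP; rewrite eq_le; apply/andP; split; last exact: (strip_dist_ge y0 S).
  by apply: ereal_inf_lbound; exists 1, g; split.
split=> //; exists g; split => //.
- split => //; first by exists L; apply: aeW => t; rewrite in_itv/= => /norm_g.
  by rewrite g0 g1 dE.
by move=> t r Pr; rewrite /g /rr -Pr KX.
Qed.

Lemma derive_along_eq (R : realType) (H : R -> R) (c d t : R) :
  0 < t < 1 -> (forall u, 0 <= u <= 1 -> H u = H 0 + c * u) ->
  is_derive t 1 H d -> d = c.
Proof.
move=> /andP[t0 t1] HE [_ <-].
have dc : is_derive t 1 (fun u => H 0 + c * u) c := is_derive_affine (H 0) c t.
have dH : is_derive t 1 H c.
  apply: near_eq_is_derive dc; near=> u; apply/esym/HE; apply/andP; split.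
    by apply: ltW; near: u; exact: lt_nbhsr.
  by apply: ltW; near: u; exact: lt_nbhsl.
by have [_ ->] := dH.
Unshelve. all: by end_near. Qed.

Lemma integral_control_speed_cst (R : realType) (f : R -> R) (c s t : R) : s <= t ->
  measurable_fun `[s, t] f -> (forall u, 0 <= f u) -> 0 <= c ->
  {ae @lebesgue_measure R, forall u : R, u \in `[s, t] -> f u = c} ->
  (\int[@lebesgue_measure R]_(u in `[s, t]) (f u)%:E = (c * (t - s))%:E)%E.
Proof.
move=> st mf f0 c0 fc.
rewrite (@ge0_ae_eq_integral_nonmeasurable _ _ R (@lebesgue_measure R) _ _ (fun=> c%:E))//.
- rewrite integral_cst//= lebesgue_measure_itv/= lte_fin.
  move: st; rewrite le_eqVlt => /predU1P[->|->]; last by rewrite -EFinB -EFinM.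
  by rewrite ltxx mule0 subrr mulr0.
- by move=> u _; rewrite lee_fin.
- by apply: ae_mono fc => u /[apply] ->.
Qed.

(** The calibrating function [H] grows at rate at most the speed [c], and by [c] in total, so it is
    affine. Equality then holds almost everywhere in Cauchy-Schwarz and determines both controls.
    Hence [P (rr t) - c * t] and [(g t).2 - Y (rr t)] have zero derivative almost everywhere; being
    Lipschitz, they are constant. *)
Lemma strip_geodesic_unique (R : realType) (alpha x0 s z0 M v rho y0 : R) g :
  grushin_strip alpha x0 s z0 M v rho ->
  let h := grushin_weight alpha x0 s in
  let P := grushin_time h z0 v in let Y := grushin_height h z0 v in
  minimising_geodesic alpha 1 g -> g 0 = (x0, y0) ->
  g 1 = (x0 + s * rho, y0 + Y rho) ->
  forall t, 0 <= t <= 1 -> exists r, P r = t * P rho /\ g t = (x0 + s * r, y0 + Y r).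
Proof.
move=> S h P Y [hg [c cg] len] g0 g1.
have [al0 s2 z01 vM rho0 xM] := S.
have ch : continuous h := @continuous_grushin_weight R alpha x0 s al0.
have [dE _] := strip_geodesic y0 S.
rewrite g0 g1 dE -/(P rho) in len.
have [a [b [L C]]] := horizontal_controlled al0 ltr01 hg.
have xP t : 0 <= t <= 1 -> `|(g t).1 - x0| <= P rho.
  move=> /andP[t0 t1]; rewrite -lee_fin -len.
  have := @controlled_length_ge_x _ _ _ _ _ _ _ 0 t C.
  by rewrite lexx t0 g0; apply.
have gM t : 0 <= t <= 1 -> `|(g t).1| <= M.
  move=> /xP tP; rewrite -[(g t).1](subrK x0) addrC (le_trans (ler_normD _ _))//.
  by apply: le_trans xM; rewrite lerD2l.
have mn := measurable_control_speed C.
have n0 t : 0 <= control_speed a b t by exact: sqrtr_ge0.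
have nc : {ae @lebesgue_measure R, forall t : R, t \in `[0, 1] -> control_speed a b t = c}.
  apply: ae_mono2 cg (controlled_derive C) => t + + t01 => /(_ t01) ct /(_ t01)[_ _].
  by rewrite ct => -[].
have P0 : 0 <= P rho.
  by have /andP[+ _] := grushin_time_ge v z01 ch rho0; apply: le_trans.
have cP : c = P rho.
  have cabs : {ae @lebesgue_measure R, forall t : R, t \in `[0, 1] -> control_speed a b t = `|c|}.
    by apply: ae_mono nc => t /[apply] nt; rewrite -nt ger0_norm.
  have E : P rho = `|c|.
    have := controlled_length C; rewrite len (integral_control_speed_cst ler01 mn n0 _ cabs)//.
    by rewrite subr0 mulr1 => -[].
  have [c0|c0] := leP 0 c; first by rewrite E ger0_norm.
  (* The constant in [constant_speed] has no prescribed sign. A negative one would make [[0, 1]] a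
     null set, which is refuted by integrating the constant [1]. *)
  have : {ae @lebesgue_measure R, forall t : R, t \in `[0, 1] -> (1 : R) = 0}.
    apply: ae_mono nc => t /[apply] nt; exfalso.
    by have := n0 t; rewrite nt leNgt c0.
  move=> /integral_control_speed_cst => /(_ ler01 (measurable_cst _) (fun _ => ler01) (lexx _)).
  rewrite mul0r integral_cst//= lebesgue_measure_itv/= lte01 oppr0 adde0 mule1 => -[] /eqP.
  by rewrite oner_eq0.
have c0 : 0 <= c by rewrite cP.
pose H := calibration alpha x0 s z0 v g.
pose rr := curve_abscissa x0 s g.
pose q := grushin_speed h z0 v.
have Hle u w : 0 <= u -> u <= w -> w <= 1 -> H w - H u <= c * (w - u).
  move=> u0 uw w1; rewrite -lee_fin.
  have sub : `[u, w]%classic `<=` `[0, 1]%classic.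
    by move=> t /=; rewrite !in_itv/= => /andP[? ?]; apply/andP; split; lra.
  have mnuw : measurable_fun `[u, w] (control_speed a b) by exact: measurable_funS mn.
  have ncuw : {ae @lebesgue_measure R, forall t : R, t \in `[u, w] -> control_speed a b t = c}.
    by apply: ae_mono nc => t nt tuw; apply: nt; exact: sub.
  rewrite -(integral_control_speed_cst uw mnuw n0 c0 ncuw).
  apply: (@lipschitz_le_integral _ H (calibration_deriv alpha x0 s z0 v g a b)
    _ _ _ (`|v| * L + L) uw) => //.
  - move=> t t' /andP[? ?] /andP[? ?].
    by apply: (calibration_lipschitz S C); apply/andP; split; lra.
  - by apply: measurable_funS (measurable_calibration_deriv S ltr01 C).
  - by apply: ae_mono (calibration_is_derive S C) => t Ht tuw; apply: Ht; exact: sub.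
  - by move=> t /andP[? ?]; apply: (calibration_deriv_le a b S gM); apply/andP; split; lra.
have rr0 : rr 0 = 0 by rewrite /rr /curve_abscissa g0 subrr mulr0.
have rr1 : rr 1 = rho by rewrite /rr /curve_abscissa g1 /= (addrC x0) addrK mulrA s2 mul1r.
have H10 : H 1 - H 0 = c.
  rewrite /H /calibration -/rr rr0 rr1 g0 g1 /= primitive0 addr0 cP /P -(grushin_calibration S).
  by rewrite -/h /Y; ring.
have HE u : 0 <= u <= 1 -> H u = H 0 + c * u.
  by move=> /andP[u0 u1]; have := Hle 0 u (lexx _) u0 u1; have := Hle u 1 u0 u1 (lexx _); lra.
have ab : {ae @lebesgue_measure R, forall t : R, t \in `[0, 1] ->
    [/\ is_derive t 1 (fun u => (g u).1) (c * s * q (rr t)) &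
        is_derive t 1 (fun u => (g u).2) (c * v * h (rr t) ^+ 2)]}.
  have ends : {ae @lebesgue_measure R, forall t : R, t != 0 /\ t != 1}.
    by apply: ae_mono2 (ae_neq 0) (ae_neq 1) => t ? ?.
  have inner : {ae @lebesgue_measure R, forall t : R, t \in `[0, 1] ->
      calibration_deriv alpha x0 s z0 v g a b t = c /\ control_speed a b t = c}.
    have hd : {ae @lebesgue_measure R, forall t : R, t \in `[0, 1] ->
        calibration_deriv alpha x0 s z0 v g a b t = c}.
      apply: ae_mono2 ends (calibration_is_derive S C) => t [tn0 tn1] Ht t01.
      apply: derive_along_eq HE (Ht t01).
      by move: t01; rewrite in_itv/= => /andP[? ?]; rewrite !lt_neqAle tn1 eq_sym tn0; apply/andP.
    by apply: ae_mono2 hd nc => t dt nt t01; split; [exact: dt|exact: nt].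
  apply: ae_mono2 inner (controlled_derive C) => t + + t01 => /(_ t01)[dt nt] /(_ t01)[dx dy _].
  have t01' : 0 <= t <= 1 by move: t01; rewrite in_itv.
  have E := speed_abscissa S gM t01'.
  have hE := weight_abscissa g S t.
  rewrite -hE -/h -/rr -/q in E dt dy.
  have n2 : a t ^+ 2 + b t ^+ 2 = c ^+ 2.
    by rewrite -nt sqr_sqrtr// addr_ge0 ?sqr_ge0.
  rewrite /calibration_deriv -hE -/h -/rr -/q in dt.
  (* The equality case of Cauchy-Schwarz: [(s * q, v * h)] is a unit vector, and the squared
     distance from the controls to [c] times it expands to [c ^ 2 + c ^ 2 - 2 * c * c]. *)
  have Z : (a t - c * s * q (rr t)) ^+ 2 + (b t - c * v * h (rr t)) ^+ 2 = 0.
    transitivity ((a t ^+ 2 + b t ^+ 2) + c ^+ 2 * ((s * s) * q (rr t) ^+ 2 + (v * h (rr t)) ^+ 2)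
      - 2 * c * (v * (b t * h (rr t)) + q (rr t) * (s * a t))); first by ring.
    by rewrite s2 mul1r E n2 dt; ring.
  have /eqP := Z; rewrite paddr_eq0 ?sqr_ge0// !sqrf_eq0 !subr_eq0 => /andP[/eqP aE /eqP bE].
  split; first by rewrite -aE.
  by rewrite (_ : c * v * _ = b t * h (rr t))// bE; ring.
have dP := is_derive_primitive (@continuous_grushin_speedV R h z0 v z01 ch).
have dY := is_derive_primitive (@continuous_grushin_height_deriv R h z0 v z01 ch).
have k1 := kappa_ge1 z01.
have Ptime t : 0 <= t <= 1 -> P (rr t) = c * t.
  move=> t01; suff : P (rr t) - c * t = P (rr 0) - c * 0.
    by rewrite rr0 /P grushin_time0; lra.
  apply: (@lipschitz_derive0 R (fun t => P (rr t) - c * t) 1 (grushin_kappa z0 * L + c) t t01).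
    move=> u w u01 w01.
    rewrite (_ : _ - _ = (P (rr u) - P (rr w)) - c * (u - w)); last by ring.
    rewrite mulrDl (le_trans (ler_normB _ _))// lerD//; last by rewrite normrM ger0_norm.
    apply: (@le_trans _ _ (grushin_kappa z0 * `|rr u - rr w|)).
      apply: (lipschitz_is_derive dP) => [|x _]; first lra.
      by have /andP[q1 q2] := grushin_speedV_itv h v x z01; rewrite ger0_norm; lra.
    by rewrite -mulrA ler_wpM2l; [|lra|exact: (curve_abscissa_lipschitz x0 s2 C)].
  apply: ae_mono ab => u Hu u01; have [dx _] := Hu u01.
  have d1 := is_derive_comp_abscissa x0 s dP dx.
  have d2 := is_derive_affine 0 c u.
  have := is_deriveB d1 d2.
  have q0 := grushin_speed_gt0 h v (rr u) z01.
  rewrite -/rr -/q (_ : _ - c = 0); last first.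
    transitivity (c * (s * s) - c); last by rewrite s2 mulr1 subrr.
    by field; rewrite lt0r_neq0.
  by congr is_derive; apply/funext => w /=; rewrite !fctE add0r.
have Ytime t : 0 <= t <= 1 -> (g t).2 = y0 + Y (rr t).
  move=> t01; suff : (g t).2 - Y (rr t) = (g 0).2 - Y (rr 0).
    by rewrite rr0 /Y grushin_height0 g0 /=; lra.
  pose B := `|v| * (M `^ alpha) ^+ 2 * grushin_kappa z0.
  have B0 : 0 <= B by apply: mulr_ge0; [apply: mulr_ge0 => //; exact: sqr_ge0|lra].
  apply: (@lipschitz_derive0 R (fun t => (g t).2 - Y (rr t)) 1 (L + B * L) t t01).
    move=> u w u01 w01.
    rewrite (_ : _ - _ = ((g u).2 - (g w).2) - (Y (rr u) - Y (rr w))); last by ring.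
    rewrite mulrDl (le_trans (ler_normB _ _))// lerD//; first exact: (controlled_lip2 C).
    apply: (@le_trans _ _ (B * `|rr u - rr w|)).
      by apply: (strip_height_lipschitz S); rewrite curve_abscissaE// gM.
    apply: (le_trans (ler_wpM2l B0 (curve_abscissa_lipschitz x0 s2 C u01 w01))).
    by rewrite mulrA.
  apply: ae_mono ab => u Hu u01; have [dx dy] := Hu u01.
  have d1 := is_derive_comp_abscissa x0 s dY dx.
  have q0 := grushin_speed_gt0 h v (rr u) z01.
  have E : c * v * h (rr u) ^+ 2 - v * h (rr u) ^+ 2 / q (rr u) * (s * (c * s * q (rr u))) = 0.
    transitivity (c * v * h (rr u) ^+ 2 * (1 - s * s)); last by rewrite s2 subrr mulr0.
    by field; rewrite lt0r_neq0.
  by have := is_deriveB dy d1; rewrite E.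
move=> t t01; exists (rr t); split; first by rewrite Ptime// cP mulrC.
by rewrite [g t]surjective_pairing -Ytime// curve_abscissaE.
Qed.

(** * Points reached with bounded momentum, and the area of balls *)

Lemma grushin_heightN (R : realType) (h : R -> R) (z0 v r : R) :
  0 <= z0 < 1 -> continuous h ->
  grushin_height h z0 (- v) r = - grushin_height h z0 v r.
Proof.
move=> z01 ch.
have e := primitiveZ (-1) r (@continuous_grushin_height_deriv R h z0 v z01 ch).
rewrite mulN1r in e; rewrite -[RHS]e; congr (primitive _ r); apply/funext => x.
by rewrite /grushin_speed !mulNr sqrrN mul1r.
Qed.

Lemma grushin_height_v0 (R : realType) (h : R -> R) (z0 r : R) :
  0 <= z0 < 1 -> continuous h -> grushin_height h z0 0 r = 0.
Proof. by move=> z01 ch; have := grushin_heightN 0 r z01 ch; rewrite oppr0; lra. Qed.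

(** At fixed [r] the height is increasing in [v] with slope bounded away from zero, hence onto; as
    it is also odd in [v], the momentum found is at most [v0] in absolute value. *)
Lemma grushin_height_surj (R : realType) (h : R -> R) (z0 v0 r y : R) :
  0 <= z0 < 1 -> continuous h -> (forall r, 0 <= h r) -> 0 <= r ->
  0 < primitive (fun r => h r ^+ 2) r -> `|y| <= grushin_height h z0 v0 r ->
  exists v, `|v| <= v0 /\ grushin_height h z0 v r = y.
Proof.
move=> z01 ch h0 r0 I0 yv.
have bnd v v' := @grushin_height_bounds R h z0 v v' r z01 ch h0 r0.
have [v vE] := expanding_surjective I0 bnd y.
exists v; split => //; rewrite ler_norml; move: yv; rewrite ler_norml => /andP[y1 y2].
have mono v1 v2 : grushin_height h z0 v1 r <= grushin_height h z0 v2 r -> v1 <= v2.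
  apply: contraLR; rewrite -!ltNge => v21.
  have /andP[+ _] := bnd _ _ (ltW v21).
  have : 0 < primitive (fun r => h r ^+ 2) r * (v1 - v2) by rewrite mulr_gt0 ?subr_gt0.
  by lra.
by apply/andP; split; apply: mono; rewrite ?grushin_heightN// vE.
Qed.

Lemma grushin_height_ge (R : realType) (h : R -> R) (z0 v r : R) :
  0 <= z0 < 1 -> continuous h -> (forall r, 0 <= h r) -> 0 <= r -> 0 <= v ->
  v * primitive (fun r => h r ^+ 2) r <= grushin_height h z0 v r.
Proof.
move=> z01 ch h0 r0 v0; have := grushin_height_bounds z01 ch h0 r0 v0.
by rewrite grushin_height_v0// !subr0 mulrC => /andP[].
Qed.

Lemma primitive_ge (R : realType) (f : R -> R) (a b c r : R) :
  continuous f -> (forall x : R, 0 <= x <= r -> 0 <= f x) -> 0 <= a -> a <= b -> b <= r ->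
  (forall x : R, a <= x <= b -> c <= f x) -> c * (b - a) <= primitive f r.
Proof.
move=> cf f0 a0 ab br fc.
have cc c0 : continuous (fun _ : R => c0 : R) by exact: cst_continuous.
have h1 : primitive (fun=> 0) a - primitive (fun=> 0) 0 <= primitive f a - primitive f 0.
  by apply: primitive_homo => // x /andP[? ?]; apply: f0; apply/andP; split; lra.
have h2 : primitive (fun=> c) b - primitive (fun=> c) a <= primitive f b - primitive f a.
  by apply: primitive_homo.
have h3 : primitive (fun=> 0) r - primitive (fun=> 0) b <= primitive f r - primitive f b.
  by apply: primitive_homo => // x /andP[? ?]; apply: f0; apply/andP; split; lra.
by move: h1 h2 h3; rewrite !primitive_cst primitive0; lra.
Qed.

Lemma sqr_weight (R : realType) (alpha x0 s : R) :
  (fun r => grushin_weight alpha x0 s r ^+ 2) = (fun r => `|x0 + s * r| `^ (2 * alpha)).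
Proof.
by apply/funext => r; rewrite /grushin_weight (mulrC 2) powRrM -powR_mulrn ?powR_ge0.
Qed.

(** The weight vanishes only at [- (s * x0)]; either the first or the last quarter of [[0, r]] stays
    at distance at least [r / 4] from this point. *)
Lemma primitive_weight_gt0 (R : realType) (alpha x0 s r : R) : 0 < alpha -> s * s = 1 ->
  0 < r -> 0 < primitive (fun r => grushin_weight alpha x0 s r ^+ 2) r.
Proof.
move=> al0 s2 r0.
have cI : continuous (fun r => grushin_weight alpha x0 s r ^+ 2).
  exact/continuous_sqr_comp/continuous_grushin_weight.
have f0 x : 0 <= x <= r -> 0 <= grushin_weight alpha x0 s x ^+ 2 by rewrite sqr_ge0.
have s1 := grushin_sign_norm s2.
pose c := ((r / 4) `^ alpha) ^+ 2.
have c0 : 0 < c * (r / 4) by rewrite mulr_gt0 ?exprn_gt0 ?powR_gt0//; lra.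
have wc x : r / 4 <= `|x0 + s * x| -> c <= grushin_weight alpha x0 s x ^+ 2.
  move=> rx; rewrite ler_sqr ?nnegrE ?powR_ge0// ge0_ler_powR ?nnegrE//; lra.
have dist x : `|x0 + s * x| = `|x + s * x0|.
  by rewrite -[LHS]mul1r -s1 -normrM mulrDr mulrA s2 mul1r addrC.
have [m|m] := leP (- (s * x0)) (r / 2).
  apply: (lt_le_trans c0); rewrite (_ : r / 4 = r - (r - r / 4)); last by ring.
  apply: primitive_ge => //; try lra.
  move=> x /andP[? ?]; apply: wc; rewrite dist; have := ler_norm (x + s * x0); lra.
apply: (lt_le_trans c0); rewrite -[X in _ * X](subr0 (r / 4)).
apply: primitive_ge => //; try lra.
move=> x /andP[? ?]; apply: wc; rewrite dist -normrN.
have := ler_norm (- (x + s * x0)); lra.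
Qed.

Lemma area_box (R : realType) (a b c d : R) : a <= b -> c <= d ->
  area (`[a, b] `*` `[c, d]) = ((b - a) * (d - c))%:E.
Proof.
have itv (x y : R) : x <= y -> lebesgue_measure `[x, y] = (y - x)%:E.
  rewrite lebesgue_measure_itv/= lte_fin le_eqVlt => /predU1P[->|->//].
  by rewrite ltxx subrr.
by move=> ab cd; rewrite area_setX// !itv// -EFinM.
Qed.

Lemma grushin_ball_area_fin (R : realType) (alpha r : R) (p : R * R) : 0 < alpha ->
  (area (grushin_ball alpha p r) < +oo)%E.
Proof.
move=> al0; pose B := `|(`|p.1| + r) `^ alpha * r| + `|r|.
have B0 : 0 <= B by rewrite addr_ge0.
apply: (@le_lt_trans _ _ (area (`[p.1 - B, p.1 + B] `*` `[p.2 - B, p.2 + B]))).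
  apply: le_area => q /(grushin_ball_box al0)[qx qy].
  have h1 := ler_norm r.
  have h2 := ler_norm ((`|p.1| + r) `^ alpha * r).
  have h3 := normr_ge0 ((`|p.1| + r) `^ alpha * r).
  have h4 := normr_ge0 r.
  have hx : `|q.1 - p.1| <= B by rewrite /B; lra.
  have hy : `|q.2 - p.2| <= B by rewrite /B; lra.
  move: hx hy; rewrite !ler_norml => /andP[? ?] /andP[? ?].
  by split; rewrite /= in_itv/=; apply/andP; split; lra.
by rewrite area_box ?ltry//; lra.
Qed.

Lemma grushin_strip_exists (R : realType) (alpha x0 s z0 M v rho : R) :
  0 < alpha -> s * s = 1 -> 0 <= z0 < 1 -> 0 < M -> `|v| <= Num.sqrt z0 / M `^ alpha ->
  0 <= rho -> `|x0| + grushin_kappa z0 * rho <= M ->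
  grushin_strip alpha x0 s z0 M v rho.
Proof.
move=> al0 s2 z01 M0 vM rho0 xM; split => //.
  have Ma : 0 < M `^ alpha by exact: powR_gt0.
  rewrite ler_pdivlMr// in vM.
  have z00 : 0 <= z0 by case/andP: z01.
  rewrite -[leRHS](sqr_sqrtr z00) -real_normK ?num_real// normrM (gtr0_norm Ma).
  by rewrite ler_sqr ?nnegrE ?sqrtr_ge0// mulr_ge0// ltW.
have ch := @continuous_grushin_weight R alpha x0 s al0.
by have /andP[_ ?] := grushin_time_ge v z01 ch rho0; lra.
Qed.

Lemma primitive_sqr_homo (R : realType) (h : R -> R) (r r' : R) :
  continuous h -> r <= r' ->
  primitive (fun r => h r ^+ 2) r <= primitive (fun r => h r ^+ 2) r'.
Proof.
move=> ch rr.
have c0 : continuous (fun _ : R => 0 : R) by exact: cst_continuous.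
have := primitive_homo rr c0 (continuous_sqr_comp ch) (fun x _ => sqr_ge0 (h x)).
by rewrite !primitive_cst !mul0r subrr subr_ge0.
Qed.

Lemma grushin_strip_reach (R : realType) (alpha x0 s z0 M rho y : R) :
  0 < alpha -> s * s = 1 -> 0 <= z0 < 1 -> 0 < M ->
  0 < rho -> `|x0| + grushin_kappa z0 * rho <= M ->
  let h := grushin_weight alpha x0 s in
  `|y| <= Num.sqrt z0 / M `^ alpha * primitive (fun r => h r ^+ 2) rho ->
  exists v, [/\ `|v| <= Num.sqrt z0 / M `^ alpha, grushin_strip alpha x0 s z0 M v rho &
    grushin_height h z0 v rho = y].
Proof.
move=> al0 s2 z01 M0 rho0 xM h yv.
have ch := @continuous_grushin_weight R alpha x0 s al0.
have h0 := @grushin_weight_ge0 R alpha x0 s.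
have v00 : 0 <= Num.sqrt z0 / M `^ alpha by rewrite divr_ge0 ?sqrtr_ge0 ?powR_ge0.
have [v [vv vE]] := grushin_height_surj z01 ch h0 (ltW rho0)
  (primitive_weight_gt0 x0 al0 s2 rho0)
  (le_trans yv (grushin_height_ge z01 ch h0 (ltW rho0) v00)).
exists v; split => //; apply: grushin_strip_exists => //; exact: ltW.
Qed.

Lemma grushin_kappa34 (R : realType) : grushin_kappa (3 / 4 : R) = 2.
Proof.
rewrite /grushin_kappa (_ : 1 - 3 / 4 = (1 / 2) ^+ 2); last by field.
by rewrite sqrtr_sqr ger0_norm; [field|lra].
Qed.

(** The bound is the area of a box inside the ball. Taking [z0 = 3 / 4] makes [kappa = 2], so
    distances up to [3 * r / 8] along the line are covered in time at most [3 * r / 4]; as [I] is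
    monotone, heights up to [v0 * I (r / 4)] are reached over the whole box. *)
Lemma grushin_ball_area_ge (R : realType) (alpha r s : R) (p : R * R) :
  0 < alpha -> s * s = 1 -> 0 < r ->
  ((r / 8 * (2 * (Num.sqrt (3 / 4) / (`|p.1| + r) `^ alpha *
     primitive (fun u => grushin_weight alpha p.1 s u ^+ 2) (r / 4))))%:E
   <= area (grushin_ball alpha p r))%E.
Proof.
move=> al0 s2 r0; set h := grushin_weight alpha p.1 s; set I := primitive _.
have z01 : 0 <= (3 / 4 : R) < 1 by apply/andP; split; lra.
have M0 : 0 < `|p.1| + r by rewrite ltr_wpDl.
set v0 := Num.sqrt (3 / 4) / (`|p.1| + r) `^ alpha.
have v00 : 0 <= v0 by rewrite divr_ge0 ?sqrtr_ge0 ?powR_ge0.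
have r40 : 0 < r / 4 by lra.
have I0 : 0 < I (r / 4) by exact: primitive_weight_gt0.
have vI : 0 <= v0 * I (r / 4) by rewrite mulr_ge0// ltW.
set B := `[r / 4, 3 * r / 8] `*` `[p.2 - v0 * I (r / 4), p.2 + v0 * I (r / 4)].
have -> : ((r / 8 * (2 * (v0 * I (r / 4))))%:E = area B).
  by rewrite area_box; [congr EFin; field|lra|lra].
rewrite -(area_reflect1 p.1 _ (grushin_sign_norm s2)).
apply: le_area => q [[rho y] [+ +] <-].
rewrite /= !in_itv/= => /andP[r1 r2] /andP[y1 y2].
have rho0 : 0 < rho by lra.
have kM : `|p.1| + grushin_kappa (3 / 4) * rho <= `|p.1| + r.
  by rewrite grushin_kappa34; lra.
have ch := @continuous_grushin_weight R alpha p.1 s al0.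
have II : I (r / 4) <= I rho by exact: primitive_sqr_homo.
have yv : `|y - p.2| <= v0 * I rho.
  by have := ler_wpM2l v00 II; rewrite ler_norml => ?; apply/andP; split; lra.
have [v [vv S vE]] := grushin_strip_reach al0 s2 z01 M0 rho0 kM yv.
have [+ _] := strip_geodesic p.2 S.
rewrite vE addrCA subrr addr0 -surjective_pairing /grushin_ball/= => ->.
rewrite lte_fin.
have /andP[_] := grushin_time_ge v z01 ch (ltW rho0); rewrite grushin_kappa34; lra.
Qed.

(** * Distortion along a horizontal line *)

Lemma continuous_grushin_height (R : realType) (h : R -> R) (z0 v : R) :
  0 <= z0 < 1 -> continuous h -> continuous (grushin_height h z0 v).
Proof.
move=> z01 ch; apply: is_derive_continuous.
by apply: is_derive_primitive; exact: continuous_grushin_height_deriv.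
Qed.

Lemma area_grushin_chart (R : realType) (h : R -> R) (z0 x0 y0 s lo hi : R) :
  0 <= z0 < 1 -> continuous h -> (forall r, 0 <= h r) ->
  s * s = 1 -> 0 <= lo -> lo <= hi -> 0 < primitive (fun r => h r ^+ 2) lo ->
  forall D, (forall p, D p -> lo <= p.1 <= hi) ->
  ((primitive (fun r => h r ^+ 2) lo)%:E * area D <=
    area [set (x0 + s * p.1, y0 + grushin_height h z0 p.2 p.1)%R | p in D] <=
    (grushin_kappa z0 ^+ 3 * primitive (fun r => h r ^+ 2) hi)%:E * area D)%E.
Proof.
move=> z01 ch h0 s2 lo0 lohi I0 D DI.
(* Clamping [rho] makes the slope bounds hold on every fibre, as [area_fiber2] requires; on [D] it
   changes nothing. *)
pose G rho v := y0 + grushin_height h z0 v (clamp lo hi rho).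
have k0 : 0 < grushin_kappa z0 ^+ 3.
  by rewrite exprn_gt0//; apply: lt_le_trans (kappa_ge1 z01).
have GB a b b' : b <= b' -> primitive (fun r => h r ^+ 2) lo * (b' - b) <=
    G a b' - G a b <= grushin_kappa z0 ^+ 3 * primitive (fun r => h r ^+ 2) hi * (b' - b).
  move=> bb; rewrite /G opprD addrACA subrr add0r.
  have /andP[c1 c2] := clamp_itv a lohi.
  have c0 : 0 <= clamp lo hi a by exact: le_trans c1.
  have /andP[b1 b2] := grushin_height_bounds z01 ch h0 c0 bb.
  have bb0 : 0 <= b' - b by rewrite subr_ge0.
  apply/andP; split.
    by apply: le_trans b1; rewrite ler_wpM2r// primitive_sqr_homo.
  by apply: (le_trans b2); rewrite ler_wpM2r// ler_wpM2l ?(ltW k0)// primitive_sqr_homo.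
have mG b : measurable_fun setT (G^~ b).
  apply: continuous_measurable_fun => x; apply: cvgD; first exact: cvg_cst.
  apply: (@continuous_comp _ _ _ (clamp lo hi) (grushin_height h z0 b)).
    by apply: (@lipschitz_continuous _ _ 1) => y z; rewrite mul1r clamp_contraction.
  exact: continuous_grushin_height.
rewrite -[area [set _ | _ in _]](_ : area [set (p.1, G p.1 p.2) | p in D] = _).
  exact: area_fiber2.
rewrite -(area_reflect1 x0 _ (grushin_sign_norm s2)); congr area.
apply/seteqP; split=> [_ [_ [[r v] Drv <-] <-]|_ [[r v] Drv <-]] /=.
  by exists (r, v) => //=; rewrite /G clamp_id//; exact: (DI _ Drv).
exists (r, G r v); last by rewrite /G clamp_id//; exact: (DI _ Drv).
by exists (r, v).
Qed.

Lemma area_grushin_time (R : realType) (h : R -> R) (z0 : R) (D : set (R * R)) :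
  0 <= z0 < 1 -> continuous h ->
  (area D <= area [set (grushin_time h z0 p.2 p.1, p.2) | p in D] <=
    (grushin_kappa z0)%:E * area D)%E.
Proof.
move=> z01 ch; rewrite -[X in (X <= _)%E]mul1e.
apply: (@area_fiber1 _ (fun v r => grushin_time h z0 v r)) => //.
  by move=> v r r' rr; exact: grushin_time_bounds.
by move=> r; exact: measurable_grushin_time.
Qed.

Lemma area_scale1 (R : realType) (t : R) (D : set (R * R)) : 0 < t ->
  area [set (t * p.1, p.2) | p in D] = (t%:E * area D)%E.
Proof.
move=> t0; have := @area_fiber1 R (fun _ b => t * b) t t t0 _ _ D.
move=> H; apply/eqP; rewrite eq_le andbC; apply: H => [_ b b' _|b].
  by rewrite mulrBr lexx.
exact: measurable_cst.
Qed.

(* In the coordinates [(P_v rho, v)], the points of [Z] are the images of those of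
   [A] under multiplication of the first coordinate by [t]. *)
Lemma area_intermediate_points (R : realType) (alpha x0 y0 s z0 M lo hi t : R) A :
  0 < alpha -> s * s = 1 -> 0 <= z0 < 1 -> 0 < M -> 0 < lo -> lo <= hi ->
  `|x0| + grushin_kappa z0 * hi <= M -> 0 < t <= 1 ->
  let I := primitive (fun r => grushin_weight alpha x0 s r ^+ 2) in
  let k := grushin_kappa z0 in
  A `<=` [set (x0 + s * u.1, y0 + u.2) | u in
     [set u | lo <= u.1 <= hi /\ `|u.2| <= Num.sqrt z0 / M `^ alpha * I lo]] ->
  let Z := intermediate_points alpha t (x0, y0) A in
  ((t * I (t * lo / k))%:E * area A <= (k ^+ 4 * I hi)%:E * area Z)%E /\
  ((I lo)%:E * area Z <= (t * (k ^+ 4 * I (t * k * hi)))%:E * area A)%E.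
Proof.
move=> al0 s2 z01 M0 lo0 lohi xM /andP[t0 t1] I k AB Z.
pose h := grushin_weight alpha x0 s.
have ch : continuous h by exact: continuous_grushin_weight.
have h0 : forall r, 0 <= h r by move=> r; exact: grushin_weight_ge0.
have k1 : 1 <= k by exact: kappa_ge1.
have k0 : 0 < k by exact: lt_le_trans k1.
set P := grushin_time h z0; set Y := grushin_height h z0.
set v0 := Num.sqrt z0 / M `^ alpha in AB.
have strip v rho : lo <= rho <= hi -> `|v| <= v0 -> grushin_strip alpha x0 s z0 M v rho.
  move=> /andP[r1 r2] vv; apply: grushin_strip_exists => //; first by lra.
  by apply: le_trans xM; rewrite lerD2l ler_pM2l.
pose D := [set p : R * R | [/\ `|p.2| <= v0, lo <= p.1 <= hi &
   A (x0 + s * p.1, y0 + Y p.2 p.1)]].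
pose D' := [set p : R * R | exists2 rho, D (rho, p.2) & P p.2 p.1 = t * P p.2 rho].
have AE : A = [set (x0 + s * p.1, y0 + Y p.2 p.1) | p in D].
  apply/seteqP; split=> [q Aq|_ [[r v] [_ _ ?] <-]//].
  have [[rho y] /= [rI yI] qE] := AB q Aq.
  have /andP[r1 r2] := rI.
  have rho0 : 0 < rho by lra.
  have v00 : 0 <= v0 by rewrite divr_ge0 ?sqrtr_ge0 ?powR_ge0.
  have yv : `|y| <= v0 * I rho.
    by apply: (le_trans yI); rewrite ler_wpM2l// primitive_sqr_homo.
  have [] := @grushin_strip_reach R alpha x0 s z0 M rho y al0 s2 z01 M0 rho0 _ yv.
    by apply: le_trans xM; rewrite lerD2l ler_pM2l.
  move=> v [vv S vE]; exists (rho, v) => /=; last by rewrite -qE /Y vE.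
  by split => //=; rewrite /Y vE qE.
(* [Z] refers to all geodesics ending in [A]; by uniqueness each is a graph over the line, so [Z] is
   exactly the image of [D']. *)
have ZE : Z = [set (x0 + s * p.1, y0 + Y p.2 p.1) | p in D'].
  apply/seteqP; split=> [z [g [gg g0 Ag ->]]|_ [[r v] [rho [/= vv rI Ar] rE] <-]] /=.
    move: (Ag); rewrite {1}AE => -[[rho v] [/= vv rI Ar] qE].
    have t01 : 0 <= t <= 1 by rewrite (ltW t0).
    have [r [rE ->]] := strip_geodesic_unique (strip _ _ rI vv) gg g0 (esym qE) t01.
    by exists (r, v) => //; exists rho.
  have [_ [g [gg g0 g1 gE]]] := strip_geodesic y0 (strip _ _ rI vv).
  by exists g; split => //; rewrite ?g1// (gE _ _ rE).
(* Travel time and distance along the line differ by a factor between [1] and [k], which enters once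
   at [rho] and once at the intermediate point. *)
have D'I p : D' p -> t * lo / k <= p.1 <= t * k * hi.
  case: p => r v /= [rho [/= _ /andP[r1 r2] _] rE].
  have rho0 : 0 <= rho by lra.
  have /andP[p1 p2] : rho <= P v rho <= k * rho by exact: grushin_time_ge.
  have r0 : 0 <= r.
    rewrite -(grushin_time_le v _ _ z01 ch) grushin_time0 -/(P v r) rE.
    by rewrite mulr_ge0 ?(ltW t0)//; lra.
  have /andP[q1 q2] : r <= P v r <= k * r by exact: grushin_time_ge.
  have u1 : t * lo <= t * P v rho by rewrite ler_pM2l//; lra.
  have u2 : t * P v rho <= t * (k * hi).
    by rewrite ler_pM2l//; apply: (le_trans p2); rewrite ler_pM2l.
  rewrite ler_pdivrMr//; move: q1 q2; rewrite rE => q1 q2; apply/andP; split; lra.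
have UE : [set (P p.2 p.1, p.2) | p in D'] =
    [set (t * p.1, p.2) | p in [set (P p.2 p.1, p.2) | p in D]].
  apply/seteqP; split=> [_ [[r v] [/= rho Drv rE] <-]|_ [_ [[rho v] Drv <-] <-]] /=.
    by exists (P v rho, v); [exists (rho, v)|rewrite rE].
  have [X [XK _ _ _]] := grushin_time_inverse v z01 ch.
  exists (X (t * P v rho), v); last by rewrite /P XK.
  by exists rho => //=; rewrite /P XK.
have lo'0 : 0 < t * lo / k by rewrite divr_gt0 ?mulr_gt0.
have lohi' : t * lo / k <= t * k * hi.
  rewrite ler_pdivrMr// -!mulrA ler_pM2l//.
  have hi0 : 0 < hi by lra.
  have h1 : hi <= hi * k by rewrite ler_peMr// ltW.
  have h2 : hi * k <= k * (hi * k) by rewrite ler_peMl// mulr_ge0// ltW.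
  lra.
have I1 : 0 < I lo by exact: primitive_weight_gt0.
have I2 : 0 < I (t * lo / k) by exact: primitive_weight_gt0.
have I3 : 0 < I hi by apply: primitive_weight_gt0 => //; lra.
have I4 : 0 < I (t * k * hi).
  by apply: primitive_weight_gt0 => //; apply: lt_le_trans lohi'.
have DI p : D p -> lo <= p.1 <= hi by case.
have /andP[a1 a2] := area_grushin_chart x0 y0 z01 ch h0 s2 (ltW lo0) lohi I1 DI.
have /andP[z1 z2] := area_grushin_chart x0 y0 z01 ch h0 s2 (ltW lo'0) lohi' I2 D'I.
have /andP[u1 u2] := area_grushin_time D z01 ch.
have /andP[w1 w2] := area_grushin_time D' z01 ch.
rewrite -/P -/k in u1 u2; rewrite -/P -/k UE area_scale1// in w1 w2.
rewrite -/Y -AE -/(I lo) -/(I hi) -/k in a1 a2.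
rewrite -/Y -ZE -/(I (t * lo / k)) -/(I (t * k * hi)) -/k in z1 z2.
have le_mul (c : R) (a b : \bar R) : 0 < c -> (a <= b -> c%:E * a <= c%:E * b)%E.
  by move=> c0; apply: lee_wpmul2l; rewrite lee_fin ltW.
have assoc (c d e : R) (a : \bar R) : c * d = e -> (c%:E * (d%:E * a) = e%:E * a)%E.
  by move=> <-; rewrite muleA EFinM.
have k3 : 0 < k ^+ 3 by rewrite exprn_gt0.
(* The areas of [A], [D], [D] in time coordinates, its contraction by [t], [D'] and [Z] are compared
   in turn. One of the two charts costs [k ^ 3] and one of the two changes to time coordinates costs
   [k], whence [k ^ 4]. *)
split.
  apply: (le_trans (le_mul _ _ _ (mulr_gt0 t0 I2) a2)).
  have c0 : 0 < k ^+ 3 * I hi * I (t * lo / k) by rewrite !mulr_gt0.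
  rewrite (assoc _ _ (k ^+ 3 * I hi * I (t * lo / k) * t)); last by ring.
  rewrite EFinM -muleA; apply: (le_trans (le_mul _ _ _ c0 (le_mul _ _ _ t0 u1))).
  apply: (le_trans (le_mul _ _ _ c0 w2)).
  rewrite (assoc _ _ (k ^+ 4 * I hi * I (t * lo / k))); last by ring.
  by rewrite EFinM -muleA; apply: le_mul z1; rewrite mulr_gt0// exprn_gt0.
apply: (le_trans (le_mul _ _ _ I1 z2)).
have c0 : 0 < I lo * (k ^+ 3 * I (t * k * hi)) by rewrite !mulr_gt0.
rewrite (assoc _ _ (I lo * (k ^+ 3 * I (t * k * hi))))//.
apply: (le_trans (le_mul _ _ _ c0 w1)).
apply: (le_trans (le_mul _ _ _ c0 (le_mul _ _ _ t0 u2))).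
rewrite !(assoc _ _ _ _ erefl) (_ : _ * t * k = t * (k ^+ 4 * I (t * k * hi)) * I lo); last by ring.
rewrite EFinM -muleA; apply: le_mul a1.
by rewrite !mulr_gt0// exprn_gt0.
Qed.

Lemma limf_esup_le (R : realType) (T : choiceType) (X : filteredType T) (f : X -> \bar R)
  (F : set (set X)) (c : \bar R) : F [set x | (f x <= c)%E] -> (limf_esup f F <= c)%E.
Proof.
move=> Fc; rewrite limf_esupE; apply: (@le_trans _ _ (ereal_sup (f @` [set x | (f x <= c)%E]))).
  by apply: ereal_inf_lbound; exists [set x | (f x <= c)%E].
by apply: ge_ereal_sup => _ [x /= fx <-].
Qed.

Lemma limf_esup_ge (R : realType) (T : choiceType) (X : filteredType T) (f : X -> \bar R)
  (F : set_system X) (c : \bar R) : ProperFilter F -> F [set x | (c <= f x)%E] ->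
  (c <= limf_esup f F)%E.
Proof.
move=> PF Fc; rewrite limf_esupE; apply: le_ereal_inf_tmp => _ [V FV <-].
have [x [Vx /= cx]] := @filter_ex _ _ PF _ (filterI FV Fc).
by apply: (le_trans cx); apply: ereal_sup_ubound; exists x.
Qed.

Lemma grushin_ball_area_gt0 (R : realType) (alpha r : R) (p : R * R) :
  0 < alpha -> 0 < r -> (0 < area (grushin_ball alpha p r))%E.
Proof.
move=> al0 r0; apply: lt_le_trans (grushin_ball_area_ge p al0 (mul1r 1) r0).
rewrite lte_fin !mulr_gt0 ?divr_gt0 ?invr_gt0 ?powR_gt0 ?sqrtr_gt0//.
  by rewrite ltr_wpDl.
by apply: primitive_weight_gt0; rewrite ?mul1r// divr_gt0.
Qed.

Lemma grushin_ball_areaE (R : realType) (alpha r : R) (p : R * R) :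
  0 < alpha -> 0 < r -> exists2 a : R, 0 < a & area (grushin_ball alpha p r) = a%:E.
Proof.
move=> al0 r0; have := grushin_ball_area_gt0 p al0 r0.
have := @grushin_ball_area_fin R alpha r p al0.
by case: (area _) => [a| |]// _ a0; exists a.
Qed.

Lemma grushin_kappaE (R : realType) (k : R) : 1 <= k ->
  0 <= 1 - k ^- 2 < 1 /\ grushin_kappa (1 - k ^- 2) = k.
Proof.
move=> k1; have k0 : 0 < k by lra.
split.
  rewrite subr_ge0 ltrBlDr ltrDl invr_gt0 exprn_gt0// andbT.
  by rewrite invf_le1 ?exprn_gt0// exprn_ege1.
by rewrite /grushin_kappa opprB addrC subrK -exprVn sqrtr_sqr ger0_norm ?invrK// invr_ge0 ltW.
Qed.

Lemma grushin_ball_box0 (R : realType) (alpha x y d1 d2 : R) : 0 < alpha -> 0 < d1 -> 0 < d2 ->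
  \forall r \near (0 : R)^'+, grushin_ball alpha (x, y) r `<=`
    [set q | `|q.1 - x| <= d1 /\ `|q.2 - y| <= d2].
Proof.
move=> al0 d10 d20; pose C := (`|x| + 1) `^ alpha.
have C0 : 0 < C by rewrite powR_gt0// ltr_wpDl.
near=> r.
have r0 : 0 < r by near: r; exact: nbhs_right_gt.
have rd1 : r <= d1 by near: r; exact: nbhs_right_le.
have r1 : r <= 1 by near: r; exact: nbhs_right_le.
have rd2 : r <= d2 / C by near: r; apply: nbhs_right_le; exact: divr_gt0.
rewrite ler_pdivlMr// in rd2.
move=> q /(grushin_ball_box al0)[/= q1 q2]; split; first by lra.
apply: (le_trans q2); apply: le_trans rd2; rewrite mulrC ler_pM2l//.
by rewrite ge0_ler_powR ?nnegrE ?lerD2l// ?addr_ge0//; exact: ltW.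
Unshelve. all: by end_near. Qed.

Section distortion_on_line.
Context (R : realType) (alpha x0 y0 s rho t : R).
Hypotheses (al0 : 0 < alpha) (s2 : s * s = 1) (rho0 : 0 < rho) (t01 : 0 < t <= 1).
Let I := primitive (fun r => grushin_weight alpha x0 s r ^+ 2).

(** Small balls about the target lie over [[rho * (1 - e), rho * (1 + e)]], at heights reached with
    momentum small enough for [kappa = 1 + e]. The area comparison therefore bounds the ratio for
    every small radius, not only its upper limit. *)
Lemma distortion_sandwich (e : R) : 0 < e < 1 ->
  ((t * I (t * (rho * (1 - e)) / (1 + e)) / ((1 + e) ^+ 4 * I (rho * (1 + e))))%:E
    <= distortion alpha t (x0, y0) (x0 + s * rho, y0)%R
    <= (t * ((1 + e) ^+ 4 * I (t * (1 + e) * (rho * (1 + e)))) / I (rho * (1 - e)))%:E)%E.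
Proof.
move=> /andP[e0 e1]; have ke : 1 <= 1 + e by lra.
(* The truncation level is chosen so that [kappa] is [1 + e]; all multiplicative errors then tend to
   [1] with [e]. *)
have [z01 kE] := grushin_kappaE ke; set z0 := 1 - _ in z01 kE.
set lo := rho * (1 - e); set hi := rho * (1 + e).
have lo0 : 0 < lo by rewrite mulr_gt0//; lra.
have hi0 : 0 < hi by rewrite mulr_gt0//; lra.
have lohi : lo <= hi by rewrite ler_pM2l//; lra.
have I0 r : 0 < r -> 0 < I r by exact: primitive_weight_gt0.
pose M := `|x0| + (1 + e) * hi.
have M0 : 0 < M by rewrite ltr_wpDl// mulr_gt0//; lra.
have z00 : 0 < z0.
  by rewrite subr_gt0 invf_lt1 ?exprn_gt0 ?exprn_egt1//; lra.
have v0 : 0 < Num.sqrt z0 / M `^ alpha * I lo.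
  by rewrite mulr_gt0 ?I0// divr_gt0 ?sqrtr_gt0 ?powR_gt0.
have er0 : 0 < rho * e by rewrite mulr_gt0.
have box : \forall r \near (0 : R)^'+, grushin_ball alpha (x0 + s * rho, y0) r `<=`
    [set (x0 + s * u.1, y0 + u.2) | u in
     [set u | lo <= u.1 <= hi /\ `|u.2| <= Num.sqrt z0 / M `^ alpha * I lo]].
  apply: filterS (grushin_ball_box0 (x0 + s * rho) y0 al0 er0 v0) => r rB q /rB /= [q1 q2].
  exists (s * (q.1 - x0), q.2 - y0) => /=; last first.
    by rewrite mulrA s2 mul1r !subrKC -surjective_pairing.
  split => //; have qE : s * (q.1 - x0) - rho = s * (q.1 - (x0 + s * rho)).
    by rewrite -[X in _ - X = _]mul1r -s2; ring.
  have : `|s * (q.1 - x0) - rho| <= rho * e by rewrite qE normrM (grushin_sign_norm s2) mul1r.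
  rewrite /lo /hi ler_norml => /andP[? ?]; apply/andP; split; lra.
have ratio : \forall r \near (0 : R)^'+,
   ((t * I (t * lo / (1 + e)) / ((1 + e) ^+ 4 * I hi))%:E <=
    area (intermediate_points alpha t (x0, y0)
      (grushin_ball alpha (x0 + s * rho, y0)%R r)) /
    area (grushin_ball alpha (x0 + s * rho, y0)%R r) <=
    (t * ((1 + e) ^+ 4 * I (t * (1 + e) * hi)) / I lo)%:E)%E.
  apply: filterS2 box (nbhs_right_gt (0 : R)) => r rB r0.
  have [b b0 ab] := grushin_ball_areaE (x0 + s * rho, y0) al0 r0.
  have kM : `|x0| + grushin_kappa z0 * hi <= M by rewrite kE.
  have [] := area_intermediate_points al0 s2 z01 M0 lo0 lohi kM t01 rB.
  rewrite -/I kE ab inver gt_eqF// => h1 h2.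
  have D0 : 0 < (1 + e) ^+ 4 * I hi by rewrite mulr_gt0 ?I0// exprn_gt0//; lra.
  rewrite lee_pdivlMr// lee_pdivrMr//; apply/andP; split.
    by rewrite -EFinM mulrAC mulrC EFinM lee_pdivrMl.
  by rewrite -EFinM [X in (_ <= X%:E)%E]mulrAC [X in (_ <= X%:E)%E]mulrC EFinM lee_pdivlMl ?I0.
apply/andP; split.
  by apply: limf_esup_ge; apply: filterS ratio => r /andP[].
by apply: limf_esup_le; apply: filterS ratio => r /andP[].
Qed.

Lemma distortion_on_line :
  distortion alpha t (x0, y0) (x0 + s * rho, y0) = (t * I (t * rho) / I rho)%:E.
Proof.
have I0 : I rho != 0 by rewrite gt_eqF//; exact: primitive_weight_gt0.
have cI : continuous I.
  apply: is_derive_continuous; apply: is_derive_primitive.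
  exact/continuous_sqr_comp/continuous_grushin_weight.
have cD : 1 + e @[e --> (0 : R)] --> (1 : R).
  by rewrite -[X in _ --> X]addr0; apply: cvgD; [exact: cvg_cst|exact: cvg_id].
have cB : 1 - e @[e --> (0 : R)] --> (1 : R).
  by rewrite -[X in _ --> X]subr0; apply: cvgB; [exact: cvg_cst|exact: cvg_id].
have rD : rho * (1 + e) @[e --> (0 : R)] --> rho.
  by rewrite -[X in _ --> X]mulr1; apply: cvgM; [exact: cvg_cst|exact: cD].
have rB : rho * (1 - e) @[e --> (0 : R)] --> rho.
  by rewrite -[X in _ --> X]mulr1; apply: cvgM; [exact: cvg_cst|exact: cB].
have cM1 (f g : R -> R) : f e @[e --> (0 : R)] --> (1 : R) ->
    g e @[e --> (0 : R)] --> (1 : R) -> f e * g e @[e --> (0 : R)] --> (1 : R).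
  by rewrite -[X in _ -> _ -> _ --> X]mulr1; exact: cvgM.
have c4 : (1 + e) ^+ 4 @[e --> (0 : R)] --> (1 : R).
  rewrite (_ : (fun e => _) = fun e : R => (1 + e) * (1 + e) * ((1 + e) * (1 + e))); last first.
    by apply/funext => e; ring.
  by apply: (cM1); apply: (cM1).
set L := t * I (t * rho) / I rho.
have lower : t * I (t * (rho * (1 - e)) / (1 + e)) / ((1 + e) ^+ 4 * I (rho * (1 + e)))
    @[e --> (0 : R)] --> L.
  rewrite (_ : L = t * I (t * rho / 1) / (1 * I rho)); last by rewrite divr1 mul1r.
  apply: cvgM.
    apply: cvgM; first exact: cvg_cst.
    apply: continuous_cvg; first exact: cI.
    apply: cvgM; first by apply: cvgM; [exact: cvg_cst|].
    by apply: cvgV; [exact: oner_neq0|exact: cD].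
  apply: cvgV; first by rewrite mul1r.
  by apply: cvgM => //; apply: continuous_cvg => //; exact: cI.
have upper : t * ((1 + e) ^+ 4 * I (t * (1 + e) * (rho * (1 + e)))) / I (rho * (1 - e))
    @[e --> (0 : R)] --> L.
  rewrite (_ : L = t * (1 * I (t * 1 * rho)) / I rho); last by rewrite mulr1 mul1r.
  apply: cvgM; last by apply: cvgV => //; apply: continuous_cvg => //; exact: cI.
  apply: cvgM; first exact: cvg_cst.
  apply: cvgM => //; apply: continuous_cvg; first exact: cI.
  by apply: cvgM => //; apply: cvgM; [exact: cvg_cst|exact: cD].
have nbhs01 : \forall e \near (0 : R)^'+, 0 < e < 1.
  near=> e; apply/andP; split; near: e; [exact: nbhs_right_gt|exact: nbhs_right_lt].
have toE (f : R -> R) : f e @[e --> (0 : R)] --> L -> (f e)%:E @[e --> (0 : R)^'+] --> L%:E.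
  by move=> fL; apply: cvg_EFin; [exact: nearW|exact: cvg_at_right_filter].
apply/eqP; rewrite eq_le; apply/andP; split.
  apply: (cvge_to_ge (toE _ upper)).
  by apply: filterS nbhs01 => e /distortion_sandwich/andP[].
apply: (cvge_to_le (toE _ lower)).
by apply: filterS nbhs01 => e /distortion_sandwich/andP[].
Unshelve. all: by end_near. Qed.

End distortion_on_line.

(** * Distortion at the base point *)

(* As [v] tends to [`|x0| `^ (- alpha)], the geodesics become vertical at [x0]. *)
Lemma exists_grushin_sector (R : realType) (alpha x0 K : R) : 0 < alpha -> x0 != 0 -> 0 < K ->
  exists z0 v0 M : R, [/\ 0 <= z0 < 1, `|x0| < M, (v0 * M `^ alpha) ^+ 2 <= z0, 0 <= v0 &
    forall s rho : R, s * s = 1 -> 0 <= rho <= M - `|x0| ->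
      K * rho <= grushin_height (grushin_weight alpha x0 s) z0 v0 rho].
Proof.
move=> al0 x00 K0; set a : R := `|x0|; have a0 : 0 < a by rewrite normr_gt0.
have aa : 0 < a `^ alpha by exact: powR_gt0.
(* [e] will bound the horizontal speed near [x0]. There [(v0 * h) ^ 2 >= 1 - e ^ 2 >= 3 / 4], so the
   slope [v0 * h ^ 2 / q] is at least [3 / 4] of the weight at [x0] divided by [e], hence at least
   [K]. *)
pose e := Num.min (1 / 2) (3 / 4 * a `^ alpha / K).
have e0 : 0 < e by rewrite lt_min; apply/andP; split; [lra|rewrite divr_gt0// mulr_gt0//; lra].
have e2 : e <= 1 / 2 by rewrite ge_min lexx.
have eK : K * e <= 3 / 4 * a `^ alpha.
  by rewrite mulrC -ler_pdivlMr// ge_min lexx orbT.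
have ee : 0 < e ^+ 2 by rewrite exprn_gt0.
have ee4 : e ^+ 2 <= 1 / 4 by rewrite expr2; nra.
(* At [x0] the quantity [(v0 * h) ^ 2] is [1 - e ^ 2 / 2], strictly between [1 - e ^ 2] and the
   truncation level [1 - e ^ 2 / 4]; by continuity it stays between them on a neighbourhood, which
   fixes [M]. *)
pose v0 := Num.sqrt (1 - e ^+ 2 / 2) / a `^ alpha.
have v00 : 0 < v0 by rewrite divr_gt0// sqrtr_gt0; lra.
pose phi (x : R) := (v0 * `|x| `^ alpha) ^+ 2.
have phia : phi a = 1 - e ^+ 2 / 2.
  by rewrite /phi normr_id divfK ?gt_eqF// sqr_sqrtr//; lra.
have cphi : {for a, continuous phi}.
  apply: (continuous_sqr_comp (h := fun x => v0 * `|x| `^ alpha)) => x.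
  by apply: cvgM; [exact: cvg_cst|exact: continuous_norm_powR].
have : \forall x \near a, `|phi a - phi x| <= e ^+ 2 / 4.
  by move/cvgrPdist_le: cphi; apply; rewrite divr_gt0.
move=> /nbhs_ballP[d /= d0 dphi].
pose M : R := a + d / 2.
have phiM (x : R) : `|x - a| <= d / 2 -> 1 - e ^+ 2 <= phi x <= 1 - e ^+ 2 / 4.
  move=> xa; have xd : `|a - x| < d by rewrite distrC; lra.
  have := dphi x xd; rewrite /= phia ler_norml => /andP[? ?].
  by apply/andP; split; lra.
exists (1 - e ^+ 2 / 4), v0, M; split.
- by apply/andP; split; lra.
- by rewrite /M; lra.
- have : `|M - a| <= d / 2 by rewrite /M addrC addKr ger0_norm; lra.
  by move=> /phiM/andP[_]; rewrite /phi ger0_norm// /M; lra.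
- exact: ltW.
move=> s rho s2 /andP[r0 rM].
set h := grushin_weight alpha x0 s; set z0 := 1 - e ^+ 2 / 4.
have z01 : 0 <= z0 < 1 by rewrite /z0; apply/andP; split; lra.
have ch : continuous h by exact: continuous_grushin_weight.
rewrite -[leRHS]subr0 -[X in _ <= _ - X](grushin_height0 h z0 v0).
have KC (x : R) : 0 <= x <= rho -> K <= v0 * h x ^+ 2 / grushin_speed h z0 v0 x.
  move=> /andP[x0' xr].
  have /phiM/andP[p1 p2] : `| `|x0 + s * x| - a| <= d / 2.
    rewrite (le_trans (ler_dist_dist _ _))// addrAC subrr add0r normrM (grushin_sign_norm s2).
    by rewrite mul1r ger0_norm//; move: rM; rewrite /M; lra.
  rewrite /phi normr_id -/(grushin_weight alpha x0 s x) -/(h x) in p1 p2.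
  have qe : grushin_speed h z0 v0 x <= e.
    rewrite -[leRHS]ger0_norm ?(ltW e0)// -sqrtr_sqr ler_wsqrtr//.
    by rewrite minElt; case: ifP => _; rewrite /z0; lra.
  have q0 := grushin_speed_gt0 h v0 x z01.
  rewrite ler_pdivlMr//; apply: (@le_trans _ _ (K * e)); first by rewrite ler_pM2l.
  rewrite -(ler_pM2l v00).
  have vK : v0 * (K * e) <= 3 / 4.
    apply: (@le_trans _ _ (v0 * (3 / 4 * a `^ alpha))); first by rewrite ler_pM2l.
    rewrite mulrCA /v0 divfK ?gt_eqF//.
    have : Num.sqrt (1 - e ^+ 2 / 2) <= 1 by rewrite -[leRHS]sqrtr1 ler_wsqrtr//; lra.
    lra.
  apply: (le_trans vK); have -> : v0 * (v0 * h x ^+ 2) = (v0 * h x) ^+ 2 by ring.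
  lra.
have cK : continuous (fun _ : R => K) by exact: cst_continuous.
have cY := @continuous_grushin_height_deriv R h z0 v0 z01 ch.
have := primitive_homo r0 cK cY KC.
by rewrite !primitive_cst mulr0 subr0.
Qed.

(** The direction [sg p.1] leads away from the singular line, so the weight stays above its value at
    [p] and the primitive at [r / 4] is at least linear in [r]. *)
Lemma grushin_ball_area_quadratic (R : realType) (alpha : R) (p : R * R) : 0 < alpha ->
  p.1 != 0 -> exists2 c : R, 0 < c &
  forall r : R, 0 < r <= 1 -> ((c * r ^+ 2)%:E <= area (grushin_ball alpha p r))%E.
Proof.
move=> al0 p0; set a : R := `|p.1|; have a0 : 0 < a by rewrite normr_gt0.
pose s := Num.sg p.1; have s2 : s * s = 1 by rewrite -expr2 sqr_sg p0.
pose w := (a `^ alpha) ^+ 2; have w0 : 0 < w by rewrite exprn_gt0 ?powR_gt0.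
pose v := Num.sqrt (3 / 4) / (a + 1) `^ alpha.
have v0 : 0 < v by rewrite divr_gt0 ?sqrtr_gt0 ?powR_gt0 ?addr_gt0//; lra.
exists (v * w / 16) => [|r /andP[r0 r1]]; first by rewrite divr_gt0// mulr_gt0.
apply: le_trans (grushin_ball_area_ge p al0 s2 r0); rewrite lee_fin.
have Iw : w * (r / 4) <= primitive (fun u => grushin_weight alpha p.1 s u ^+ 2) (r / 4).
  rewrite -[X in _ * X]subr0; apply: primitive_ge => //; first last.
  - move=> x /andP[x0 _]; rewrite ler_sqr ?nnegrE ?powR_ge0//.
    rewrite ge0_ler_powR ?nnegrE ?(ltW a0) ?(ltW al0)//.
    rewrite (_ : p.1 + s * x = s * (a + x)); last by rewrite mulrDr /a -numEsg.
    rewrite normrM (grushin_sign_norm s2) mul1r (le_trans _ (ler_norm _))//.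
    by rewrite /a; lra.
  - lra.
  - by move=> x _; exact: sqr_ge0.
  - exact/continuous_sqr_comp/continuous_grushin_weight.
have vr : v <= Num.sqrt (3 / 4) / (a + r) `^ alpha.
  rewrite /v ler_pM2l ?sqrtr_gt0 ?divr_gt0// lef_pV2 ?posrE ?powR_gt0 ?addr_gt0//.
  by rewrite ge0_ler_powR ?nnegrE ?lerD2l// ?addr_ge0 ?(ltW al0) ?(ltW a0) ?(ltW r0).
have -> : v * w / 16 * r ^+ 2 = r / 8 * (2 * (v * (w * (r / 4)))) by field.
rewrite !ler_pM2l ?divr_gt0//; apply: ler_pM => //.
- exact: ltW.
- by rewrite mulr_ge0 ?(ltW w0)//; lra.
Qed.

(* A geodesic from [p] to [q] of length less than [t * r] extends to one of length
   [1 / t] times as large. *)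
Lemma intermediate_ball_sector (R : realType) (alpha K : R) (p : R * R) :
  0 < alpha -> p.1 != 0 -> 0 < K ->
  exists2 r1 : R, 0 < r1 & forall r t : R, 0 < r <= r1 -> 0 < t <= 1 ->
    forall q, grushin_ball alpha p (t * r) q -> q.1 != p.1 ->
      `|q.2 - p.2| <= K * `|q.1 - p.1| ->
    intermediate_points alpha t p (grushin_ball alpha p r) q.
Proof.
move=> al0; case: p => x0 y0 /= x00 K0.
have [z0 [v0 [M [z01 xM vM v00 KY]]]] := exists_grushin_sector al0 x00 K0.
have k1 := kappa_ge1 z01; set k := grushin_kappa z0 in k1.
have k0 : 0 < k by exact: lt_le_trans k1.
exists ((M - `|x0|) / k) => [|r t /andP[r0 rM] /andP[t0 t1] q qB qx qK].
  by rewrite divr_gt0// subr_gt0.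
rewrite ler_pdivlMr// mulrC in rM.
pose s := Num.sg (q.1 - x0).
have s2 : s * s = 1 by rewrite -expr2 sqr_sg subr_eq0 qx.
pose rho : R := `|q.1 - x0|.
have rho0 : 0 < rho by rewrite normr_gt0 subr_eq0.
have qE : q.1 = x0 + s * rho by rewrite /s -numEsg subrKC.
have rhor : rho <= t * r by have [/= /ltW] := grushin_ball_box al0 qB.
have tr : t * r <= r by rewrite ler_piMl// ltW.
have krho : k * rho <= k * r by rewrite ler_pM2l//; lra.
set h := grushin_weight alpha x0 s.
have ch : continuous h by exact: continuous_grushin_weight.
have h0 : forall r, 0 <= h r by move=> ?; exact: grushin_weight_ge0.
have rhok : rho <= k * rho by rewrite ler_peMl// ltW.
have yK : `|q.2 - y0| <= grushin_height h z0 v0 rho.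
  have rhoM : 0 <= rho <= M - `|x0| by rewrite (ltW rho0)/=; lra.
  exact: (le_trans qK (KY s rho s2 rhoM)).
have [v [vv vE]] := grushin_height_surj z01 ch h0 (ltW rho0)
  (primitive_weight_gt0 x0 al0 s2 rho0) yK.
have strip rho' : 0 <= rho' -> `|x0| + grushin_time h z0 v rho' <= M ->
    grushin_strip alpha x0 s z0 M v rho'.
  move=> rho'0 xM'; split => //; apply: le_trans vM.
  have M0 : 0 <= M by apply: ltW; apply: le_lt_trans xM.
  by rewrite -[leLHS]real_normK ?num_real// normrM (ger0_norm (powR_ge0 _ _)) ler_sqr
    ?nnegrE ?mulr_ge0 ?powR_ge0// ler_wpM2r ?powR_ge0.
have /andP[P1 P2] := grushin_time_ge v z01 ch (ltW rho0).
have S : grushin_strip alpha x0 s z0 M v rho.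
  by apply: strip; [exact: ltW|rewrite -/k in P2; lra].
have qEE : q = (x0 + s * rho, y0 + grushin_height h z0 v rho).
  by rewrite vE -qE subrKC -surjective_pairing.
have [dq _] := strip_geodesic y0 S.
have Ptr : grushin_time h z0 v rho < t * r.
  by move: qB; rewrite /grushin_ball/= {1}qEE dq lte_fin.
have [X [XK _ _ _]] := grushin_time_inverse v z01 ch.
pose rho' := X (grushin_time h z0 v rho / t).
have PE : grushin_time h z0 v rho = t * grushin_time h z0 v rho'.
  by rewrite /rho' XK mulrC divfK ?gt_eqF.
have Pr : grushin_time h z0 v rho' < r by rewrite -(ltr_pM2l t0) -PE.
have rho'0 : 0 <= rho'.
  rewrite -(grushin_time_le v _ _ z01 ch) grushin_time0 -(ler_pM2l t0) mulr0 -PE; lra.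
have S' : grushin_strip alpha x0 s z0 M v rho'.
  apply: strip => //; have : 1 * r <= k * r by rewrite ler_pM2r.
  lra.
have [dq' [g [gg g0 g1 gE]]] := strip_geodesic y0 S'.
exists g; split => //.
  by rewrite g1 /grushin_ball/= dq' lte_fin.
by rewrite (gE _ _ PE) -qEE.
Qed.

(* The points of the ball missed by the sector lie in a box of height of order
   [t * r] and of width of order [t * r / K]. *)
Lemma area_intermediate_ball (R : realType) (alpha e : R) (p : R * R) :
  0 < alpha -> p.1 != 0 -> 0 < e ->
  exists2 r1 : R, 0 < r1 & forall r t : R, 0 < r <= r1 -> 0 < t <= 1 ->
    (area (grushin_ball alpha p (t * r)) <=
     area (intermediate_points alpha t p (grushin_ball alpha p r)) +
     e%:E * area (grushin_ball alpha p (t * r)))%E.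
Proof.
move=> al0 p0 e0; have [c c0 cB] := grushin_ball_area_quadratic al0 p0.
pose C := (`|p.1| + 1) `^ alpha.
have C0 : 0 < C by rewrite powR_gt0// ltr_wpDl.
(* With this slope the box [B] below has area [4 * C ^ 2 * u ^ 2 / K = e * (c * u ^ 2)], at most the
   proportion [e] of the ball. *)
pose K := 4 * C ^+ 2 / (c * e).
have K0 : 0 < K by rewrite divr_gt0 ?mulr_gt0 ?exprn_gt0.
have [r1 r10 H] := intermediate_ball_sector al0 p0 K0.
exists (Num.min r1 1) => [|r t]; first by rewrite lt_min r10 ltr01.
rewrite le_min => /andP[r0 /andP[rr1 r1']] t01; have /andP[t0 t1] := t01.
set u := t * r; have u0 : 0 < u by rewrite mulr_gt0.
have u1 : u <= 1 by rewrite mulr_ile1// ltW.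
pose d := C * u / K; have d0 : 0 < d by rewrite !divr_gt0 ?mulr_gt0.
have Cu0 : 0 < C * u by rewrite mulr_gt0.
set Z := intermediate_points _ _ _ _.
pose B := `[p.1 - d, p.1 + d] `*` `[p.2 - C * u, p.2 + C * u].
have sub : grushin_ball alpha p u `<=` Z `|` B.
  move=> q qB; have [/= q1 q2] := grushin_ball_box al0 qB.
  have qC : `|q.2 - p.2| <= C * u.
    apply: (le_trans q2); rewrite ler_pM2r// ge0_ler_powR ?nnegrE ?lerD2l//; first exact: ltW.
    by rewrite addr_ge0// ltW.
  have inB : `|q.1 - p.1| <= d -> B q.
    move: qC; rewrite !ler_norml => /andP[? ?] /andP[? ?].
    by split; rewrite /= in_itv/=; apply/andP; split; lra.
  have [qp|qp] := eqVneq q.1 p.1; first by right; apply: inB; rewrite qp subrr normr0 ltW.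
  have [qK|qK] := leP `|q.2 - p.2| (K * `|q.1 - p.1|); first by left; apply: H => //; rewrite r0.
  right; apply: inB; rewrite /d ler_pdivlMr// mulrC; lra.
apply: (le_trans (le_area sub)); apply: (le_trans (areaU _ _)); rewrite leeD2l//.
have -> : area B = (e * (c * u ^+ 2))%:E.
  rewrite area_box; [congr EFin; rewrite /d /K; field|lra|lra].
  by rewrite !gt_eqF.
by rewrite EFinM; apply: lee_wpmul2l; [rewrite lee_fin ltW|apply: cB; rewrite u0].
Qed.

Lemma distortion_base (R : realType) (alpha N t : R) (p : R * R) :
  0 < alpha -> p.1 != 0 -> 2 <= N -> 0 < t <= 1 ->
  ((t `^ N)%:E <= distortion alpha t p p)%E.
Proof.
move=> al0 p0 N2 t01; have /andP[t0 t1] := t01.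
have t2 : 0 < t ^+ 2 by rewrite exprn_gt0.
apply: (@le_trans _ _ (t ^+ 2)%:E).
  by rewrite lee_fin -powR_mulrn ?(ltW t0)// ger_powR// t0.
(* The upper limit is an infimum of suprema: if it is below [t ^ 2], so is the supremum [S] of the
   ratio over some neighbourhood [V]. *)
rewrite leNgt; apply/negP => /ereal_inf_lt[_ [V FV <-]].
pose a r := area (grushin_ball alpha p r).
set f := fun r => (_ / area _)%E; set S := ereal_sup _ => St.
have f0 r : 0 < r -> (0 <= f r)%E.
  move=> r0; rewrite /f; have [b b0 ->] := grushin_ball_areaE p al0 r0.
  by rewrite inver gt_eqF// mule_ge0 ?area_ge0// lee_fin invr_ge0 ltW.
have fS r : V r -> (f r <= S)%E by move=> Vr; apply: ereal_sup_ubound; exists r.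
have [r0 [Vr0 /= r00]] := @filter_ex _ _ _ _ (filterI FV (nbhs_right_gt (0 : R))).
have S0 : (0 <= S)%E by apply: le_trans (f0 _ r00) (fS _ Vr0).
move: S St fS S0 => [b| |]//; rewrite lte_fin => bt fb; rewrite lee_fin => b0.
(* Then [1 - e] is the midpoint of [b / t ^ 2] and [1], so losing the proportion [e] of the ball
   still leaves the contraction factor [th] below [1]. *)
pose e := (1 - b / t ^+ 2) / 2.
have bt2 : b / t ^+ 2 < 1 by rewrite ltr_pdivrMr ?mul1r.
have e0 : 0 < e by rewrite /e; lra.
have bt0 : 0 <= b / t ^+ 2 by rewrite divr_ge0// ltW.
have e1 : e < 1 by rewrite /e; lra.
pose th := b / (1 - e) / t ^+ 2.
have th1 : 0 <= th < 1.
  rewrite /th mulrAC divr_ge0//=; last lra.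
  by rewrite ltr_pdivrMr /e; lra.
have [r1 r10 H] := area_intermediate_ball al0 p0 e0.
have [c c0 cB] := grushin_ball_area_quadratic al0 p0.
move: FV => /nbhs_ballP[d /= d0 dV].
pose r2 := Num.min (d / 2) (Num.min r1 1).
have r20 : 0 < r2 by rewrite !lt_min r10 ltr01 divr_gt0.
have [r2d r2r1 r21] : [/\ r2 <= d / 2, r2 <= r1 & r2 <= 1].
  by rewrite /r2; split; rewrite !ge_min lexx ?orbT.
pose A r : R := fine (a r).
have aA (r : R) : 0 < r -> a r = (A r)%:E.
  by move=> r_0; rewrite /A /a; have [x _ ->] := grushin_ball_areaE p al0 r_0.
have step (r : R) : 0 < r <= r2 -> A (t * r) <= th * t ^+ 2 * A r.
  move=> /andP[r_0 rr2].
  have Vr : V r.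
    by apply: dV => //; rewrite /ball/= sub0r normrN gtr0_norm//; lra.
  have rr1 : 0 < r <= r1 by rewrite r_0/=; lra.
  have := H r t rr1 t01; have := fb r Vr; rewrite /f -/(a r) aA// -/(a (t * r)).
  rewrite aA ?mulr_gt0//; set z := area _.
  have Ar : 0 < A r by have := grushin_ball_area_gt0 p al0 r_0; rewrite -/(a r) aA.
  rewrite inver gt_eqF// lee_pdivrMr// -EFinM => zb.
  have := area_ge0 (intermediate_points alpha t p (grushin_ball alpha p r)); rewrite -/z.
  case: z zb => [z| |]//; rewrite !lee_fin => zb z0 Hz.
  rewrite /th divfK ?gt_eqF// mulrAC ler_pdivlMr; lra.
(* Iterating [step] contradicts the quadratic lower bound on the area of balls. *)
have geo k : A (t ^+ k * r2) <= (th * t ^+ 2) ^+ k * A r2.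
  elim: k => [|k IH]; first by rewrite !expr0 !mul1r.
  have tk : 0 < t ^+ k <= 1 by rewrite exprn_gt0// exprn_ile1// ltW.
  rewrite exprS -mulrA; apply: (le_trans (step _ _)).
    have /andP[tk0 tk1] := tk.
    by rewrite mulr_gt0//= ler_piMl// ltW.
  by rewrite [in leRHS]exprS -[leRHS]mulrA ler_wpM2l// mulr_ge0 ?(ltW t2)//; case/andP: th1.
have low k : c * r2 ^+ 2 <= th ^+ k * A r2.
  have /andP[tk0 tk1] : 0 < t ^+ k <= 1 by rewrite exprn_gt0// exprn_ile1// ltW.
  have tr0 : 0 < t ^+ k * r2 by rewrite mulr_gt0.
  have tr1 : 0 < t ^+ k * r2 <= 1.
    by rewrite tr0 mulr_ile1// ltW.
  have := cB _ tr1; rewrite -/(a _) aA// lee_fin => h1.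
  have := le_trans h1 (geo k).
  rewrite [X in c * X]exprMn mulrCA -exprM mulnC exprM [in leRHS]exprMn.
  by rewrite (mulrC (th ^+ k)) -mulrA ler_pM2l// exprn_gt0.
have Ar : 0 < A r2 by have := grushin_ball_area_gt0 p al0 r20; rewrite -/(a r2) aA.
have /andP[th0 th1'] := th1.
have thk : th ^+ n @[n --> \oo] --> (0 : R) by apply: cvg_expr; rewrite ger0_norm.
have cr : 0 < c * r2 ^+ 2 / A r2 by rewrite divr_gt0// mulr_gt0// exprn_gt0.
move/cvgrPdist_lt/(_ _ cr): thk => -[k _ /(_ k (leqnn k))] /=.
rewrite sub0r normrN ger0_norm ?exprn_ge0// ltr_pdivlMr//.
by have := low k; lra.
Qed.

(** * The sharp exponent *)

Lemma sqr_powR (R : realType) (z a : R) : (z ^+ 2) `^ a = `|z| `^ (2 * a).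
Proof. by rewrite -real_normK ?num_real// -powR_mulrn// powRrM. Qed.

Lemma distortion_ge0 (R : realType) (alpha t : R) (p q : R * R) :
  0 < alpha -> (0 <= distortion alpha t p q)%E.
Proof.
move=> al0; apply: limf_esup_ge; apply: filterS (nbhs_right_gt (0 : R)) => r r0 /=.
have [b b0 ->] := grushin_ball_areaE q al0 r0.
by rewrite inver gt_eqF// mule_ge0 ?area_ge0// lee_fin invr_ge0 ltW.
Qed.

Lemma distortion_ge (R : realType) (alpha u N t : R) (q0 q : R * R) :
  1 <= alpha -> 1 <= u ->
  u `^ (2 * alpha + 1) + 1 = (2 * alpha + 1) * (u + 1) -> 1 + u `^ (2 * alpha) <= N ->
  q0.1 != 0 -> q.2 = q0.2 -> 0 <= t <= 1 ->
  ((t `^ N)%:E <= distortion alpha t q0 q)%E.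
Proof.
move=> al1 u1 uE Nu; case: q0 q => [x0 y0] [x1 y1] /= x00 -> /andP[t0 t1].
have al0 : 0 < alpha by lra.
have u0 : 0 < u by lra.
have b1 : 1 <= 2 * alpha by lra.
set n := u `^ (2 * alpha) in Nu.
(* This gives [N >= 2], as [distortion_base] requires in the case [q = q0]. *)
have n1 : 1 <= n.
  apply: le_trans (powR_bernoulli (ltW u0) b1).
  by rewrite lerDl mulr_ge0//; lra.
move: t0; rewrite le_eqVlt => /predU1P[<-|t0].
  by rewrite powR0 ?distortion_ge0// gt_eqF//; lra.
have t01 : 0 < t <= 1 by rewrite t0.
have [->|x10] := eqVneq x1 x0; first by apply: distortion_base => //; lra.
pose s := Num.sg (x1 - x0); pose rho : R := `|x1 - x0|.
have s2 : s * s = 1 by rewrite -expr2 sqr_sg subr_eq0 x10.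
have rho0 : 0 < rho by rewrite normr_gt0 subr_eq0.
have -> : x1 = x0 + s * rho by rewrite /s -numEsg subrKC.
pose I := primitive (fun r => `|x0 + s * r| `^ (2 * alpha)).
have I0 : 0 < I rho by rewrite /I -sqr_weight; exact: primitive_weight_gt0.
rewrite distortion_on_line// lee_fin sqr_weight -/I ler_pdivlMr//.
apply: (@le_trans _ _ (t * (t `^ n * I rho))).
  rewrite mulrA ler_pM2r// mulr_powRD1 ?(ltW t0)//; last lra.
  by rewrite ger_powR ?t0//; lra.
rewrite ler_pM2l//; apply: primitive_powR_scale => //.
  by rewrite -sqr_weight; exact/continuous_sqr_comp/continuous_grushin_weight.
by move=> y y0'; apply: primitive_norm_powR_le.
Qed.

(** A single end point is tested, the extremal one on the far side of the singular line; the
    inequalities for [t] close to [1] already force the bound. *)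
Lemma distortion_exponent_ge (R : realType) (alpha u N : R) (q0 : R * R) :
  1 <= alpha -> 1 <= u ->
  u `^ (2 * alpha + 1) + 1 = (2 * alpha + 1) * (u + 1) -> q0.1 != 0 ->
  (forall q : R * R, q.2 = q0.2 -> forall t : R, 0 <= t <= 1 ->
    ((t `^ N)%:E <= distortion alpha t q0 q)%E) ->
  1 + u `^ (2 * alpha) <= N.
Proof.
move=> al1 u1 uE; case: q0 => x0 y0 /= x00 H.
have al0 : 0 < alpha by lra.
have u0 : 0 < u by lra.
have b1 : 1 <= 2 * alpha by lra.
pose s := - Num.sg x0; pose rho : R := (1 + u) * `|x0|.
have s2 : s * s = 1 by rewrite mulrNN -expr2 sqr_sg x00.
have rho0 : 0 < rho by rewrite mulr_gt0 ?normr_gt0//; lra.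
pose w (r : R) := `|x0 + s * r| `^ (2 * alpha).
have I0 : 0 < primitive w rho.
  by rewrite /w -sqr_weight; exact: primitive_weight_gt0.
have cw : continuous w.
  by rewrite /w -sqr_weight; exact/continuous_sqr_comp/continuous_grushin_weight.
have wE : rho * w rho = u `^ (2 * alpha) * primitive w rho.
  exact: (primitive_norm_powR_critical b1 x00 u0 uE).
 have scale (t : R) : 0 < t <= 1 -> t `^ N * primitive w rho <= t * primitive w (t * rho).
  move=> t01; have := H (x0 + s * rho, y0) erefl t.
  rewrite distortion_on_line// lee_fin sqr_weight -/w ler_pdivlMr//; apply.
  by case/andP: t01 => /ltW-> ->.
have := primitive_powR_scale_inv cw scale.
by move=> Nw; rewrite -(ler_pM2r I0) mulrDl mul1r -wE.
Qed.

Theorem proposition26 (R : realType) (alpha : R) (halpha : 1 <= alpha) :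
  let eqn := fun m : R =>
    ((m + 1) ^+ 2) `^ alpha * (m + 1) - ((2 * alpha + 1) * m + 1) = 0 in
  exists m_alpha : R,
    [/\ -3 <= m_alpha <= -2,
        m_alpha != 0 /\ eqn m_alpha,
        forall m : R, m != 0 -> eqn m -> m = m_alpha &
        forall (q0 : R * R) (N : R), q0.1 != 0 ->
          ((forall q : R * R, q.2 = q0.2 ->
              forall t : R, 0 <= t <= 1 ->
                ((t `^ N)%:E <= distortion alpha t q0 q)%E)
           <->
           N >= 2 * (((alpha + 1) * m_alpha + 1) / (m_alpha + 1)))].
Proof.
have [|u /andP[u1 u2] uE] := @exists_grushin_critical R (2 * alpha); first by lra.
have u0 : 0 < u by lra.
have uu : u * u `^ (2 * alpha) = u `^ (2 * alpha + 1) by rewrite mulr_powRD1; lra.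
move=> eqn; exists (- 1 - u).
(* After multiplication by [u], this is the equation satisfied by [u]. *)
have NE : 2 * (((alpha + 1) * (- 1 - u) + 1) / (- 1 - u + 1)) = 1 + u `^ (2 * alpha).
  have -> : - 1 - u + 1 = - u by ring.
  have un0 : u != 0 by rewrite gt_eqF.
  apply: (mulfI un0); rewrite [in RHS]mulrDr uu mulr1.
  have -> : u `^ (2 * alpha + 1) = (2 * alpha + 1) * (u + 1) - 1 by lra.
  by field.
split.
- by apply/andP; split; lra.
- split; first by rewrite lt_eqF//; lra.
  rewrite /eqn sqr_powR (_ : - 1 - u + 1 = - u); last by ring.
  by rewrite normrN gtr0_norm// mulrN mulrC uu; lra.
- move=> m m0; rewrite /eqn sqr_powR => mE.
  suff : m + 1 = - u by lra.
  apply: (@grushin_critical_unique R (2 * alpha)) => //; [lra|lra|].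
  by apply: contra m0 => /eqP ?; apply/eqP; lra.
move=> q0 N x00; rewrite NE; split; first exact: distortion_exponent_ge.
by move=> Nu q qq t t01; exact: distortion_ge Nu x00 qq t01.
Qed.
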